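(* Fix a realization of $\mathrm{sh}^{(n)}$ as $\mathrm{sh}_A\subset\mathbb P(M^A)$, where $A=(a_1,\ldots,a_n)\in\mathbb N^n$ (positive integers), $a_1<\cdots<a_n$. Let $\mathrm G=SL_2(\mathbb C[t]/t^n)$. Then there is a $\mathrm G$-equivariant isomorphism ${\bf F}_n\to\mathrm{sh}^{(n)}$ sending the point $[P]$ to $[v_A]$.
   Context: Fusion products. Let $e,h,f$ be the standard basis of $\mathfrak{sl}_2(\mathbb C)$ and write $x_j=x\otimes t^j$. For positive integers $A=(a_1,\ldots,a_n)$ choose pairwise distinct $z_1,\ldots,z_n\in\mathbb C$, let $\mathbb C^{a}$ be the $a$-dimensional irreducible $\mathfrak{sl}_2$-module, and $\mathbb C^{a_i}(z_i)$ the $\mathfrak{sl}_2\otimes\mathbb C[t]$-module on which $x_j$ acts as $z_i^jx$. Let $\overline{v_A}\in\bigotimes_i\mathbb C^{a_i}(z_i)$ be the tensor product of lowest weight vectors and $F_s$ the span of all $x^{(1)}_{i_1}\cdots x^{(k)}_{i_k}\overline{v_A}$ with $x^{(j)}\in\mathfrak{sl}_2$, $i_1+\cdots+i_k\le s$. The fusion product is the associated graded $\mathfrak{sl}_2\otimes\mathbb C[t]$-module $M^A=\bigoplus_sF_s/F_{s-1}$, with $v_A$ the image of $\overline{v_A}$. Known facts: $\mathfrak{sl}_2\otimes t^j$ acts by $0$ for $j\ge n$; $M^A=\mathbb C[e_0,\ldots,e_{n-1}]v_A\simeq\mathbb C[e_0,\ldots,e_{n-1}]/I_A$ with $I_A$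 generated by $\sum_{i_1+\cdots+i_k=s}e_{n-1-i_1}\cdots e_{n-1-i_k}$ for $k\ge1$, $s<\sum_{j=1}^n\max(k+1-a_j,0)$ (so $M^A$ does not depend on the $z_i$); $\dim M^A=\prod a_i$. Schubert variety. $\mathrm G$ acts on $M^A$ and on $\mathbb P(M^A)$; $[v]$ denotes the line $\mathbb Cv$; $\mathrm{sh}_A=\overline{\mathrm G\cdot[v_A]}\subset\mathbb P(M^A)$. For $a_1<\cdots<a_n$ the variety $\mathrm{sh}_A$, regarded up to isomorphism as depending only on $n$, is denoted $\mathrm{sh}^{(n)}$. Generalized flag manifold. Let $V_0=\mathbb C^2\otimes(\mathbb C[t]/t^n)$ with its natural action of $\mathrm G$ and of multiplication by $t$. Let $v_+,v_-$ be a basis of $\mathbb C^2$ with $h v_+=-v_+$, $hv_-=v_-$. ${\bf F}_n$ is the variety of sequences of subspaces $V_0\supset V_1\supset V_2\supset\cdots\supset V_n$ with $tV_i\subset V_{i+1}$ and $\dim(V_i/V_{i+1})=1$ for $i=0,\ldots,n-1$; $\mathrm G$ acts on it. The point $[P]\in{\bf F}_n$ is given by $V_i=\langle v_+\otimes t^k,\ v_-\otimes t^l:\ 0\le k\le n-1,\ i\le l\le n-1\rangle$.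
   Formalization: The formal theorem assumes a_1 ≥ 2: for a_1 = 1 the claim fails (n = 1, A = (1): sh_A is a point while F_1 is a projective line; in general dim sh_A < n = dim F_n). *)

(* Defs.v *)
From HB Require Import structures.
From mathcomp Require Import all_boot all_order all_algebra.
From mathcomp Require Import mpoly ring.
From Stdlib Require Import ClassicalEpsilon.

Set Implicit Arguments.
Unset Strict Implicit.
Unset Printing Implicit Defensive.

Import GRing.Theory Num.Theory.
Local Open Scope ring_scope.

(* Subvarieties of products of projective spaces.  The product is indexed by  *)
(* [mp_blk]; the homogeneous coordinates of all the factors together are      *)
(* indexed by [mp_crd], and [mp_blkof] tells which factor a coordinate        *)
(* belongs to.  [mp_hc u x] means that x is a system of (multi)homogeneous    *)
(* coordinates of the point u; elements of [mp_pt] without coordinates are    *)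
(* not points of the product.                                                 *)
Record mproj (C : fieldType) := MProj {
  mp_pt : Type;
  mp_blk : finType;
  mp_crd : finType;
  mp_blkof : mp_crd -> mp_blk;
  mp_hc : mp_pt -> (mp_crd -> C) -> Prop
}.

Section Varieties.
Variable C : fieldType.

Definition form (P : mproj C) := {mpoly C[#|mp_crd P|]}.

Definition form_eval (P : mproj C) (p : form P) (x : mp_crd P -> C) : C :=
  p.@[fun k => x (enum_val k)].

Definition multihomog (P : mproj C) (d : mp_blk P -> nat) (p : form P) : Prop :=
  forall m, m \in msupp p -> forall i : mp_blk P,
    (\sum_(k < #|mp_crd P| | mp_blkof (enum_val k) == i) m k)%N = d i.

Definition zariski_closure (P : mproj C) (S : mp_pt P -> Prop) (u : mp_pt P)
    : Prop :=
  (exists x, mp_hc u x) /\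
  forall (d : mp_blk P -> nat) (p : form P), multihomog d p ->
    (forall v x, S v -> mp_hc v x -> form_eval p x = 0) ->
    forall x, mp_hc u x -> form_eval p x = 0.

(* Each component of f is given, near each point u of X, by multihomogeneous  *)
(* forms of equal multidegree that do not vanish simultaneously at u.  No     *)
(* separate neighbourhood of u is needed: multiplying the forms by an         *)
(* equation of the complement restricts them to a smaller neighbourhood.      *)
Definition regular_map (P Q : mproj C) (X : mp_pt P -> Prop)
    (f : mp_pt P -> mp_pt Q) : Prop :=
  forall u, X u -> forall i : mp_blk Q,
  exists (d : mp_blk P -> nat) (F : mp_crd Q -> form P),
    [/\ forall j, multihomog d (F j),
        exists x j, [/\ mp_hc u x, mp_blkof j = i & form_eval (F j) x != 0]
      & forall v x y, X v -> mp_hc v x -> mp_hc (f v) y ->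
        (exists2 j, mp_blkof j = i & form_eval (F j) x != 0) ->
        exists2 c : C, c != 0 &
          forall j, mp_blkof j = i -> y j = c * form_eval (F j) x].

Definition variety_iso (P Q : mproj C) (X : mp_pt P -> Prop)
    (Y : mp_pt Q -> Prop) (f : mp_pt P -> mp_pt Q) : Prop :=
  exists g : mp_pt Q -> mp_pt P,
    [/\ forall u, X u -> Y (f u) /\ g (f u) = u,
        forall v, Y v -> X (g v) /\ f (g v) = v,
        regular_map X f
      & regular_map Y g].

(* P(M), with the line through v represented by the subspace <[v]>.           *)
Definition proj_space (M : vectType C) : mproj C :=
  @MProj C {vspace M} unit 'I_(\dim {:M}) (fun=> tt)
    (fun l x => let v := \sum_k x k *: (vbasis {:M})`_k in
                v != 0 /\ l = <[v]>%VS).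

End Varieties.

Section Fusion.
Variable C : numFieldType.

(* The a-dimensional irreducible sl_2-module, in a basis u_0, ..., u_(a-1)    *)
(* with u_0 of lowest weight: e u_k = u_(k+1), h u_k = (2k - (a-1)) u_k,      *)
(* f u_k = k (a - k) u_(k-1).  A traceless x is x_00 h + x_01 e + x_10 f.     *)
Definition irr_mx (a : nat) (x : 'M[C]_2) : 'M[C]_a :=
  \matrix_(k, l)
    (x 0 0 * ((l.*2)%:R - a.-1%:R) *+ (k == l)
     + x 0 1 *+ (k == l.+1 :> nat)
     + x 1 0 * (l * (a - l))%:R *+ (k.+1 == l)).

Variables (n : nat) (a : 'I_n -> nat) (z : 'I_n -> C).

(* The tensor product of the C^(a_i): m indexes the basis vector              *)
(* u_(m 0) * ... * u_(m (n-1)).                                               *)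
Definition tidx := {dffun forall i : 'I_n, 'I_(a i)}.
Definition tens : vectType C := {ffun tidx -> C^o}.

Definition tidx_upd (m : tidx) (i : 'I_n) (k : 'I_(a i)) : tidx :=
  finfun (dfwith (fun j => m j) k).

Definition tens_at (i : 'I_n) (x : 'M[C]_2) (w : tens) : tens :=
  [ffun m : tidx => \sum_(k < a i) irr_mx (a i) x (m i) k * w (tidx_upd m k)].

Definition current (x : 'M[C]_2) (j : nat) (w : tens) : tens :=
  \sum_(i < n) (z i ^+ j) *: tens_at i x w.

Fact current_is_linear x j : linear (current x j).
Proof.
move=> c v w; rewrite /current scaler_sumr -big_split /=; apply: eq_bigr => i _.
rewrite scalerA [c * _]mulrC -scalerA -scalerDr; congr (_ *: _); apply/ffunP => m.
rewrite !ffunE scaler_sumr -big_split /=; apply: eq_bigr => k _.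
by rewrite !ffunE mulrDr; congr (_ + _); rewrite mulrCA.
Qed.
HB.instance Definition _ x j :=
  GRing.isLinear.Build C tens tens _ (current x j) (current_is_linear x j).

Definition vbar : tens := [ffun m : tidx => [forall i, m i == 0 :> nat]%:R].

Inductive monomial : nat -> tens -> Prop :=
| MonNil : monomial 0 vbar
| MonCons x j s w : \tr x = 0 -> monomial s w ->
    monomial (j + s) (current x j w).

(* The span of the monomials of degree < s, so F_s is [filt_lt s.+1] and      *)
(* F_(s-1) is [filt_lt s], with F_(-1) = 0.                                   *)
Definition filt_lt (s : nat) (w : tens) : Prop :=
  forall U : {vspace tens},
    (forall r v, (r < s)%N -> monomial r v -> v \in U) -> w \in U.

(* A realization of the associated graded module of the filtration F: a       *)
(* module M with classes [fp_cls s : F_s -> M] that identify M with the       *)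
(* direct sum of the F_s / F_(s-1), where [fp_act x j] is the operator of     *)
(* x \otimes t^j.  It is unique up to a unique isomorphism, and               *)
(* [fusion_product_exists] shows that there is one.                           *)
Record fusion_product := FusionProduct {
  fp_mod :> vectType C;
  fp_cls : nat -> tens -> fp_mod;
  fp_act : 'M[C]_2 -> nat -> 'End(fp_mod);
  fp_cls_linear : forall s c v w, filt_lt s.+1 v -> filt_lt s.+1 w ->
    fp_cls s (c *: v + w) = c *: fp_cls s v + fp_cls s w;
  fp_cls_ker : forall s v, filt_lt s.+1 v -> fp_cls s v = 0 <-> filt_lt s v;
  fp_cls_span : forall m, exists N (v : nat -> tens),
    (forall s, filt_lt s.+1 (v s)) /\ m = \sum_(s < N) fp_cls s (v s);
  fp_cls_direct : forall N (v : nat -> tens),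
    (forall s, filt_lt s.+1 (v s)) -> \sum_(s < N) fp_cls s (v s) = 0 ->
    forall s, (s < N)%N -> fp_cls s (v s) = 0;
  fp_act_cls : forall x j s v, \tr x = 0 -> filt_lt s.+1 v ->
    fp_act x j (fp_cls s v) = fp_cls (j + s) (current x j v)
}.

Definition fp_vac (M : fusion_product) : M := fp_cls M 0 vbar.

End Fusion.

Section Existence.
Variable C : numFieldType.

Lemma span_vspace (vT : vectType C) (P : vT -> Prop) :
  {W : {vspace vT} | forall w, w \in W <->
    forall U : {vspace vT}, (forall v, P v -> v \in U) -> w \in U}.
Proof.
apply: constructive_indefinite_description.
suff H k : forall U : {vspace vT}, (\dim U < k)%N -> (forall v, P v -> v \in U) ->
    exists W : {vspace vT}, forall w, w \in W <->
    forall U : {vspace vT}, (forall v, P v -> v \in U) -> w \in U.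
  by apply: (H _ fullv (ltnSn _)) => v _; rewrite memvf.
elim: k => // k IHk U; rewrite ltnS => leUk PU.
case: (classic (forall U' : {vspace vT}, (forall v, P v -> v \in U') ->
                  (U <= U')%VS)) => [minU | notall].
  exists U => w; split=> [wU U' /minU/subvP|]; [exact | exact].
suff [U' PU' nUU'] : exists2 U' : {vspace vT}, (forall v, P v -> v \in U') & ~ (U <= U')%VS.
  apply: (IHk (U :&: U')%VS) => [|v Pv]; last by rewrite memv_cap PU ?PU'.
  apply: leq_trans leUk; rewrite ltn_neqAle dimvS ?capvSl // andbT.
  apply/negP => /eqP eqd; apply: nUU'; apply/capv_idPl/eqP.
  by rewrite eqEdim capvSl eqd leqnn.
apply: NNPP => no; apply: notall => U' PU'; apply: NNPP => nUU'.
by apply: no; exists U'.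
Qed.

Lemma lfun_of_linear (aT rT : vectType C) (f : aT -> rT) :
  linear f -> {F : 'Hom(aT, rT) | F =1 f}.
Proof.
move=> lf; pose L : {linear aT -> rT} := HB.pack f (GRing.isLinear.Build C aT rT _ f lf).
by exists (linfun L) => x; rewrite lfunE.
Qed.

Variables (n : nat) (a : 'I_n -> nat) (z : 'I_n -> C).
Local Notation tens := (tens C a).

Lemma filt_current x j s v : \tr x = 0 ->
  filt_lt (a := a) z s v -> filt_lt z (j + s) (current z x j v).
Proof.
move=> trx Fv U HU.
suff: v \in (linfun (current (a := a) z x j) @^-1: U)%VS by rewrite -memv_preim lfunE.
apply: Fv => r w rs mw; rewrite -memv_preim lfunE; apply: HU (MonCons j trx mw).
by rewrite ltn_add2l.
Qed.

Lemma fusion_product_exists : inhabited (fusion_product a z).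
Proof.
pose U s := sval (span_vspace (fun v : tens => exists2 r, (r < s)%N & monomial (a:=a) z r v)).
have UE s w : w \in U s <-> filt_lt z s w.
  rewrite (svalP (span_vspace _) w); split=> H V PV; apply: H.
    by move=> v [r rs mv]; apply: PV mv.
  by move=> r v rs mv; apply: PV; exists r.
have Umono s r : (s <= r)%N -> (U s <= U r)%VS.
  move=> sr; apply/subvP => w /UE Fw; apply/UE => V PV; apply: Fw => q v qs.
  by apply: PV; apply: leq_trans sr.
have [N HN] : exists N, forall s, (N <= s)%N -> (U s.+1 <= U s)%VS.
  suff H k : forall s0, (\dim (fullv : {vspace tens}) - \dim (U s0) < k)%N ->
    exists N, forall s, (N <= s)%N -> (U s.+1 <= U s)%VS.
    exact: (H _ 0 (ltnSn _)).
  elim: k => // k IHk s0; rewrite ltnS => les0.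
  case: (classic (forall s, (s0 <= s)%N -> (U s.+1 <= U s)%VS)) => [|nall].
    by exists s0.
  suff [s ss0 nsub] : exists2 s, (s0 <= s)%N & ~ (U s.+1 <= U s)%VS.
    have lt : (\dim (U s0) < \dim (U s.+1)%N)%N.
      rewrite ltn_neqAle dimvS ?Umono // 1?leqW // andbT.
      apply/negP => /eqP eqd; apply: nsub.
      have /eqP <- : U s0 == U s.+1 by rewrite eqEdim Umono ?leqW //= eqd.
      exact: Umono.
    apply: (IHk s.+1); apply: leq_trans les0; apply: ltn_sub2l => //.
    exact: leq_trans lt (dimvS (subvf _)).
  apply: NNPP => no; apply: nall => s ss0; apply: NNPP => ns.
  by apply: no; exists s.
have [q q0 qsub] : exists2 q : nat -> 'End(tens),
    forall s v, q s v = 0 <-> v \in U s & forall s v, v - q s v \in U s.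
  exists (fun s => \1 - projv (U s))%VF => s v;
    rewrite add_lfunE opp_lfunE id_lfunE; last first.
    by rewrite opprB addrC subrK memv_proj.
  by split=> [/subr0_eq ->|vU]; rewrite ?memv_proj // projv_id ?subrr.
pose G : vectType C := {ffun 'I_N -> tens}.
pose inj (s : nat) (v : tens) : G := [ffun r : 'I_N => if r == s :> nat then v else 0].
have inj_lin s : linear (inj s).
  move=> c v w; apply/ffunP => r; rewrite !ffunE; case: ifP => _ //.
  by rewrite scaler0 addr0.
pose injL s := sval (lfun_of_linear (inj_lin s)).
have injLE s : injL s =1 inj s by exact: (svalP (lfun_of_linear (inj_lin s))).
pose W := (\sum_(s < N) (injL s \o q s) @: U s.+1)%VS.
have Winj s v : v \in U s.+1 -> inj s (q s v) \in W.
  move=> vU; have [sN|Ns] := ltnP s N.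
    have -> : inj s (q s v) = (injL s \o q s)%VF v by rewrite comp_lfunE injLE.
    apply: (subvP (sumv_sup (Ordinal sN) isT (subvv _))); exact: memv_img.
  suff -> : inj s (q s v) = 0 by apply: mem0v.
  apply/ffunP => r; rewrite !ffunE; case: eqP => // rs.
  by move: (ltn_ord r); rewrite rs ltnNge Ns.
have qN s v : (N <= s)%N -> v \in U s.+1 -> q s v = 0.
  by move=> Ns vU; apply/q0; apply: (subvP (HN _ Ns)).
pose actG x j (m : G) : G := \sum_(r < N) inj (j + r)%N (q (j + r)%N (current z x j (m r))).
have actG_lin x j : linear (actG x j).
  move=> c v w; rewrite /actG scaler_sumr -big_split /=; apply: eq_bigr => r _.
  by rewrite !ffunE linearP linearP inj_lin.
pose actL x j := sval (lfun_of_linear (actG_lin x j)).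
have actLE x j : actL x j =1 actG x j by exact: (svalP (lfun_of_linear (actG_lin x j))).
pose M : vectType C := subvs_of W.
pose cls s v : M := vsproj W (inj s (q s v)).
pose act x j : 'End(M) :=
  (linfun (vsproj W) \o (actL x j \o linfun (@vsval _ _ W)))%VF.
have clsK s v : v \in U s.+1 -> vsval (cls s v) = inj s (q s v).
  by move=> vU; rewrite vsprojK // Winj.
have sumK (v : nat -> tens) K : (forall s, v s \in U s.+1) -> forall r : 'I_N,
    vsval (\sum_(s < K) cls s (v s)) r = if (r < K)%N then q r (v r) else 0.
  move=> vU r; rewrite linear_sum /= sum_ffunE.
  under eq_bigr => s _ do rewrite clsK // ffunE.
  case: ifP => rK.
    rewrite (bigD1 (Ordinal rK)) //= eqxx big1 ?addr0 // => s /eqP nsr.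
    by case: eqP => // rs; case: nsr; apply: val_inj.
  by rewrite big1 // => s _; case: eqP => // rs; rewrite rs ltn_ord in rK.
have cls_linear s c v w : cls s (c *: v + w) = c *: cls s v + cls s w.
  by rewrite /cls linearP inj_lin linearP.
exists; apply: (@FusionProduct C n a z M cls act).
- by move=> s c v w _ _; apply: cls_linear.
- move=> s v /UE vU; rewrite -UE -q0; split=> [c0|qv]; last first.
    apply: val_inj; rewrite /= clsK // qv; apply/ffunP => r; rewrite !ffunE.
    by case: ifP.
  have [sN|Ns] := ltnP s N; last exact: qN.
  have := congr1 (fun m : M => (vsval m : G) (Ordinal sN)) c0.
  by rewrite /= clsK // !ffunE /= eqxx.
- move=> m; have /memv_sumP[u uW mE] := subvsP m.
  have uE (s : 'I_N) : {v : tens | v \in U s.+1 /\ u s = inj s (q s v)}.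
    apply: constructive_indefinite_description.
    have /memv_imgP[v vU ->] := uW s isT; exists v.
    by rewrite comp_lfunE injLE.
  pose v s : tens := oapp (fun s' => sval (uE s')) 0 (insub s : option 'I_N).
  have vU s : v s \in U s.+1.
    rewrite /v; case: insubP => [s' _ <-|_] /=; last exact: mem0v.
    by have [] := svalP (uE s').
  exists N, v; split=> [s|]; first exact/UE.
  apply: val_inj; rewrite /= mE linear_sum /=; apply: eq_bigr => s _.
  rewrite clsK //; have [_ ->] := svalP (uE s); rewrite /v.
  by case: insubP => [s' _ /val_inj ->|]; rewrite ?ltn_ord.
- move=> K v Fv; have vU s : v s \in U s.+1 by apply/UE.
  move=> s0 s sK; apply: val_inj; rewrite /= clsK //; apply/ffunP => r.
  rewrite !ffunE; case: eqP => // rs.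
  have := sumK v K vU r; rewrite s0 rs sK => <-.
  by rewrite linear0 ffunE.
- move=> x j s v trx /UE vU; apply: val_inj.
  have cU : current z x j v \in U (j + s).+1.
    by rewrite -addnS; apply/UE; apply: filt_current => //; apply/UE.
  have HE : actG x j (inj s (q s v)) = inj (j + s) (q (j + s) (current z x j v)).
    rewrite /actG; have [sN|Ns] := ltnP s N; last first.
      rewrite (qN s) // (qN (j + s)) // ?(leq_trans Ns) ?leq_addl //.
      rewrite big1 => [|r _].
        by apply/ffunP => r; rewrite !ffunE; case: ifP.
      rewrite !ffunE if_same linear0 linear0.
      by apply/ffunP => r'; rewrite !ffunE if_same.
    rewrite (bigD1 (Ordinal sN)) //= big1 => [|r /eqP nrs]; last first.
      rewrite !ffunE; case: eqP => [rs|_]; first by case: nrs; apply: val_inj.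
      by rewrite linear0 linear0; apply/ffunP => r'; rewrite !ffunE if_same.
    rewrite addr0 !ffunE /= eqxx; congr (inj _ _).
    apply/eqP; rewrite eq_sym -subr_eq0 -linearB -linearB; apply/eqP/q0/UE.
    by apply: filt_current => //; apply/UE.
  rewrite /= clsK // !comp_lfunE !lfunE /= clsK // actLE HE.
  by rewrite vsprojK // Winj.
Qed.
End Existence.

(* C[t]/t^n.  For n = 0 the library quotients by 'X instead of 'X^0.          *)
Notation trunc C n := {poly %/ ('X^n : {poly C})}.

Section Group.
Variables (C : numFieldType) (n : nat).

Definition unip_up (p : trunc C n) : 'M[trunc C n]_2 := 1 + p *: delta_mx 0 1.
Definition unip_lo (p : trunc C n) : 'M[trunc C n]_2 := 1 + p *: delta_mx 1 0.

(* The exponential of a nilpotent endomorphism: terms of degree greater than  *)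
(* \dim M vanish.                                                             *)
Definition nexp (M : vectType C) (N : 'End(M)) : 'End(M) :=
  \sum_(k < (\dim {:M}).+1)
    (k`!%:R : C)^-1 *: iter k (fun T => (N \o T)%VF) \1%VF.

Variables (a : 'I_n -> nat) (z : 'I_n -> C) (M : fusion_product a z).

Definition fp_actp (x : 'M[C]_2) (p : trunc C n) : 'End(M) :=
  \sum_(j < n) (p : {poly C})`_j *: fp_act M x j.

(* The graph of the action of SL_2(C[t]/t^n) on M that integrates the Lie     *)
(* algebra action: exp (e \otimes p) and exp (f \otimes p) act by the         *)
(* exponentials of the corresponding operators, and these elements generate   *)
(* the group (see [group_act_total]).                                         *)
Inductive group_act : 'M[trunc C n]_2 -> 'End(M) -> Prop :=
| GActUp p : group_act (unip_up p) (nexp (fp_actp (delta_mx 0 1) p))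
| GActLo p : group_act (unip_lo p) (nexp (fp_actp (delta_mx 1 0) p))
| GActMul g1 T1 g2 T2 : group_act g1 T1 -> group_act g2 T2 ->
    group_act (g1 *m g2) (T1 \o T2)%VF.

Definition vac_orbit (l : mp_pt (proj_space M)) : Prop :=
  exists g T, group_act g T /\ l = <[T (fp_vac M)]>%VS.

Definition schubert : mp_pt (proj_space M) -> Prop := zariski_closure vac_orbit.

End Group.

Arguments fp_actp {C n a z} M x p.
Arguments group_act {C n a z} M _ _.
Arguments vac_orbit {C n a z} M _.
Arguments schubert {C n a z} M _.

Section Elementary.
Variable R : comUnitRingType.
Implicit Types (g h : 'M[R]_2) (p c x : R).

Let up p : 'M[R]_2 := 1 + p *: delta_mx 0 1.
Let lo p : 'M[R]_2 := 1 + p *: delta_mx 1 0.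

Lemma mx2_eq g h : g 0 0 = h 0 0 -> g 0 1 = h 0 1 ->
  g 1 0 = h 1 0 -> g 1 1 = h 1 1 -> g = h.
Proof.
move=> e1 e2 e3 e4; apply/matrixP => i j.
have o (k : 'I_2) : k = 0 \/ k = 1.
  by case: k => [[|[|k]] lk] //; [left|right]; apply: val_inj.
by case: (o i) => ->; case: (o j) => ->.
Qed.

Lemma mulmx2E g h i j : (g *m h) i j = g i 0 * h 0 j + g i 1 * h 1 j.
Proof.
rewrite mxE !big_ord_recl big_ord0 addr0.
by congr (_ + g _ _ * h _ _); apply: val_inj.
Qed.

Lemma det_mx22 g : \det g = g 0 0 * g 1 1 - g 0 1 * g 1 0.
Proof.
rewrite (expand_det_row _ 0) !big_ord_recl big_ord0 addr0 /cofactor !det_mx11.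
rewrite !mxE /= expr0 expr1 mul1r mulN1r mulrN.
by congr (_ * g _ _ - g _ _ * g _ _); apply: val_inj.
Qed.

Lemma upE p i j : up p i j = (i == j)%:R + p * ((i == 0) && (j == 1))%:R.
Proof. by rewrite !mxE. Qed.
Lemma loE p i j : lo p i j = (i == j)%:R + p * ((i == 1) && (j == 0))%:R.
Proof. by rewrite !mxE. Qed.

Lemma lo_mul p g : lo (- p) *m (lo p *m g) = g.
Proof.
by apply: mx2_eq; rewrite !(mulmx2E, loE) /= ?eqxx; ring.
Qed.

Lemma det_lo p : \det (lo p) = 1.
Proof. by rewrite det_mx22 !loE /=; ring. Qed.

Lemma lo1_mul10 g : (lo 1 *m g) 1 0 = g 1 0 + g 0 0.
Proof. by rewrite mulmx2E !loE /=; ring. Qed.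

Lemma up_lo_up g : \det g = 1 -> g 1 0 \is a GRing.unit ->
  g = up ((g 0 0 - 1) / g 1 0) *m (lo (g 1 0) *m up ((g 1 1 - 1) / g 1 0)).
Proof.
rewrite det_mx22 => dg cU; set c := g 1 0 in dg cU *.
have cV : c * c^-1 = 1 by rewrite divrr.
apply: mx2_eq; rewrite !(mulmx2E, loE, upE) -/c /= ?eqxx.
- by ring: cV.
- have -> : g 0 1 = c^-1 * (g 0 0 * g 1 1 - 1).
    by rewrite -dg; ring: cV.
  by ring: cV.
- by ring.
- by ring: cV.
Qed.
End Elementary.

Section Generation.
Variables (C : numFieldType) (n : nat).

Lemma trunc_nilp (p : trunc C n) :
  p \isn't a GRing.unit -> p ^+ n.-1.+1 = 0.
Proof.
rewrite qualifE /= => pN; apply: val_inj; rewrite /= poly_of_qpolyX.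
apply/eqP; rewrite -[_ == _]/(Pdiv.CommonRing.rdvdp _ _) -Pdiv.Idomain.dvdpE.
move: pN; move: (p : {poly C}) => P; rewrite mk_monic_Xn coprimep_pexpl //.
rewrite coprimep_sym -['X]subr0 coprimep_XsubC negbK => rP.
by apply: dvdp_exp2r; rewrite dvdp_XsubCl.
Qed.

Lemma trunc_unitVunit (p q x y : trunc C n) :
  p * x - q * y = 1 -> p \isn't a GRing.unit -> q \is a GRing.unit.
Proof.
move=> E /trunc_nilp pN; set k := n.-1.+1 in pN.
have : q * y * (- \sum_(i < k) (p * x) ^+ i) = 1.
  have -> : q * y = p * x - 1 by rewrite -E opprB addrC subrK.
  by rewrite mulrN -subrX1 exprMn pN mul0r sub0r opprK.
by move=> u; have := unitr1 (trunc C n); rewrite -u !unitrM => /andP[/andP[]].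
Qed.

Variables (a : 'I_n -> nat) (z : 'I_n -> C) (M : fusion_product a z).

Lemma group_act_total (g : 'M[trunc C n]_2) : \det g = 1 ->
  exists T, group_act M g T.
Proof.
have lower_unit (h : 'M[trunc C n]_2) : \det h = 1 -> h 1 0 \is a GRing.unit ->
    exists T, group_act M h T.
  move=> dh cU; rewrite (up_lo_up dh cU).
  eexists; apply: GActMul; first exact: GActUp.
  by apply: GActMul; [exact: GActLo | exact: GActUp].
move=> dg.
have [|nc] := boolP (g 1 0 \is a GRing.unit); first exact: lower_unit.
have [T gT] : exists T, group_act M (unip_lo 1 *m g) T.
  apply: lower_unit.
    by rewrite det_mulmx dg mulr1 det_lo.
  rewrite lo1_mul10.
  apply: contraT => /(@trunc_unitVunit _ (g 1 0) (g 1 1) (g 1 1 + g 0 1)).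
  rewrite (negPf nc); apply; rewrite -dg det_mx22.
  by rewrite mulrDl mulrDr opprD addrACA subrr add0r (mulrC (g 1 0) (g 0 1)).
rewrite -(lo_mul 1 g).
by eexists; apply: GActMul gT; exact: GActLo.
Qed.
End Generation.

Section Flags.
Variables (C : numFieldType) (n : nat).

(* C^2 \otimes C[t]/t^n; the pair (p, q) is v_- \otimes p + v_+ \otimes q, as *)
(* h = diag(1, -1), h v_- = v_- and h v_+ = - v_+.                            *)
Definition V0 : vectType C := (trunc C n * trunc C n)%type.

Definition v_minus (p : trunc C n) : V0 := (p, 0).
Definition v_plus (p : trunc C n) : V0 := (0, p).

Definition tmul (v : V0) : V0 := ('qX * v.1, 'qX * v.2).

Definition gmul (g : 'M[trunc C n]_2) (v : V0) : V0 :=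
  (g 0 0 * v.1 + g 0 1 * v.2, g 1 0 * v.1 + g 1 1 * v.2).

Fact gmul_is_linear g : linear (gmul g).
Proof.
move=> c [v1 v2] [w1 w2]; congr pair => /=; rewrite !mulrDr scalerDr !scalerAr;
  exact: addrACA.
Qed.
HB.instance Definition _ g :=
  GRing.isLinear.Build C V0 V0 _ (gmul g) (gmul_is_linear g).

Definition flag : Type := {ffun 'I_n.+1 -> {vspace V0}}.

Definition is_flag (V : flag) : Prop :=
  V ord0 = fullv /\
  forall i, (i < n)%N ->
    [/\ (V (inord i.+1) <= V (inord i))%VS,
        \dim (V (inord i)) = (\dim (V (inord i.+1))).+1
      & forall v, v \in V (inord i) -> tmul v \in V (inord i.+1)].

Definition flag_act (g : 'M[trunc C n]_2) (V : flag) : flag :=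
  [ffun i => (linfun (gmul g) @: V i)%VS].

Definition flag_P : flag :=
  [ffun i : 'I_n.+1 =>
    <<[seq v_plus ('qX ^+ k) | k <- iota 0 n]
      ++ [seq v_minus ('qX ^+ l) | l <- iota i (n - i)]>>%VS].

(* Flags as points of a product of projective spaces, each V_i being given by *)
(* its Pluecker coordinates: the maximal minors of a basis of V_i, of size    *)
(* 2n - i.  The minors are indexed by all maps S, not only increasing ones.   *)
Definition flag_space : mproj C :=
  @MProj C flag 'I_n.+1
    {i : 'I_n.+1 & {ffun 'I_(n.*2 - i) -> 'I_(\dim {:V0})}} (@tag _ _)
    (fun V x => forall i : 'I_n.+1, exists2 B : (n.*2 - i).-tuple V0,
       basis_of (V i) B &
       forall S : {ffun 'I_(n.*2 - i) -> 'I_(\dim {:V0})},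
         x (Tagged (fun i : 'I_n.+1 =>
                      {ffun 'I_(n.*2 - i) -> 'I_(\dim {:V0})}) S)
         = \det (\matrix_(r, c) coord (vbasis {:V0}) (S c) (tnth B r))).

Definition flag_variety : mp_pt flag_space -> Prop := is_flag.

End Flags.

(* Main.v *)
(* Write K for max_i a_i - 1 and, for r < K, let m_r be the number of i with   *)
(* r + 1 < a_i; every m in 1..n occurs.  Sending a flag to the tensor product   *)
(* over r of its Pluecker vectors of V_(m_r) embeds F_n in the projective space *)
(* of a tensor power T of V_0, and the theorem follows once M^A is identified   *)
(* with the G-submodule of T generated by the image w of [P].                   *)
(* Over C[t]/prod (t - z_i) the subspaces V_m deform so that the corresponding  *)
(* vector has lowest weight -(a_i - 1) at each z_i, which gives an intertwiner  *)
(* from the tensor product of the C^(a_i)(z_i); its graded part is a            *)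
(* homomorphism psi : M^A -> T with psi(v_A) = w.  It is injective: dim M^A is  *)
(* at most prod a_i, while the vectors exp(e(p)) w, whose coordinates are       *)
(* products of minors, span at least prod a_i dimensions.                       *)
(* Every flag is V_i = g_i V_0 with g_i = prod_(j<i) Q_j K(0), Q_j in SL_2(C),  *)
(* K(s) = [[t, s], [0, 1]]; replacing K(0) by K(s) with s generic puts it into  *)
(* the cell exp(e(p)) [P].  Hence flags have their image in P(M^A), inside      *)
(* sh_A.  Conversely the conditions on a flag, written in ratios of             *)
(* coordinates, extend from the orbit of [v_A] to its closure.                  *)

Require Import Defs.
From HB Require Import structures.
From mathcomp Require Import all_boot all_order all_algebra.
From mathcomp Require Import perm mpoly ring zify.
From mathcomp Require Import reals complex.
From Stdlib Require Import ClassicalEpsilon.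

Set Implicit Arguments.
Unset Strict Implicit.
Unset Printing Implicit Defensive.

Import GRing.Theory Num.Theory.
Local Open Scope ring_scope.

(** * Tensor powers and multivectors *)

(** Attach to a flag the tensor product over the blocks r of the Pluecker vectors of V_m, m =
    [bsize a r]. If M^A embeds equivariantly in the tensor power T that contains these vectors, with
    v_A going to the vector w of [P], then sh_A is the closure of the orbit of [P] in a
    Segre-Pluecker embedding of F_n. What remains is that the orbit is dense among flags and that
    limits of points of the orbit are flags.

    The map M^A -> T comes from a deformation. Over C[t]/prod (t - z_i) the current algebra acts
    through one copy of sl_2 for each z_i. A subspace spanned by all eigenvectors of type v_+ and
    some of type v_- gives a vector killed by every f ([w_pt_f]), of weight -(a_i - 1) at z_i
    ([w_pt_h]); sl_2-theory then gives an intertwiner from the tensor product ([psi_tens_act]).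
    Leading terms in the t-degree turn it into [psi], compatible with the action truncated modulo
    t^n ([psi_act]).

    Injectivity ([psi_inj]) is a count. The dimension of M is at most prod a_i ([dim_fusion]). The
    vectors exp(e(p)) w lie in the image, and linear functionals restrict on them to spans of
    products of minors of a Toeplitz-like matrix in p. Among those functions [minors_dim] finds prod
    a_i independent ones, by recursion on n and on the degree in the top coefficient of p:
    [minors_exchange] produces functions of smaller degree, [minors_lift] realizes the leading
    coefficients as minors modulo a smaller power of t.

    For density, a flag is a product of matrices Q_j K(0); with K(s) instead it lies in the cell
    exp(e(p)) [P] for almost all s ([hmx_cell]). Thus polynomial conditions on the cell hold on all
    flags ([cell_dense]), which puts every flag into P(M) ([flag_im]) and into sh_A ([phi_closure]).
    Conversely, once an identity submatrix is normalized, being a flag is a system of equations in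
    ratios of coordinates ([flag_ids]), and it passes to the closure ([closure_ids],
    [closure_flag]). Both directions are given by forms: products of Pluecker coordinates in
    [phi_regular], and linear forms obtained by freezing all blocks but one in [phi_inv_regular]. *)

Section TensorPower.
Variable C : fieldType.
Variable P : finType.

(** Tensors by their coefficients, one for each map from the positions to the basis indices. Vectors
    are rows and matrices act from the right, which is why products are reversed in [tpM] and
    brackets in [dp_comm]. *)
Definition tpow (D : nat) : vectType C := {ffun {ffun P -> 'I_D} -> C^o}.

Definition tpf D D' (f : P -> 'M[C]_(D, D')) (x : tpow D) : tpow D' :=
  [ffun S' : {ffun P -> 'I_D'} =>
     \sum_(S : {ffun P -> 'I_D}) (\prod_q f q (S q) (S' q)) * x S].

Fact tpf_is_linear D D' f : linear (@tpf D D' f).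
Proof.
move=> c x y; apply/ffunP => S'; rewrite !ffunE scaler_sumr -big_split /=.
by apply: eq_bigr => S _; rewrite !ffunE mulrDr; congr (_ + _); rewrite /GRing.scale /= mulrCA.
Qed.
HB.instance Definition _ D D' (f : P -> 'M[C]_(D, D')) :=
  GRing.isLinear.Build C (tpow D) (tpow D') _ (tpf f) (tpf_is_linear f).

Lemma eq_tpf D D' (f g : P -> 'M[C]_(D, D')) : f =1 g -> tpf f =1 tpf g.
Proof.
move=> fg x; apply/ffunP => S; rewrite !ffunE; apply: eq_bigr => S' _.
by congr (_ * _); apply: eq_bigr => q _; rewrite fg.
Qed.

Lemma tpf_comp D D' D'' (f : P -> 'M[C]_(D, D')) (g : P -> 'M[C]_(D', D'')) x :
  tpf g (tpf f x) = tpf (fun q => f q *m g q) x.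
Proof.
apply/ffunP => S; rewrite !ffunE.
under eq_bigr => S' _ do rewrite ffunE mulr_sumr.
rewrite exchange_big; apply: eq_bigr => S1 _ /=.
under eq_bigr => S' _ do rewrite mulrA.
rewrite -mulr_suml; congr (_ * _).
under [RHS]eq_bigr => q _ do rewrite mxE.
rewrite bigA_distr_bigA /=; apply: eq_bigr => S' _.
by rewrite -big_split /=; apply: eq_bigr => q _; rewrite mulrC.
Qed.

Lemma prod_eqb (D : nat) (S S' : {ffun P -> 'I_D}) :
  \prod_q ((S q == S' q)%:R : C) = (S == S')%:R.
Proof.
case: (altP (S =P S')) => [->|]; first by rewrite big1 // => q _; rewrite eqxx.
move=> neq; have [q nq] : exists q, S q != S' q.
  apply/existsP; rewrite -negb_forall; apply: contra neq => /forallP H.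
  by apply/eqP/ffunP => q; apply/eqP/H.
by rewrite (bigD1 q) //= (negPf nq) mul0r.
Qed.

Lemma tpf1 D (x : tpow D) : tpf (fun=> 1%:M) x = x.
Proof.
apply/ffunP => S; rewrite ffunE (bigD1 S) //= [X in _ + X]big1.
  by rewrite addr0 big1 ?mul1r // => q _; rewrite mxE eqxx.
move=> S' neq; rewrite [X in X * _](_ : _ = 0) ?mul0r //.
under eq_bigr => q _ do rewrite mxE.
by rewrite prod_eqb (negPf neq).
Qed.

Definition tp D D' (A : 'M[C]_(D, D')) : tpow D -> tpow D' := tpf (fun=> A).
HB.instance Definition _ D D' (A : 'M[C]_(D, D')) :=
  GRing.isLinear.Build C (tpow D) (tpow D') _ (tp A) (tpf_is_linear (fun=> A)).

Lemma tpM D D' D'' (A : 'M[C]_(D, D')) (B : 'M[C]_(D', D'')) x :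
  tp (A *m B) x = tp B (tp A x).
Proof. by rewrite /tp tpf_comp. Qed.

Lemma tp1 D (x : tpow D) : tp 1%:M x = x.
Proof. exact: tpf1. Qed.

Definition at_pos D (q : P) (A : 'M[C]_D) (q' : P) : 'M[C]_D :=
  if q' == q then A else 1%:M.

Definition dp D (A : 'M[C]_D) (x : tpow D) : tpow D := \sum_q tpf (at_pos q A) x.

Fact dp_is_linear D A : linear (@dp D A).
Proof.
move=> c x y; rewrite /dp scaler_sumr -big_split /=; apply: eq_bigr => q _.
by rewrite linearP.
Qed.
HB.instance Definition _ D (A : 'M[C]_D) :=
  GRing.isLinear.Build C (tpow D) (tpow D) _ (dp A) (dp_is_linear A).

Lemma prod_at_pos D q (A : 'M[C]_D) (S S' : {ffun P -> 'I_D}) :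
  \prod_r at_pos q A r (S r) (S' r) =
  A (S q) (S' q) * \prod_(r | r != q) (S r == S' r)%:R.
Proof.
rewrite (bigD1 q) //= /at_pos eqxx; congr (_ * _).
by apply: eq_bigr => r /negPf ->; rewrite mxE.
Qed.

Lemma tpf_at_lin D q c (A B : 'M[C]_D) x :
  tpf (at_pos q (c *: A + B)) x = c *: tpf (at_pos q A) x + tpf (at_pos q B) x.
Proof.
apply/ffunP => S; rewrite !ffunE scaler_sumr -big_split /=; apply: eq_bigr => S' _.
rewrite /GRing.scale /= mulrA -mulrDl; congr (_ * _).
by rewrite !prod_at_pos !mxE mulrDl mulrA.
Qed.

Lemma dp_lin D c (A B : 'M[C]_D) x : dp (c *: A + B) x = c *: dp A x + dp B x.
Proof.
rewrite /dp scaler_sumr -big_split /=; apply: eq_bigr => q _.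
exact: tpf_at_lin.
Qed.

Lemma dp0 D x : dp (0 : 'M[C]_D) x = 0.
Proof. by have := dp_lin (-1) (0 : 'M[C]_D) 0 x; rewrite scaler0 addr0 scaleN1r addNr. Qed.

Lemma dpD D (A B : 'M[C]_D) x : dp (A + B) x = dp A x + dp B x.
Proof. by rewrite -[A]scale1r dp_lin !scale1r. Qed.

Lemma dpZ D c (A : 'M[C]_D) x : dp (c *: A) x = c *: dp A x.
Proof. by rewrite -[c *: A]addr0 dp_lin dp0 addr0. Qed.

Lemma dp_sum D (I : finType) (A : I -> 'M[C]_D) x :
  dp (\sum_i A i) x = \sum_i dp (A i) x.
Proof.
elim/big_rec2: _ => [|i y1 y2 _ <-]; first exact: dp0.
by rewrite dpD.
Qed.

Lemma dpZr D c (A : 'M[C]_D) x : dp A (c *: x) = c *: dp A x.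
Proof. by have := dp_is_linear A c x 0; rewrite !addr0 linear0 addr0. Qed.

Lemma dp_sumr D (A : 'M[C]_D) (I : finType) (Q : pred I) (F : I -> tpow D) :
  dp A (\sum_(i | Q i) F i) = \sum_(i | Q i) dp A (F i).
Proof. exact: (linear_sum (dp A)). Qed.

Lemma dp_tp D D' (A : 'M[C]_D) (A' : 'M[C]_D') (B : 'M[C]_(D, D')) x :
  A *m B = B *m A' -> tp B (dp A x) = dp A' (tp B x).
Proof.
move=> AB; rewrite /dp linear_sum; apply: eq_bigr => q _ /=.
rewrite /tp !tpf_comp; apply: eq_tpf => q'; rewrite /at_pos.
by case: eqP => _ //; rewrite mul1mx mulmx1.
Qed.

Lemma dp_comm D (A B : 'M[C]_D) x :
  dp A (dp B x) - dp B (dp A x) = dp (B *m A - A *m B) x.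
Proof.
have E (A1 A2 : 'M[C]_D) : dp A1 (dp A2 x) =
    \sum_q \sum_q' tpf (fun r => at_pos q' A2 r *m at_pos q A1 r) x.
  rewrite /dp; apply: eq_bigr => q _; rewrite linear_sum; apply: eq_bigr => q' _ /=.
  by rewrite tpf_comp.
rewrite !E [X in _ - X]exchange_big -sumrB /dp /=; apply: eq_bigr => q _.
rewrite -sumrB (bigD1 q) //= [X in _ + X]big1 ?addr0.
  have -> : B *m A - A *m B = (-1) *: (A *m B) + B *m A by rewrite scaleN1r addrC.
  rewrite tpf_at_lin scaleN1r addrC.
  congr (- _ + _); apply: eq_tpf => r; rewrite /at_pos; case: eqP => //; by rewrite mulmx1.
move=> q' neq; apply/eqP; rewrite subr_eq0; apply/eqP; apply: eq_tpf => r.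
rewrite /at_pos; case: (r =P q) => [->|_]; last by case: eqP => _; rewrite ?mulmx1 ?mul1mx.
by rewrite eq_sym (negPf neq) mulmx1 mul1mx.
Qed.

Definition tpset D (A : 'M[C]_D) (Q : {set P}) : tpow D -> tpow D :=
  tpf (fun q => if q \in Q then A else 1%:M).

Lemma tpf0 D q (f : P -> 'M[C]_D) x : f q = 0 -> tpf f x = 0.
Proof.
move=> fq; apply/ffunP => S; rewrite !ffunE big1 // => S' _.
by rewrite (bigD1 q) //= fq mxE mul0r mul0r.
Qed.

(* For [A ^+ 2 = 0] both sides of the exponential are sums over the subsets   *)
(* of positions at which A acts, by a power of the derivation being k! times  *)
(* the sum over the subsets of size k.                                        *)
Lemma iter_dp D (A : 'M[C]_D) (k : nat) x : A *m A = 0 ->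
  iter k (dp A) x = k`!%:R *: \sum_(Q : {set P} | #|Q| == k) tpset A Q x.
Proof.
move=> A2; elim: k => [|k IHk].
  rewrite fact0 scale1r (bigD1 set0) ?cards0 //= [X in _ + X]big1.
    rewrite addr0 -[LHS]tpf1; apply: eq_tpf => q.
    by rewrite inE.
  by move=> Q /andP[]; rewrite cards_eq0 => ->.
rewrite iterS IHk dpZr dp_sumr factS mulnC natrM -scalerA; congr (_ *: _).
have dpQ Q : dp A (tpset A Q x) = \sum_(q | q \notin Q) tpset A (q |: Q) x.
  rewrite /dp (bigID (mem Q)) /= big1 ?add0r.
    apply: eq_bigr => q qQ; rewrite /tpset tpf_comp; apply: eq_tpf => r.
    rewrite /at_pos !inE; case: (r =P q) => [->|_] /=; first by rewrite (negPf qQ) mul1mx.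
    by rewrite mulmx1.
  move=> q qQ; rewrite /tpset tpf_comp (@tpf0 _ q) //.
  by rewrite qQ /at_pos eqxx.
under eq_bigr => Q _ do rewrite dpQ.
rewrite (exchange_big_dep predT) //=.
transitivity (\sum_q \sum_(Q : {set P} | (#|Q| == k.+1) && (q \in Q)) tpset A Q x).
  apply: eq_bigr => q _.
  rewrite [RHS](reindex_onto (fun Q => q |: Q) (fun Q => Q :\ q)) /=; last first.
    by move=> Q /andP[_ qQ]; rewrite setD1K.
  apply: eq_big => // Q; rewrite setU11 andbT cardsU1.
  case qQ: (q \in Q) => /=; last by rewrite setU1K ?qQ // eqxx add1n eqSS andbT.
  rewrite andbF; apply/esym/negP => /andP[_ /eqP E].
  by move: qQ; rewrite -E !inE eqxx.
rewrite (exchange_big_dep (fun Q : {set P} => #|Q| == k.+1)) /=; last by move=> q Q _ /andP[].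
rewrite scaler_sumr; apply: eq_bigr => Q /eqP cQ.
by rewrite -cQ scaler_nat -sumr_const; apply: eq_bigl => q; rewrite eqxx.
Qed.

Lemma iter_dp_eq0 D (A : 'M[C]_D) (k : nat) x : A *m A = 0 -> (#|P| < k)%N ->
  iter k (dp A) x = 0.
Proof.
move=> A2 Pk; rewrite iter_dp // big1 ?scaler0 // => Q /eqP cQ.
by have := max_card (mem Q); rewrite cQ leqNgt Pk.
Qed.

Lemma tp_sumset D (A : 'M[C]_D) x : tp (1%:M + A) x = \sum_Q tpset A Q x.
Proof.
apply/ffunP => S; rewrite ffunE sum_ffunE.
under [RHS]eq_bigr => Q _ do rewrite ffunE.
rewrite exchange_big; apply: eq_bigr => S' _ /=.
rewrite -mulr_suml; congr (_ * _).
under eq_bigr => q _ do rewrite mxE addrC.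
by rewrite bigA_distr; apply: eq_big => [Q|Q _]; rewrite ?inE //; apply: eq_bigr => q _; case: ifP.
Qed.

End TensorPower.

(** Both sides are the sum of [tpset A Q x] over all sets [Q] of positions, the right one grouped by
    cardinality. Any bound above [#|P|] serves, which lets it be compared with the cutoff in
    [nexp]. *)
Lemma tp_exp (C : numFieldType) (P : finType) D (A : 'M[C]_D) (N : nat) (x : tpow C P D) :
  A *m A = 0 -> (#|P| < N)%N ->
  tp (1%:M + A) x = \sum_(k < N) k`!%:R^-1 *: iter k (dp A) x.
Proof.
move=> A2 PN; rewrite tp_sumset.
rewrite (partition_big (fun Q : {set P} => inord #|Q| : 'I_#|P|.+1) predT) //=.
rewrite [RHS](bigID (fun k : 'I_N => (k < #|P|.+1)%N)) /= [X in _ = _ + X]big1 ?addr0; last first.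
  by move=> k; rewrite -leqNgt => Pk; rewrite iter_dp_eq0 // scaler0.
rewrite -(big_ord_widen N (fun k => k`!%:R^-1 *: iter k (dp A) x)) //.
apply: eq_bigr => k _.
rewrite iter_dp // scalerA mulVf ?scale1r; last by rewrite pnatr_eq0 -lt0n fact_gt0.
apply: eq_bigl => Q; apply/eqP/eqP => [<-|E]; last by apply: val_inj; rewrite /= inordK E.
by rewrite inordK // ltnS max_card.
Qed.

(** * Tensor products of Pluecker vectors *)

Section Multivectors.
Variable C : fieldType.

(** Multilinearity in the columns, each column having its own matrix [A j]; this is what makes [tpf]
    computable on Pluecker vectors. *)
Lemma det_mul_col (m D D' : nat) (B : 'M[C]_(m, D)) (A : 'I_m -> 'M[C]_(D, D')) (s' : 'I_m -> 'I_D') :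
  \det (\matrix_(i, j) (B *m A j) i (s' j)) =
  \sum_(s : {ffun 'I_m -> 'I_D}) (\prod_j A j (s j) (s' j)) * \det (colsub s B).
Proof.
rewrite -det_tr; under [RHS]eq_bigr => s _ do rewrite -det_tr mulr_sumr.
rewrite exchange_big /=; apply: eq_bigr => sg _.
under eq_bigr => j _ do rewrite !mxE.
rewrite bigA_distr_bigA /= mulr_sumr; apply: eq_bigr => s _.
rewrite mulrCA; congr (_ * _); rewrite -big_split /=.
by apply: eq_bigr => j _; rewrite !mxE mulrC.
Qed.

(** The derivative of the determinant in the direction [a *m N], through the adjugate. *)
Lemma det_col_sum (m : nat) (N a : 'M[C]_m) :
  \sum_j0 \det (\matrix_(i, j) (if j == j0 then (a *m N) i j else N i j)) = \tr a * \det N.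
Proof.
transitivity (\tr (a *m N *m \adj N)).
  rewrite mxtrace_mulC /mxtrace; apply: eq_bigr => j0 _.
  rewrite (expand_det_col _ j0) mxE; apply: eq_bigr => i _.
  rewrite !mxE eqxx mulrC; congr (_ * _).
  rewrite /cofactor; congr (_ * \det _); apply/matrixP => i' j'.
  by rewrite !mxE eq_sym (negPf (neq_lift _ _)).
by rewrite -mulmxA mul_mx_adj mul_mx_scalar mxtraceZ mulrC.
Qed.

Variables (K : nat) (k : 'I_K -> nat).

Definition pos : finType := {r : 'I_K & 'I_(k r)}.
Definition mkpos r (j : 'I_(k r)) : pos := Tagged (fun r => 'I_(k r)) j.

Definition slot (J : Type) (S : {ffun pos -> J}) (r : 'I_K) : {ffun 'I_(k r) -> J} :=
  [ffun j => S (mkpos j)].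

Definition unslot (J : Type) (s : forall r, {ffun 'I_(k r) -> J}) : {ffun pos -> J} :=
  [ffun q : pos => s (tag q) (tagged q)].

Lemma slotK J (s : forall r, {ffun 'I_(k r) -> J}) r : slot (unslot s) r = s r.
Proof. by apply/ffunP => j; rewrite !ffunE. Qed.

Lemma sum_slot (J : finType) (G : forall r, {ffun 'I_(k r) -> J} -> C) :
  \sum_(S : {ffun pos -> J}) \prod_r G r (slot S r) = \prod_r \sum_s G r s.
Proof.
pose T_ r : finType := {ffun 'I_(k r) -> J}.
pose P_ r : {ffun T_ r -> C} := [ffun s => G r s].
under [RHS]eq_bigr => r _.
  rewrite (eq_bigr (P_ r)); last by move=> s _; rewrite ffunE.
  rewrite (big_tag (fun r => P_ r : T_ r -> C)).
  over.
rewrite (bigA_distr_big_dep (fun r => mem (tagged_with T_ r))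
  (fun r => untag 0 (P_ r))) /=.
rewrite -(@big_fprod C 0 1 *%R +%R 'I_K T_ P_).
pose h (t : fprod T_) : {ffun pos -> J} := unslot (fun r => t r).
rewrite (reindex h) /=; last first.
  exists (fun S => [fprod r => slot S r]) => [t _|S _].
    by apply/fprodP => r; rewrite fprodE /h slotK.
  by apply/ffunP => -[r j]; rewrite /h !ffunE /= fprodE ffunE.
by apply: eq_bigr => t _; apply: eq_bigr => r _; rewrite /h slotK ffunE.
Qed.

Lemma prod_pos (F : pos -> C) : \prod_q F q = \prod_r \prod_j F (@mkpos r j).
Proof.
by rewrite sig_big_dep /=; apply: eq_bigr => -[r j] _.
Qed.

Lemma sumn_pos (F : pos -> nat) : (\sum_q F q = \sum_r \sum_j F (@mkpos r j))%N.
Proof.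
by rewrite sig_big_dep /=; apply: eq_bigr => -[r j] _.
Qed.

(** The tensor product over the blocks of the wedges of the rows of [B r], as an element of the full
    tensor power. *)
Definition mvec D (B : forall r, 'M[C]_(k r, D)) : tpow C pos D :=
  [ffun S => \prod_r \det (colsub (slot S r) (B r))].

Lemma tpf_mvec D D' (f : pos -> 'M[C]_(D, D')) (B : forall r, 'M[C]_(k r, D)) S :
  tpf f (mvec B) S =
  \prod_r \det (\matrix_(i, j) (B r *m f (mkpos j)) i (slot S r j)).
Proof.
under [RHS]eq_bigr => r _ do rewrite (det_mul_col (B r) (fun j => f (mkpos j)) (slot S r)).
rewrite -(sum_slot (fun r s => (\prod_j f (mkpos j) (s j) (slot S r j)) * \det (colsub s (B r)))).
rewrite ffunE; apply: eq_bigr => S' _.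
rewrite ffunE big_split /=; congr (_ * _).
rewrite prod_pos; apply: eq_bigr => r _; apply: eq_bigr => j _.
by rewrite !ffunE.
Qed.

Lemma tp_mvec D D' (A : 'M[C]_(D, D')) (B : forall r, 'M[C]_(k r, D)) :
  tp A (mvec B) = mvec (fun r => B r *m A).
Proof.
apply/ffunP => S; rewrite tpf_mvec ffunE; apply: eq_bigr => r _.
by congr (\det _); apply/matrixP => i j; rewrite !mxE.
Qed.

Lemma eq_mvec D (B B' : forall r, 'M[C]_(k r, D)) : (forall r, B r = B' r) -> mvec B = mvec B'.
Proof.
by move=> E; apply/ffunP => S; rewrite !ffunE; apply: eq_bigr => r _; rewrite E.
Qed.

Lemma mvec_mull D (G : forall r, 'M[C]_(k r)) (B : forall r, 'M[C]_(k r, D)) :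
  mvec (fun r => G r *m B r) = (\prod_r \det (G r)) *: mvec B.
Proof.
apply/ffunP => S; rewrite !ffunE /GRing.scale /= -big_split /=; apply: eq_bigr => r _.
rewrite -det_mulmx; congr (\det _); apply/matrixP => i j; rewrite !mxE.
by apply: eq_bigr => c _; rewrite !mxE.
Qed.

(** A subspace stable under [A] has an eigenvector of the derivation as Pluecker vector, the
    eigenvalue being the trace on the subspace. *)
Lemma dp_mvec D (A : 'M[C]_D) (B : forall r, 'M[C]_(k r, D)) (a : forall r, 'M[C]_(k r)) :
  (forall r, B r *m A = a r *m B r) -> dp A (mvec B) = (\sum_r \tr (a r)) *: mvec B.
Proof.
move=> BA; apply/ffunP => S; rewrite sum_ffunE !ffunE /GRing.scale /= mulr_suml.
under eq_bigr => q _ do rewrite tpf_mvec.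
transitivity (\sum_r0 \sum_(j0 : 'I_(k r0))
  \prod_r \det (\matrix_(i, j) (B r *m at_pos (mkpos j0) A (mkpos j)) i (slot S r j))).
  rewrite sig_big_dep /=; apply: eq_bigr => -[r j] _; exact: eq_bigr.
apply: eq_bigr => r0 _; rewrite [in RHS](bigD1 r0) //= mulrA -det_col_sum mulr_suml.
apply: eq_bigr => j0 _; rewrite (bigD1 r0) //=; congr (\det _ * _).
  apply/matrixP => i j; rewrite !mxE /at_pos.
  have -> : (mkpos j == mkpos j0) = (j == j0) by rewrite /mkpos eq_Tagged.
  case: eqP => _; rewrite -?BA.
    transitivity ((B r0 *m A) i (slot S r0 j)); first by rewrite mxE.
    by rewrite BA mxE; apply: eq_bigr => c _; rewrite !mxE.
  transitivity ((B r0 *m 1%:M) i (slot S r0 j)); first by rewrite mxE.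
  by rewrite mulmx1.
apply: eq_bigr => r /negPf neq; congr (\det _); apply/matrixP => i j.
rewrite !mxE /at_pos.
have -> : (mkpos j == mkpos j0) = false.
  by apply/negbTE/negP => /eqP /(congr1 (@tag _ _)) /= /eqP; rewrite neq.
transitivity ((B r *m 1%:M) i (slot S r j)); first by rewrite mxE.
by rewrite mulmx1.
Qed.

End Multivectors.

(** * Filtration of tensors by the degree in t, and leading terms *)

Section Filtration.
Variable C : fieldType.

(** The leading part of a product is the product of the leading parts: equality of the total degrees
    forces equality in each factor. *)
Lemma fil_prod (I : finType) (f f0 : I -> C) (al be : I -> nat) :
  (forall i, f i != 0 -> (be i <= al i)%N) ->
  (forall i, f0 i = if be i == al i then f i else 0) ->
  (\prod_i f i != 0 -> (\sum_i be i <= \sum_i al i)%N) /\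
  \prod_i f0 i = if (\sum_i be i == \sum_i al i)%N then \prod_i f i else 0.
Proof.
move=> fil sym; have H : \prod_i f i != 0 -> forall i, (be i <= al i)%N.
  move=> /prodf_neq0 nz i; exact/fil/nz.
have L nz := leqif_sum (fun i (_ : true) => leqif_eq (H nz i)).
split=> [nz|]; first by have [] := L nz.
have [z|nz] := eqVneq (\prod_i f i) 0.
  rewrite z if_same; move/eqP: z; rewrite prodf_seq_eq0 => /hasP[i _ /= fi].
  by rewrite (bigD1 i) //= sym (eqP fi) if_same mul0r.
have [_ ->] := L nz; case: forallP => [E|/forallP].
  by apply: eq_bigr => i _; move: (E i); rewrite sym /= => ->.
rewrite negb_forall => /existsP[i /= ni].
by rewrite (bigD1 i) //= sym (negPf ni) mul0r.
Qed.

(** All terms of the Leibniz formula have the same total degrees, so [fil_prod] applies to each of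
    them. *)
Lemma fil_det (m : nat) (N N0 : 'M[C]_m) (al be : 'I_m -> nat) :
  (forall i j, N i j != 0 -> (be j <= al i)%N) ->
  (forall i j, N0 i j = if be j == al i then N i j else 0) ->
  (\det N != 0 -> (\sum_i be i <= \sum_i al i)%N) /\
  \det N0 = if (\sum_i be i == \sum_i al i)%N then \det N else 0.
Proof.
move=> fil sym.
have H (s : 'S_m) := fil_prod (fun i => fil i (s i)) (fun i => sym i (s i)).
have R (s : 'S_m) : (\sum_i be (s i) = \sum_i be i)%N by rewrite [RHS](reindex_inj (@perm_inj _ s)).
split.
  apply: contraNT => lt; rewrite /determinant big1 // => s _.
  have [Hs _] := H s; have [->|/Hs] := eqVneq (\prod_i N i (s i)) 0; first by rewrite mulr0.
  by rewrite R (negPf lt).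
rewrite /determinant; under [LHS]eq_bigr => s _ do rewrite (H s).2 R.
by case: ifP => // _; rewrite big1 // => s _; rewrite mulr0.
Qed.

Variables (P : finType) (D : nat) (dg : 'I_D -> nat).

Definition tdeg (S : {ffun P -> 'I_D}) := (\sum_q dg (S q))%N.
Definition tcomp (d : nat) (x : tpow C P D) : tpow C P D :=
  [ffun S => if tdeg S == d then x S else 0].
Definition tsupp (d : nat) (x : tpow C P D) := forall S, x S != 0 -> (tdeg S <= d)%N.

(* [A0] is the part of degree j of [A], which raises degrees by at most j.    *)
Definition filmx m (al : 'I_m -> nat) (j : nat) (A A0 : 'M[C]_(m, D)) :=
  forall i c, (A i c != 0 -> (dg c <= al i + j)%N) /\
    A0 i c = if (dg c == al i + j)%N then A i c else 0.

Lemma tcomp_is_linear d : linear (tcomp d).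
Proof.
move=> c x y; apply/ffunP => S; rewrite !ffunE.
by case: ifP => // _; rewrite scaler0 addr0.
Qed.
HB.instance Definition _ d :=
  GRing.isLinear.Build C (tpow C P D) (tpow C P D) _ (tcomp d) (tcomp_is_linear d).

Lemma tsupp_lin d c x y : tsupp d x -> tsupp d y -> tsupp d (c *: x + y).
Proof.
move=> sx sy S; rewrite !ffunE; have [->|/sx //] := eqVneq (x S) 0.
by rewrite scaler0 add0r => /sy.
Qed.

Lemma tsuppW d d' x : (d <= d')%N -> tsupp d x -> tsupp d' x.
Proof. by move=> dd' sx S /sx /leq_trans; apply. Qed.

Lemma tsupp0 d : tsupp d 0.
Proof. by move=> S; rewrite ffunE eqxx. Qed.

Lemma tcomp_eq0 d x d' : tsupp d x -> (d < d')%N -> tcomp d' x = 0.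
Proof.
move=> sx dd'; apply/ffunP => S; rewrite !ffunE; case: eqP => // E.
by apply/eqP; apply: contraTT dd' => /sx; rewrite E -leqNgt.
Qed.

Lemma fil_tpf (f f0 : P -> 'M[C]_D) (js : P -> nat) d x :
  (forall q, filmx dg (js q) (f q) (f0 q)) -> tsupp d x ->
  tsupp (d + \sum_q js q) (tpf f x) /\
  tcomp (d + \sum_q js q) (tpf f x) = tpf f0 (tcomp d x).
Proof.
move=> fil sx.
have H (S S' : {ffun P -> 'I_D}) := fil_prod
  (fun q => (fil q (S q) (S' q)).1) (fun q => (fil q (S q) (S' q)).2).
have sumE (S : {ffun P -> 'I_D}) : (\sum_q (dg (S q) + js q) = tdeg S + \sum_q js q)%N.
  by rewrite big_split.
split=> [S'|].
  rewrite ffunE => nz; rewrite leqNgt; apply: contraNN nz => lt.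
  rewrite big1 // => S _; apply/eqP; rewrite mulf_eq0.
  have [//|/= /sx xS] := boolP (x S == 0); rewrite ?orbT // orbF.
  apply: contraTT lt => /(H S S').1; rewrite sumE -leqNgt => /leq_trans; apply.
  by rewrite leq_add2r.
apply/ffunP => S'; rewrite !ffunE; under [RHS]eq_bigr => S _ do rewrite (H S S').2 sumE ffunE.
rewrite -/(tdeg S'); case: ifP => [/eqP E|nE].
  apply: eq_bigr => S _; rewrite E eqn_add2r [d == _]eq_sym; case: ifP => [//|nd].
  rewrite mul0r; have [->|nz] := eqVneq (x S) 0; first by rewrite mulr0.
  have [->|/(H S S').1] := eqVneq (\prod_q f q (S q) (S' q)) 0; first by rewrite mul0r.
  rewrite sumE -/(tdeg S') E leq_add2r => dS.
  by move: nd; rewrite eqn_leq dS sx.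
apply/esym; rewrite big1 // => S _; case: (tdeg S =P d) => [->|]; last by rewrite mulr0.
by rewrite nE mul0r.
Qed.

Lemma filmx1 : filmx dg 0 (1%:M : 'M[C]_D) 1%:M.
Proof.
move=> i c; rewrite mxE addn0; have [->|_] := eqVneq i c; first by rewrite eqxx.
by rewrite mulr0n if_same; split=> //; rewrite eqxx.
Qed.

(** Applied to x (x) t^j over C[t]/prod (t - z_i), whose leading part is x (x) t^j over C[t]/t^n. *)
Lemma fil_dp (A A0 : 'M[C]_D) (j d : nat) x : filmx dg j A A0 -> tsupp d x ->
  tsupp (d + j) (dp A x) /\ tcomp (d + j) (dp A x) = dp A0 (tcomp d x).
Proof.
move=> fil sx.
have H q : tsupp (d + j) (tpf (at_pos q A) x) /\
    tcomp (d + j) (tpf (at_pos q A) x) = tpf (at_pos q A0) (tcomp d x).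
  have Ej : (\sum_q' (if q' == q then j else 0) = j)%N by rewrite -big_mkcond big_pred1_eq.
  have := @fil_tpf (at_pos q A) (at_pos q A0) (fun q' => if q' == q then j else 0%N) d x.
  rewrite Ej; apply=> // q'; rewrite /at_pos; case: ifP => _ //; exact: filmx1.
split.
  rewrite /dp; elim/big_ind: _ => [|y z sy sz|q _]; first exact: tsupp0.
    by rewrite -[y]scale1r; apply: tsupp_lin.
  by have [] := H q.
rewrite /dp linear_sum /=; apply: eq_bigr => q _; exact: (H q).2.
Qed.

End Filtration.

Lemma fil_mvec (C : fieldType) (K : nat) (k : 'I_K -> nat) (D : nat) (dg : 'I_D -> nat)
    (B B0 : forall r, 'M[C]_(k r, D)) (al : forall r, 'I_(k r) -> nat) :
  (forall r, filmx dg (al r) 0 (B r) (B0 r)) ->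
  tsupp dg (\sum_r \sum_i al r i)%N (mvec B) /\
  tcomp dg (\sum_r \sum_i al r i)%N (mvec B) = mvec B0.
Proof.
move=> fil.
have H (S : {ffun pos k -> 'I_D}) r := @fil_det C (k r)
  (colsub (slot S r) (B r)) (colsub (slot S r) (B0 r)) (al r) (fun j => dg (slot S r j)).
have {}H S r : (\det (colsub (slot S r) (B r)) != 0 ->
     (\sum_i dg (slot S r i) <= \sum_i al r i)%N) /\
   \det (colsub (slot S r) (B0 r)) = if (\sum_i dg (slot S r i) == \sum_i al r i)%N
     then \det (colsub (slot S r) (B r)) else 0.
  apply: H => i j; rewrite !mxE; have [] := fil r i (slot S r j); rewrite addn0 //.
have G S := fil_prod (fun r => (H S r).1) (fun r => (H S r).2).
have dE (S : {ffun pos k -> 'I_D}) : tdeg dg S = (\sum_r \sum_i dg (slot S r i))%N.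
  rewrite /tdeg sumn_pos; apply: eq_bigr => r _; apply: eq_bigr => j _.
  by rewrite ffunE.
split=> [S|]; first by rewrite ffunE dE => /(G S).1.
by apply/ffunP => S; rewrite !ffunE (G S).2 dE.
Qed.

(** * An exchange relation between two determinants *)

Section DeterminantExchange.
Variable C : fieldType.

Lemma col_mx_ord0 (k D : nat) (x : 'rV[C]_D) (A : 'M[C]_(k, D)) c :
  (col_mx x A : 'M_(k.+1, D)) ord0 c = x 0 c.
Proof. by rewrite -[x 0 c](col_mxEu x A); congr (col_mx x A _ c); apply: val_inj. Qed.

Lemma col_mx_lift0 (k D : nat) (x : 'rV[C]_D) (A : 'M[C]_(k, D)) i c :
  (col_mx x A : 'M_(k.+1, D)) (lift ord0 i) c = A i c.
Proof. by rewrite -[A i c](col_mxEd x A); congr (col_mx x A _ c); apply: val_inj. Qed.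

Lemma row_mx_ord0 (k D : nat) (x : 'cV[C]_D) (A : 'M[C]_(D, k)) c :
  (row_mx x A : 'M_(D, k.+1)) c ord0 = x c 0.
Proof. by rewrite -[x c 0](row_mxEl x A); congr (row_mx x A c _); apply: val_inj. Qed.

Lemma row_mx_lift0 (k D : nat) (x : 'cV[C]_D) (A : 'M[C]_(D, k)) c i :
  (row_mx x A : 'M_(D, k.+1)) c (lift ord0 i) = A c i.
Proof. by rewrite -[A c i](row_mxEr x A); congr (row_mx x A c _); apply: val_inj. Qed.

Lemma det_col_dep (k D : nat) (x : 'rV[C]_D) (A : 'M[C]_(k, D)) (X : 'M[C]_(D, k.+1)) :
  (x <= A)%MS -> \det ((col_mx x A : 'M_(k.+1, D)) *m X) = 0.
Proof.
move=> /submxP[w ->]; apply/eqP/det0P.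
exists (row_mx 1%:M (- w) : 'rV_(k.+1)).
  apply/eqP => /(congr1 (fun v : 'rV_(1 + k) => lsubmx v 0 0)).
  by rewrite row_mxKl !mxE eqxx => /eqP; rewrite oner_eq0.
by rewrite mulmxA (mul_row_col 1%:M (- w)) mul1mx mulNmx subrr mul0mx.
Qed.

Lemma det_col_expand (k D : nat) (x : 'rV[C]_D) (A : 'M[C]_(k, D)) (X : 'M[C]_(D, k.+1)) :
  \det ((col_mx x A : 'M_(k.+1, D)) *m X) =
  \sum_(j < k.+1) (-1) ^+ j * (x *m col j X) 0 0 * \det (A *m col' j X).
Proof.
rewrite (expand_det_row _ ord0); apply: eq_bigr => j _.
rewrite /cofactor add0n mulrCA mulrA; congr (_ * _); [congr (_ * _)|apply: (congr1 (@determinant C k))].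
  by rewrite !mxE; apply: eq_bigr => c _; rewrite col_mx_ord0 !mxE.
apply/matrixP => i i'; rewrite !mxE.
by apply: eq_bigr => c _; rewrite col_mx_lift0 !mxE.
Qed.

(* The exchange A /\ b_i (x) B_i^ summed over the rows b_i of [B] moved by    *)
(* [T]: only the row b0 survives, the others being absorbed by [A].           *)
Lemma det_exchange (k l D : nat) (A : 'M[C]_(k, D)) (u b0 : 'rV[C]_D) (B : 'M[C]_(l, D))
    (T : 'M[C]_D) (X : 'M[C]_(D, k.+1)) (Y : 'M[C]_(D, l)) :
  b0 *m T = u -> (B *m T <= A)%MS ->
  \det ((col_mx u A : 'M_(k.+1, D)) *m X) * \det (B *m Y) =
  \sum_(j < k.+1) (-1) ^+ j * (\det (A *m col' j X) *
     \det ((col_mx b0 B : 'M_(l.+1, D)) *m (row_mx (T *m col j X) Y : 'M_(D, l.+1)))).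
Proof.
move=> b0T BT; pose BB : 'M_(l.+1, D) := col_mx b0 B.
have E j : \det (BB *m (row_mx (T *m col j X) Y : 'M_(D, l.+1))) =
   \sum_(i < l.+1) (-1) ^+ i * (row i BB *m T *m col j X) 0 0 * \det (row' i BB *m Y).
  rewrite (expand_det_col _ ord0); apply: eq_bigr => i _.
  rewrite /cofactor addn0 mulrCA mulrA; congr (_ * _); [congr (_ * _)|apply: (congr1 (@determinant C l))].
    rewrite -mulmxA -row_mul !mxE; apply: eq_bigr => c _.
    by rewrite row_mx_ord0.
  apply/matrixP => i1 i2; rewrite !mxE.
  by apply: eq_bigr => c _; rewrite row_mx_lift0 !mxE.
under eq_bigr => j _ do rewrite -/BB E mulr_sumr mulr_sumr.
rewrite exchange_big big_ord_recl [X in _ = _ + X]big1 /=; last first.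
  move=> i _.
  transitivity ((-1) ^+ lift ord0 i * \det (row' (lift ord0 i) BB *m Y) *
     \det ((col_mx (row (lift ord0 i) BB *m T) A : 'M_(k.+1, D)) *m X)).
    rewrite det_col_expand mulr_sumr; apply: eq_bigr => j _; ring.
  rewrite det_col_dep ?mulr0 // -row_mul.
  rewrite (_ : row _ _ = row i (B *m T)); first exact: submx_trans (row_sub _ _) BT.
  apply/rowP => c; rewrite !mxE; apply: eq_bigr => c' _.
  by rewrite /BB col_mx_lift0.
rewrite addr0 det_col_expand mulr_suml; apply: eq_bigr => j _.
have -> : row ord0 BB = b0 by apply/rowP => c; rewrite mxE col_mx_ord0.
have -> : row' ord0 BB = B by apply/matrixP => i c; rewrite mxE col_mx_lift0.
by rewrite b0T expr0 mul1r; ring.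
Qed.

End DeterminantExchange.

(** * Spans of minors on the cell exp(e(p)) [P] *)

Section ToeplitzFlag.
Variable C : fieldType.
Implicit Types (p f g : {poly C}) (n k : nat).

(** The vector f v_- + g v_+ modulo t^n. In these coordinates [mulx n p] is the Toeplitz matrix of
    multiplication by p, [tau n j] the action of t^j and [umx n p] that of exp(e(p)). *)
Definition pr n f g : 'rV[C]_(n + n) := row_mx (\row_l f`_l) (\row_l g`_l).

Definition mulx n p : 'M[C]_n := \matrix_(i < n, l < n) (p * 'X^i)`_l.
Definition tau n j : 'M[C]_(n + n) := block_mx (mulx n 'X^j) 0 0 (mulx n 'X^j).
Definition umx n p : 'M[C]_(n + n) := block_mx 1%:M 0 (mulx n p) 1%:M.

Lemma row_mulx n f p : (\row_l f`_l) *m mulx n p = \row_l (p * f)`_l.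
Proof.
apply/rowP => l; rewrite !mxE coefMr.
rewrite (big_ord_widen n (fun j => p`_(l - j) * f`_j)) // [RHS]big_mkcond /=.
apply: eq_bigr => i _; rewrite !mxE coefMXn ltnS [(i <= l)%N]leqNgt.
by case: ifP => _; rewrite ?mulr0 // mulrC.
Qed.

Lemma pr_tau n f g j : pr n f g *m tau n j = pr n ('X^j * f) ('X^j * g).
Proof. by rewrite /pr /tau mul_row_block !mulmx0 addr0 add0r !row_mulx. Qed.

Lemma prD n f g f' g' : pr n (f + f') (g + g') = pr n f g + pr n f' g'.
Proof.
by rewrite /pr add_row_mx; congr row_mx; apply/rowP => l; rewrite !mxE coefD.
Qed.

Lemma prZ n c f g : pr n (c *: f) (c *: g) = c *: pr n f g.
Proof.
by rewrite /pr scale_row_mx; congr row_mx; apply/rowP => l; rewrite !mxE coefZ.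
Qed.

Lemma pr_umx n f g p : pr n f g *m umx n p = pr n (f + p * g) g.
Proof.
rewrite /pr mul_row_block !mulmx1 mulmx0 add0r row_mulx; congr row_mx.
by apply/rowP => l; rewrite !mxE coefD.
Qed.

Lemma pr_ge n f g j : (n <= j)%N -> pr n ('X^j * f) ('X^j * g) = 0.
Proof.
move=> nj; rewrite -row_mx0; congr row_mx; apply/rowP => l;
  by rewrite !mxE coefXnM (leq_trans (ltn_ord l) nj).
Qed.

Lemma det_umx n p : \det (umx n p) = 1.
Proof. by rewrite det_lblock !det1 mulr1. Qed.

(* The subspace V_m of the flag exp(e(p)) [P] is spanned by the first 2n - m  *)
(* of the vectors p t^i v_- + t^i v_+ (i = 0, ..., n - 1) and                 *)
(* t^(n-1) v_-, ..., v_-.                                                     *)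
Definition vrow n p i : 'rV[C]_(n + n) :=
  if (i < n)%N then pr n ('X^i * p) 'X^i else pr n 'X^(n.*2.-1 - i) 0.

(** The order is reversed so that the next vector is added on top ([rmxS]), where [det_exchange]
    expects it. *)
Definition rmx n k p : 'M[C]_(k, n + n) := \matrix_(i < k) vrow n p (k.-1 - i).

Lemma vrow_umx n p q i : vrow n p i *m umx n q = vrow n (p + q) i.
Proof.
rewrite /vrow; case: ifP => _; rewrite pr_umx ?mulr0 ?addr0 //.
by rewrite mulrDr [q * _]mulrC.
Qed.

Lemma rmx_umx n k p q : rmx n k p *m umx n q = rmx n k (p + q).
Proof. by apply/row_matrixP => i; rewrite row_mul !rowK vrow_umx. Qed.

Lemma rmxS n k p : rmx n k.+1 p = col_mx (vrow n p k) (rmx n k p).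
Proof.
apply/matrixP => i c; rewrite mxE; case: (unliftP ord0 i) => [j|] ->.
  rewrite (col_mx_lift0 (vrow n p k)) mxE /= /bump /=; congr (vrow _ _ _ _ _); lia.
by rewrite (col_mx_ord0 (vrow n p k)) subn0.
Qed.

Lemma vrow_sub n k p i : (i < k)%N -> (vrow n p i <= rmx n k p)%MS.
Proof.
move=> ik; have lt : (k.-1 - i < k)%N by lia.
have -> : vrow n p i = row (Ordinal lt) (rmx n k p) by rewrite rowK /=; congr (vrow _ _ _); lia.
exact: row_sub.
Qed.

Lemma det_rmx_full n k p q (X : 'M[C]_(n + n, k)) : k = (n + n)%N ->
  \det (rmx n k p *m X) = \det (rmx n k q *m X).
Proof.
move=> E; subst k; have -> : rmx n (n + n) p = rmx n (n + n) q *m umx n (p - q).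
  by rewrite rmx_umx addrC subrK.
by rewrite !det_mulmx det_umx mulr1.
Qed.

(** Codimensions n, s + 1 are traded for n + 1, s. Multiplication by t^(n-s) takes t^s v_-, the row
    added to the second factor, to the top row t^n v_- of the first; it kills the vectors t^j v_-
    with j > s and shifts the remaining rows within the span of the t^i (p v_- + v_+). *)
Lemma det_rmx_exchange n s p (X : 'M[C]_(n.+1 + n.+1, n.+2))
    (Y : 'M[C]_(n.+1 + n.+1, n.+1.*2 - s.+1)) : (s < n)%N ->
  \det (rmx n.+1 n.+2 p *m X) * \det (rmx n.+1 (n.+1.*2 - s.+1) p *m Y) =
  \sum_(j < n.+2) (-1) ^+ j * (\det (rmx n.+1 n.+1 p *m col' j X) *
     \det (rmx n.+1 (n.+1.*2 - s.+1).+1 p *m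
        (row_mx (tau n.+1 (n - s) *m col j X) Y : 'M_(_, (n.+1.*2 - s.+1).+1)))).
Proof.
move=> sn; rewrite [rmx n.+1 n.+2 p]rmxS.
under eq_bigr => j _ do rewrite [rmx _ _.+1 p in X in _ * (_ * X)]rmxS.
apply: det_exchange.
  rewrite /vrow ltnn ltnNge (_ : (n < _)%N = true) /=; last by lia.
  rewrite pr_tau mulr0 -exprD; congr (pr _ 'X^_ _); lia.
apply/row_subP => i; rewrite row_mul rowK.
set v := (_.-1 - i)%N; have vk : (v <= n.+1.*2 - s.+2)%N by rewrite /v; lia.
move: v vk => v vk {i}; rewrite /vrow; case: ltnP => vn; rewrite pr_tau.
  have [lt|ge] := ltnP (v + (n - s)) n.+1.
    have := @vrow_sub n.+1 n.+1 p _ lt; rewrite /vrow lt.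
    by rewrite mulrA -exprD [(n - s + v)%N]addnC.
  rewrite mulrA -exprD -['X^(n - s + v) in X in pr _ _ X]mulr1 pr_ge ?sub0mx //; lia.
rewrite -exprD mulr0 -['X^_]mulr1 -(mulr0 'X^(n - s + (n.+1.*2.-1 - v))).
by rewrite pr_ge ?sub0mx //; lia.
Qed.

End ToeplitzFlag.

(** * Dependence of minors on the top coefficient of p, and comparison of successive powers of t *)

Section ToeplitzReduction.
Variable C : fieldType.
Implicit Types (p f g : {poly C}) (n k : nat).

Lemma det_reindex_rows k (f : 'I_k -> 'I_k) : injective f ->
  exists b : bool, forall A B : 'M[C]_k,
    (forall i, row i A = row (f i) B) -> \det A = (-1) ^+ b * \det B.
Proof.
move=> finj; exists (odd_perm (perm finj)) => A B E.
have -> : A = row_perm (perm finj) B.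
  by apply/matrixP => i j; have /rowP/(_ j) := E i; rewrite !mxE permE.
by rewrite row_permE det_mulmx det_perm.
Qed.

(** The derivative of [rmx] along t^n: only the last row p v_- + v_+ changes, by t^n v_-, since t^n
    t^i vanishes for i > 0. *)
Definition rmx_dir n k p : 'M[C]_(k.+1, n.+1 + n.+1) :=
  \matrix_(i < k.+1) vrow n.+1 p (if i == ord_max then n.+1 else k - i)%N.

Lemma vrow_dir n p (s : C) i : (i <= n.+1.*2)%N ->
  vrow n.+1 (p + s *: 'X^n) i =
  vrow n.+1 p i + (if i == 0 then s *: vrow n.+1 p n.+1 else 0).
Proof.
rewrite /vrow ltnn => _; case: ifP => [lt|]; last first.
  by move=> /negbT; rewrite -leqNgt; case: i => // i _; rewrite addr0.
rewrite mulrDr -['X^i in X in pr _ _ X]addr0 prD; congr (_ + _).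
have -> : pr n.+1 ('X^i * (s *: 'X^n)) 0 = s *: pr n.+1 ('X^(n + i)) 0.
  by rewrite -prZ scaler0 -scalerAr -exprD addnC.
case: eqP => [->|ne].
  by congr (_ *: pr _ 'X^_ _); lia.
rewrite -['X^_]mulr1 -(mulr0 'X^(n + i)) pr_ge ?scaler0 //; lia.
Qed.

Lemma det_rmx_dir n k p (s : C) (X : 'M[C]_(n.+1 + n.+1, k.+1)) : (k < n.+1.*2)%N ->
  \det (rmx n.+1 k.+1 (p + s *: 'X^n) *m X) =
  \det (rmx n.+1 k.+1 p *m X) + s * \det (rmx_dir n k p *m X).
Proof.
move=> kn; rewrite -[X in _ = X + _]mul1r.
apply: (determinant_multilinear (i0 := ord_max)).
- rewrite !row_mul scale1r scalemxAl -mulmxDl; congr (_ *m _).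
  by rewrite !rowK /= eqxx subnn vrow_dir // eqxx.
- apply/matrixP => i j; rewrite !mxE; apply: eq_bigr => c _; rewrite !mxE; congr (_ * _).
  rewrite vrow_dir; last by lia.
  case: eqP => [|_]; last by rewrite addr0.
  by rewrite lift_max; have := ltn_ord i; rewrite /=; lia.
- apply/matrixP => i j; rewrite !mxE; apply: eq_bigr => c _; rewrite !mxE; congr (_ * _).
  have -> : (lift ord_max i == ord_max :> 'I_k.+1) = false by rewrite eq_sym (negPf (neq_lift _ _)).
  rewrite vrow_dir; last by lia.
  case: eqP => [|_]; last by rewrite addr0.
  by rewrite lift_max; have := ltn_ord i; rewrite /=; lia.
Qed.

(** With more than n + 1 rows the vector t^n v_- is already among the others. *)
Lemma det_rmx_dir_eq0 n k p (X : 'M[C]_(n.+1 + n.+1, k.+1)) : (n.+1 <= k)%N ->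
  \det (rmx_dir n k p *m X) = 0.
Proof.
move=> nk; have lt : (k - n.+1 < k.+1)%N by lia.
apply: (determinant_alternate (i1 := ord_max) (i2 := Ordinal lt)).
  by apply/eqP => /(congr1 val) /=; lia.
move=> j; rewrite !mxE; apply: eq_bigr => c _; rewrite !mxE eqxx; congr (vrow _ _ _ _ _ * _).
by case: eqP => [/(congr1 val)|_] /=; lia.
Qed.

Definition injmx n : 'M[C]_(n, n.+1) := \matrix_(i, j) (j == i.+1 :> nat)%:R.

Lemma row_injmx n f : (\row_(l < n) f`_l) *m injmx n = \row_(l < n.+1) ('X * f)`_l.
Proof.
apply/rowP => l; rewrite !mxE coefXM; case: (unliftP ord0 l) => [i ->|->].
  rewrite !lift0 /= (bigD1 i) //= !mxE lift0 eqxx mulr1 big1 ?addr0 // => j ne.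
  rewrite !mxE lift0 eqSS; case: eqP => [E|]; last by rewrite mulr0.
  by case/eqP: ne; apply: val_inj.
by rewrite big1 // => i _; rewrite !mxE mulr0.
Qed.

Definition inj2 n : 'M[C]_(n + n, n.+1 + n.+1) := block_mx (injmx n) 0 0 (injmx n).

Lemma pr_inj2 n f g : pr n f g *m inj2 n = pr n.+1 ('X * f) ('X * g).
Proof. by rewrite /pr /inj2 mul_row_block !mulmx0 addr0 add0r !row_injmx. Qed.

Lemma injmx_tr n : injmx n *m (injmx n)^T = 1%:M.
Proof.
apply/matrixP => i j; rewrite !mxE (bigD1 (lift ord0 i)) //= !mxE lift0 eqxx mul1r.
rewrite big1 ?addr0 => [|l ne]; first by rewrite eqSS.
rewrite !mxE; case: eqP => [E|]; last by rewrite mul0r.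
by case/eqP: ne; apply: val_inj.
Qed.

Lemma inj2_tr n : inj2 n *m (inj2 n)^T = 1%:M.
Proof.
rewrite /inj2 tr_block_mx !trmx0 mulmx_block !mulmx0 !mul0mx !addr0 !add0r injmx_tr.
by rewrite -scalar_mx_block.
Qed.

(** The replaced row was the only one not divisible by t. Dividing by t leaves, up to order, the
    basis of V_n modulo t^(n+1). *)
Lemma det_rmx_dir_top n (Y : 'M[C]_(n.+1 + n.+1, n.+2)) :
  exists (X : 'M[C]_(n.+2 + n.+2, n.+2)) (b : bool), forall p,
    \det (rmx_dir n.+1 n.+1 p *m X) = (-1) ^+ b * \det (rmx n.+1 n.+2 p *m Y).
Proof.
pose f (i : 'I_n.+2) : 'I_n.+2 := if i == ord_max then ord0 else inord i.+1.
have finj : injective f.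
  move=> i j; rewrite /f; have [->|ni] := eqVneq i ord_max; have [->|nj] := eqVneq j ord_max => //.
  - move/(congr1 val); rewrite /= inordK //; move: nj (ltn_ord j); rewrite -val_eqE /=; lia.
  - move/(congr1 val); rewrite /= inordK //; move: ni (ltn_ord i); rewrite -val_eqE /=; lia.
  move/(congr1 val); rewrite /= !inordK; first by move=> [/val_inj].
    by move: nj (ltn_ord j); rewrite -val_eqE /=; lia.
  by move: ni (ltn_ord i); rewrite -val_eqE /=; lia.
have [b Eb] := det_reindex_rows finj.
exists ((inj2 n.+1)^T *m Y), b => p.
have := Eb (rmx_dir n.+1 n.+1 p *m ((inj2 n.+1)^T *m Y)) (rmx n.+1 n.+2 p *m Y).
apply=> i; rewrite !row_mul !rowK.
rewrite -[in RHS](mul1mx Y) -(inj2_tr n.+1) !mulmxA; congr (_ *m _ *m _).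
rewrite /f; have [_|ni] := eqVneq i ord_max.
  rewrite subn0 /vrow !ltnn pr_inj2 mulr0 -exprS; congr (pr _ 'X^_ _); lia.
have ilt : (i < n.+1)%N by move: ni (ltn_ord i); rewrite -val_eqE /=; lia.
rewrite inordK // /vrow /= ifT; last by lia.
rewrite ifT ?pr_inj2; last by lia.
rewrite -exprS mulrA -exprS; congr (pr _ ('X^_ * _) 'X^_); lia.
Qed.

Definition restmx n : 'M[C]_(n.+1, n) := \matrix_(i, j) (i == j :> nat)%:R.

Lemma row_restmx n f : (\row_(l < n.+1) f`_l) *m restmx n = \row_(l < n) f`_l.
Proof.
apply/rowP => l; rewrite !mxE (bigD1 (widen_ord (leqnSn n) l)) //= !mxE eqxx mulr1.
rewrite big1 ?addr0 // => i ne; rewrite !mxE; case: eqP => [E|]; last by rewrite mulr0.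
by case/eqP: ne; apply: val_inj.
Qed.

Definition rest2 n : 'M[C]_(n.+1 + n.+1, n + n) := block_mx (restmx n) 0 0 (restmx n).

Lemma pr_rest2 n f g : pr n.+1 f g *m rest2 n = pr n f g.
Proof. by rewrite /pr /rest2 mul_row_block !mulmx0 addr0 add0r !row_restmx. Qed.

Definition lastcol n : 'M[C]_(n.+1 + n.+1, 1 + 1) :=
  block_mx (delta_mx ord_max 0) 0 0 (delta_mx ord_max 0).

Lemma pr_lastcol n f g : pr n.+1 f g *m lastcol n = row_mx (f`_n)%:M (g`_n)%:M.
Proof.
have E h : (\row_(l < n.+1) h`_l) *m delta_mx ord_max (0 : 'I_1) = (h`_n)%:M.
  apply/matrixP => i j; rewrite !ord1 !mxE eqxx (bigD1 ord_max) //= !mxE !eqxx mulr1.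
  rewrite big1 ?addr0 // => l /negPf ne; by rewrite !mxE ne mulr0.
by rewrite /pr /lastcol mul_row_block !mulmx0 addr0 add0r !E.
Qed.

(** Modulo t^n the rows t^n v_- and t^n (p v_- + v_+) vanish, and the others form the basis of the
    subspace of the same codimension. Two columns of [X] read off the coefficients of t^n and see a
    triangular block with diagonal 1 on those two rows. *)
Lemma det_rmx_red n k (Y : 'M[C]_(n + n, k)) : (n <= k)%N -> (k <= n.*2)%N ->
  exists (X : 'M[C]_(n.+1 + n.+1, k.+2)) (b : bool), forall p,
    \det (rmx n.+1 k.+2 p *m X) = (-1) ^+ b * \det (rmx n k p *m Y).
Proof.
move=> nk kn.
(* [fn] moves the vectors numbered n + 1 and n to the front and keeps the order of the others; [w]
   lists the vectors in the new order. *)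
pose fn i := if (i < k - n)%N then i.+2 else if i == (k - n)%N then 0%N
  else if i == (k - n).+1 then 1%N else i.
have fnP i : (i < k.+2)%N -> (fn i < k.+2)%N.
  by rewrite /fn => ik; case: ifP => ?; [|case: eqP => ?; [|case: eqP => ?]]; lia.
pose f (i : 'I_k.+2) : 'I_k.+2 := Ordinal (fnP i (ltn_ord i)).
have finj : injective f.
  move=> i j /(congr1 val) /= E; apply: val_inj => /=; move: E; rewrite /fn.
  by do 2!(case: ifP => ?; [|case: eqP => ?; [|case: eqP => ?]]); lia.
have [b Eb] := det_reindex_rows finj.
pose skip v := if (v < n)%N then v else v.+2.
pose w (i : nat) := if i == 0%N then n.+1 else if i == 1%N then n else skip (k.-1 - i.-2)%N.
have wf i : (i < k.+2)%N -> w (fn i) = (k.+1 - i)%N.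
  rewrite /w /skip /fn => ik; case: ltngtP => [lt|gt|eq] /=; last by lia.
    by rewrite ifF; lia.
  have [E|ne] := eqVneq i (k - n).+1; first by rewrite /=; lia.
  have -> : (i == 0%N) = false by lia.
  have -> : (i == 1%N) = false by lia.
  by rewrite ifT; lia.
pose W p : 'M[C]_(2 + k, n.+1 + n.+1) := \matrix_(i < 2 + k) vrow n.+1 p (w i).
pose X : 'M[C]_(n.+1 + n.+1, 2 + k) := row_mx (lastcol n) (rest2 n *m Y).
exists X, b => p.
rewrite (Eb (rmx n.+1 k.+2 p *m X) (W p *m X)); last first.
  move=> i; rewrite !row_mul !rowK /= wf //; congr (vrow _ _ _ *m _); lia.
congr (_ * _).
have -> : W p *m X = block_mx (usubmx (W p) *m lastcol n) 0
    (dsubmx (W p) *m lastcol n) (rmx n k p *m Y).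
  rewrite -[W p]vsubmxK /X mul_col_row !col_mxKu !col_mxKd !mulmxA.
  congr block_mx.
    apply/row_matrixP => i; rewrite row0 !row_mul.
    have -> : row i (usubmx (W p)) = vrow n.+1 p (w i).
      by apply/rowP => c; rewrite !mxE.
    rewrite /vrow /w; case: i => [[|[|i]] ?] //=.
      by rewrite ltnn pr_rest2 -['X^_]mulr1 -(mulr0 'X^(n.+1.*2.-1 - n.+1)) pr_ge ?mul0mx //; lia.
    by rewrite ltnSn pr_rest2 -['X^n in X in pr _ _ X]mulr1 pr_ge ?mul0mx.
  congr (_ *m _); apply/row_matrixP => i; rewrite row_mul rowK.
  have -> : row i (dsubmx (W p)) = vrow n.+1 p (w i.+2).
    by apply/rowP => c; rewrite !mxE.
  rewrite /w /= /vrow /skip; case: (ltnP (k.-1 - i) n) => lt.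
    by rewrite ifT ?pr_rest2 // ltnW.
  rewrite ifF ?pr_rest2; last by lia.
  congr (pr _ 'X^_ _); lia.
rewrite (det_lblock (usubmx (W p) *m lastcol n)).
suff -> : \det (usubmx (W p) *m lastcol n) = 1 by rewrite mul1r.
have E i j : (usubmx (W p) *m lastcol n) i j = (vrow n.+1 p (w i) *m lastcol n) 0 j.
  by rewrite !mxE; apply: eq_bigr => c _; rewrite !mxE.
have e0 (x y : C) : (row_mx x%:M y%:M : 'M_(1, 2)) 0 0 = x.
  by rewrite mxE; case: splitP => l //= _; rewrite ord1 mxE.
have e1 (x y : C) : (row_mx x%:M y%:M : 'M_(1, 2)) 0 1 = y.
  by rewrite mxE; case: splitP => l /=; rewrite ord1 // mxE.
rewrite det_mx22 !E /w /= /vrow ltnn ltnSn !pr_lastcol !e0 !e1 coef0 mul0r subr0.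
by rewrite !coefXn eqxx mulr1 (_ : n == _) //; lia.
Qed.

End ToeplitzReduction.

(** * Spans of products of minors as functions of p *)

Section MinorFunctions.
Variable C : numFieldType.
Implicit Types (p : {poly C}) (n k m : nat) (ms : seq nat) (f g h : {poly C} -> C).

Inductive spn (G : ({poly C} -> C) -> Prop) : ({poly C} -> C) -> Prop :=
| SpnZero f : (forall p, f p = 0) -> spn G f
| SpnAdd c g f h : G g -> spn G f -> (forall p, h p = c * g p + f p) -> spn G h.

Lemma spn_ext G f g : spn G f -> (forall p, g p = f p) -> spn G g.
Proof.
case=> [{}f f0 | c g1 f1 {}f G1 f1S fE] gE; first by apply: SpnZero => p; rewrite gE.
by apply: SpnAdd G1 f1S _ => p; rewrite gE.
Qed.

Lemma spn_gen (G : ({poly C} -> C) -> Prop) f : G f -> spn G f.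
Proof.
move=> Gf; apply: (@SpnAdd G 1 f (fun=> 0)) => // [|p]; first exact: SpnZero.
by rewrite mul1r addr0.
Qed.

Lemma spn_lin G c f g h : spn G f -> spn G g -> (forall p, h p = c * f p + g p) -> spn G h.
Proof.
move=> Sf Sg; elim: Sf h => [{}f f0 | c1 g1 f1 {}f G1 _ IH fE] h hE.
  by apply: spn_ext Sg _ => p; rewrite hE f0 mulr0 add0r.
apply: (@SpnAdd G (c * c1) g1 (fun p => c * f1 p + g p)) => //; first exact: IH.
by move=> p; rewrite hE fE mulrDr mulrA addrA.
Qed.

Lemma spn_scale G c f g : spn G f -> (forall p, g p = c * f p) -> spn G g.
Proof.
move=> Sf gE; apply: (spn_lin Sf (SpnZero _ (fun p => erefl (0 : C)))) => p.
by rewrite gE addr0.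
Qed.

Lemma spn_sum G (I : finType) (c : I -> C) (F : I -> {poly C} -> C) :
  (forall i, spn G (F i)) -> spn G (fun p => \sum_i c i * F i p).
Proof.
move=> SF; suff H (r : seq I) : spn G (fun p => \sum_(i <- r) c i * F i p).
  by apply: spn_ext (H (index_enum I)) _.
elim: r => [|i r IH]; first by apply: SpnZero => p; rewrite big_nil.
by apply: (spn_lin (SF i) IH) => p; rewrite big_cons.
Qed.

Lemma spn_sub (G H : ({poly C} -> C) -> Prop) f :
  (forall g, G g -> spn H g) -> spn G f -> spn H f.
Proof.
move=> GH; elim=> [{}f f0 | c g {}f h Gg _ IH hE]; first exact: SpnZero.
exact: (spn_lin (GH _ Gg) IH hE).
Qed.

(** One factor for each m in the list, linear in the Pluecker vector of V_m of the flag exp(e(p))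
    [P]. An arbitrary [X] instead of a choice of columns keeps the family stable under the
    reductions above. *)
Inductive gen n : seq nat -> ({poly C} -> C) -> Prop :=
| GenNil f : (forall p, f p = 1) -> gen n [::] f
| GenCons m k ms X f g : (k + m = n.*2)%N -> gen n ms f ->
    (forall p, g p = \det (rmx n k p *m X) * f p) -> gen n (m :: ms) g.

Definition minors n ms := spn (gen n ms).

Lemma minors_cons n m k ms X f g : (k + m = n.*2)%N -> minors n ms f ->
  (forall p, g p = \det (rmx n k p *m X) * f p) -> minors n (m :: ms) g.
Proof.
move=> km Sf; elim: Sf g => [{}f f0 | c g1 f1 {}f G1 _ IH fE] g gE.
  by apply: SpnZero => p; rewrite gE f0 mulr0.
apply: (@SpnAdd _ c (fun p => \det (rmx n k p *m X) * g1 p)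
  (fun p => \det (rmx n k p *m X) * f1 p)); first exact: (GenCons km G1 (fun p => erefl _)).
  exact: (IH _ (fun p => erefl _)).
by move=> p; rewrite gE fE; ring.
Qed.

Lemma gen_insert n m k ms1 ms2 X f g : (k + m = n.*2)%N -> gen n (ms1 ++ ms2) f ->
  (forall p, g p = \det (rmx n k p *m X) * f p) -> gen n (ms1 ++ m :: ms2) g.
Proof.
move=> km; elim: ms1 f g => [|m1 ms1 IH] f g /= Gf gE; first exact: (GenCons km Gf gE).
inversion Gf as [|m' k1 ms X1 f1 g1 k1m Gf1 fE]; subst.
apply: (@GenCons n m1 k1 _ X1 (fun p => \det (rmx n k p *m X) * f1 p)) => //.
  exact: (IH _ _ Gf1 (fun p => erefl _)).
by move=> p; rewrite gE fE; ring.
Qed.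

Lemma gen_perm n ms ms' f : perm_eq ms ms' -> gen n ms f -> gen n ms' f.
Proof.
elim: ms ms' f => [|m ms IH] ms' f pe Gf.
  by move: pe; rewrite perm_sym => /perm_nilP ->.
inversion Gf as [|m' k1 ms1 X1 f1 g1 k1m Gf1 fE]; subst.
have min : m \in ms' by rewrite -(perm_mem pe) inE eqxx.
case/splitPr: ms' / min pe => s1 s2 pe.
apply: (gen_insert k1m) fE; apply: IH Gf1.
by move: pe; rewrite -(cat1s m s2) perm_sym perm_catCA perm_cons perm_sym.
Qed.

Lemma minors_perm n ms ms' f : perm_eq ms ms' -> minors n ms f -> minors n ms' f.
Proof.
by move=> pe; apply: spn_sub => g Gg; apply: spn_gen; apply: gen_perm pe Gg.
Qed.

(** These minors belong to V_0, the whole space, on which exp(e(p)) has determinant 1; they are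
    constant. *)
Lemma minors_cons0 n ms f : minors n (0 :: ms)%N f -> minors n ms f.
Proof.
apply: spn_sub => {}f Gf; inversion Gf as [|m' k1 ms1 X1 f1 g1 k1m Gf1 fE]; subst.
apply: (@spn_scale _ (\det (rmx n k1 0 *m X1)) f1); first exact: spn_gen.
move=> p; rewrite fE (det_rmx_full p 0) //; lia.
Qed.

Lemma minors_exchange n s ms f : (s < n)%N ->
  minors n.+1 (n :: s.+1 :: ms) f -> minors n.+1 (n.+1 :: s :: ms) f.
Proof.
move=> sn; apply: spn_sub => {}f Gf.
inversion Gf as [|m' k1 ms1 X f1 g1 k1m Gf1 fE]; subst.
inversion Gf1 as [|m' k2 ms2 Y f2 g2 k2m Gf2 f1E]; subst.
have E1 : k1 = n.+2 by lia.
have E2 : k2 = (n.+1.*2 - s.+1)%N by lia.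
subst k1 k2.
apply: spn_ext (spn_sum (fun j : 'I_n.+2 => (-1) ^+ j) _) _; last first.
  move=> p; rewrite fE f1E mulrA (det_rmx_exchange _ _ _ sn) mulr_suml.
  by apply: eq_bigr => j _; rewrite -!mulrA.
move=> j; apply: (minors_cons (k := n.+1) (X := col' j X)
  (f := fun p => \det (rmx n.+1 (n.+1.*2 - s.+1).+1 p *m
        (row_mx (tau C n.+1 (n - s) *m col j X) Y : 'M_(_, (n.+1.*2 - s.+1).+1))) * f2 p)) => //.
  lia.
apply: minors_cons (spn_gen Gf2) _ => //; lia.
Qed.

Lemma minors_lift0 n ms f : all (fun m => m <= n)%N ms -> minors n ms f -> minors n.+1 ms f.
Proof.
move=> le; apply: spn_sub => {}f Gf; elim: Gf le => [{}f f1 _| m k {}ms X {}f g km Gf IH gE].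
  exact/spn_gen/GenNil.
move=> /= /andP[mn le]; have nk : (n <= k)%N by lia.
have [|X' [b E]] := det_rmx_red X nk; first by lia.
apply: (@spn_scale _ ((-1) ^+ b) (fun p => \det (rmx n.+1 k.+2 p *m X') * f p)).
  by apply: minors_cons (IH le) _ => //; lia.
by move=> p; rewrite gE E mulrA mulrA -expr2 sqrr_sign mul1r.
Qed.

(* Along the line p + s t^n the function f is a polynomial of degree at most  *)
(* d in s, and g p is the coefficient of s^d.                                 *)
Definition topc n d f g := forall p, exists q : {poly C},
  [/\ (size q <= d.+1)%N, q`_d = g p & forall s, f (p + s *: 'X^n) = q.[s]].

Lemma topc_mul n d d' f f' g g' h : topc n d f g -> topc n d' f' g' ->
  (forall p, h p = f p * f' p) -> topc n (d + d') h (fun p => g p * g' p).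
Proof.
move=> tf tf' hE p; have [q [sq qd qE]] := tf p; have [q' [sq' qd' qE']] := tf' p.
exists (q * q'); split; last by move=> s; rewrite hE hornerM qE qE'.
  apply: leq_trans (size_polyMleq _ _) _; lia.
rewrite coefM (bigD1 (inord d)) //= inordK; last by lia.
rewrite qd addKn qd' big1 ?addr0 // => i ne.
have [lt|] := ltnP i d; last first.
  rewrite leq_eqVlt => /orP[/eqP E|lt]; last by rewrite (nth_default _ (leq_trans sq lt)) mul0r.
  by case/eqP: ne; apply: val_inj; rewrite /= inordK //; lia.
by rewrite [X in _ * X]nth_default ?mulr0 // (leq_trans sq') //; lia.
Qed.

Lemma topc_lin n d c f f' g g' h : topc n d f g -> topc n d f' g' ->
  (forall p, h p = c * f p + f' p) -> topc n d h (fun p => c * g p + g' p).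
Proof.
move=> tf tf' hE p; have [q [sq qd qE]] := tf p; have [q' [sq' qd' qE']] := tf' p.
exists (c *: q + q'); split; last by move=> s; rewrite hE hornerD hornerZ qE qE'.
  apply: leq_trans (size_polyD _ _) _; rewrite geq_max sq' andbT.
  exact: leq_trans (size_scale_leq _ _) sq.
by rewrite coefD coefZ qd qd'.
Qed.

Lemma topc_weak n d d' f g : topc n d f g -> (d < d')%N -> topc n d' f (fun=> 0).
Proof.
move=> tf dd' p; have [q [sq qd qE]] := tf p; exists q; split=> //.
  by apply: leq_trans sq _; lia.
by rewrite nth_default // (leq_trans sq).
Qed.

Lemma topc0 n d f : (forall p, f p = 0) -> topc n d f (fun=> 0).
Proof. by move=> f0 p; exists 0; rewrite size_poly0 coef0; split=> // s; rewrite horner0. Qed.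

Lemma topc_eq n d f g g' : topc n d f g -> (forall p, g' p = g p) -> topc n d f g'.
Proof. by move=> tf gE p; have [q [sq qd qE]] := tf p; exists q; rewrite gE. Qed.

Lemma topc_const n c f : (forall p, f p = c) -> topc n 0 f (fun=> c).
Proof.
move=> fE p; exists c%:P; rewrite size_polyC coefC; split=> // [|s]; first by case: eqP.
by rewrite fE hornerC.
Qed.

Lemma topc_det n k (X : 'M[C]_(n.+1 + n.+1, k.+1)) : (k < n.+1.*2)%N ->
  topc n 1 (fun p => \det (rmx n.+1 k.+1 p *m X)) (fun p => \det (rmx_dir n k p *m X)).
Proof.
move=> kn p; exists ((\det (rmx_dir n k p *m X))%:P * 'X + (\det (rmx n.+1 k.+1 p *m X))%:P).
split=> [||s]; last by rewrite det_rmx_dir // hornerMXaddC hornerC addrC mulrC.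
  by rewrite size_MXaddC size_polyC; case: ifP => // _; case: eqP.
by rewrite coefD coefMX !coefC /= addr0.
Qed.

(** Here the codimension is at most n; so only the factors for V_(n+1) contribute to the degree in
    s. *)
Lemma topc_det0 n k (X : 'M[C]_(n.+1 + n.+1, k.+1)) : (k < n.+1.*2)%N -> (n < k)%N ->
  topc n 0 (fun p => \det (rmx n.+1 k.+1 p *m X)) (fun p => \det (rmx n.+1 k.+1 p *m X)).
Proof.
move=> kn nk p; exists (\det (rmx n.+1 k.+1 p *m X))%:P; split=> [||s].
- by rewrite size_polyC; case: eqP.
- by rewrite coefC.
- by rewrite det_rmx_dir // det_rmx_dir_eq0 // mulr0 addr0 hornerC.
Qed.

End MinorFunctions.

(** * A lower bound for the dimension of the spans *)

Section MinorDimension.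
Variable C : numFieldType.
Implicit Types (p : {poly C}) (n k m : nat) (ms : seq nat) (f g h : {poly C} -> C).

Lemma poly_horner_eq0 (q : {poly C}) : (forall s, q.[s] = 0) -> q = 0.
Proof.
move=> q0; apply/eqP; apply: contraT => nq.
have := max_poly_roots nq (rs := [seq i%:R | i <- iota 0 (size q)]).
rewrite size_map size_iota ltnn; apply.
  by apply/allP => x _; rewrite rootE q0.
rewrite map_inj_in_uniq ?iota_uniq // => i j _ _ /eqP.
by rewrite eqr_nat => /eqP.
Qed.

Lemma topc_inj n d f g : topc n d f g -> (forall p, f p = 0) -> forall p, g p = 0.
Proof.
move=> tf f0 p; have [q [_ <- qE]] := tf p.
by rewrite (@poly_horner_eq0 q) ?coef0 // => s; rewrite -qE f0.
Qed.

Lemma topc_sum n d (I : finType) (c : I -> C) (F G : I -> {poly C} -> C) :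
  (forall i, topc n d (F i) (G i)) ->
  topc n d (fun p => \sum_i c i * F i p) (fun p => \sum_i c i * G i p).
Proof.
move=> tF p; have [q qP] := fin_all_exists (fun i => tF i p).
exists (\sum_i c i *: q i); split.
- apply: leq_trans (size_sum _ _ _) _; apply/bigmax_leqP => i _.
  by apply: leq_trans (size_scale_leq _ _) _; have [] := qP i.
- by rewrite coef_sum; apply: eq_bigr => i _; rewrite coefZ; have [_ ->] := qP i.
- move=> s; rewrite horner_sum; apply: eq_bigr => i _.
  by rewrite hornerZ; have [_ _ ->] := qP i.
Qed.

Definition dimge N (E : ({poly C} -> C) -> Prop) := exists F : 'I_N -> {poly C} -> C,
  (forall i, E (F i)) /\
  forall c : 'I_N -> C, (forall p, \sum_i c i * F i p = 0) -> forall i, c i = 0.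

Lemma dimge_sub N (E E' : ({poly C} -> C) -> Prop) :
  (forall f, E f -> E' f) -> dimge N E -> dimge N E'.
Proof. by move=> EE' [F [EF ind]]; exists F; split=> // i; apply: EE'. Qed.

(** In a linear relation the coefficients of s^d involve only the lifts of [E2], which therefore
    drop out first. *)
Lemma dimge_split n d N1 N2 (E E1 E2 : ({poly C} -> C) -> Prop) :
  dimge N1 E1 -> dimge N2 E2 ->
  (forall f, E1 f -> E f /\ topc n d f (fun=> 0)) ->
  (forall g, E2 g -> exists f, E f /\ topc n d f g) ->
  dimge (N1 + N2) E.
Proof.
move=> [F1 [E1F ind1]] [F2 [E2F ind2]] sub lift.
have [F FP] := fin_all_exists (fun i => lift _ (E2F i)).
exists (fun i => match split i with inl i1 => F1 i1 | inr i2 => F i2 end); split.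
  by move=> i; case: (split i) => j; [have [] := sub _ (E1F j) | have [] := FP j].
move=> c c0; pose c1 i := c (lshift N2 i); pose c2 i := c (rshift N1 i).
have {}c0 p : \sum_i c1 i * F1 i p + \sum_i c2 i * F i p = 0.
  rewrite -[RHS](c0 p) big_split_ord /=; congr (_ + _); apply: eq_bigr => i _.
    by rewrite (unsplitK (inl _)).
  by rewrite (unsplitK (inr _)).
have c20 : forall i, c2 i = 0.
  apply: ind2 => p.
  have t1 := topc_sum c1 (fun i => (sub _ (E1F i)).2).
  have t2 := topc_sum c2 (fun i => (FP i).2).
  have t := topc_lin (c := 1) t1 t2 (fun q => erefl _).
  have := topc_inj t _ p; rewrite big1 => [|i _]; last by rewrite mulr0.
  by rewrite mulr0 add0r; apply=> q; rewrite mul1r c0.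
have c10 : forall i, c1 i = 0.
  by apply: ind1 => p; rewrite -[RHS](c0 p) [X in _ = _ + X]big1 ?addr0 // => i _; rewrite c20 mul0r.
by move=> i; case: (split_ordP i) => j ->; [exact: c10 | exact: c20].
Qed.

Lemma minors_topc n ms f : all (fun m => m <= n.+1)%N ms -> minors n.+1 ms f ->
  exists g, topc n (count_mem n.+1 ms) f g.
Proof.
move=> le; elim=> {f} [f f0 | c g f h Gg _ [f' tf] hE]; first by exists (fun=> 0); apply: topc0.
suff [g' tg] : exists g', topc n (count_mem n.+1 ms) g g'.
  by exists (fun p => c * g' p + f' p); apply: topc_lin tg tf hE.
elim: Gg le {f h f' tf hE} => [{}g g1 _ | m k {}ms X f {}g km _ IH gE] /=.
  by exists (fun=> 1); apply: topc_const.
move=> /andP[mn le]; have [f' tf] := IH le.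
have [k' kE] : exists k', k = k'.+1 by exists k.-1; lia.
subst k; have [E|ne] := eqVneq m n.+1.
  by eexists; apply: topc_mul (topc_det X _) tf gE; lia.
by eexists; apply: topc_mul (topc_det0 X _ _) tf gE; lia.
Qed.

(* Rewriting the sizes n+2, s as n+1, s+1 gives a space of functions of smaller *)
(* degree in the direction t^(n+1); the coefficients of top degree form the     *)
(* space where each n+2 is replaced by n.  The two dimensions add up.           *)
Definition drop2 n m := if m == n.+2 then n else m.

Lemma drop2_le n m : (m <= n.+2)%N -> (drop2 n m <= n.+1)%N.
Proof. by rewrite /drop2; case: eqP; lia. Qed.

Lemma drop2_lt n m j : (j < n)%N -> (j < drop2 n m)%N = (j < m)%N.
Proof. by rewrite /drop2; case: eqP; lia. Qed.

Lemma drop2_eq n m : (m <= n.+2)%N -> ((n < m) = (n < drop2 n m) + (m == n.+2) :> nat)%N.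
Proof. by rewrite /drop2; case: eqP; lia. Qed.

(** A factor with m = n + 2 is lifted by [det_rmx_dir_top], being the slope of a minor; every other
    factor is lifted by [det_rmx_red] to a minor that is constant along the line. *)
Lemma minors_lift n ms g : all (fun m => m <= n.+2)%N ms -> minors n.+1 (map (drop2 n) ms) g ->
  exists f, minors n.+2 ms f /\ topc n.+1 (count_mem n.+2 ms) f g.
Proof.
move=> le; elim=> {g} [g g0 | c g1 g h Gg _ [f' [Sf' tf']] hE].
  exists (fun=> 0); split; first exact: SpnZero.
  exact: topc_eq (topc0 _ _ (fun p => erefl _)) _.
suff [f1 [S1 t1]] : exists f1, minors n.+2 ms f1 /\ topc n.+1 (count_mem n.+2 ms) f1 g1.
  exists (fun p => c * f1 p + f' p); split; first exact: (spn_lin S1 Sf').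
  exact: topc_eq (topc_lin t1 tf' (fun p => erefl _)) _.
elim: ms le g1 Gg {f' Sf' tf' h hE} => [_ | m ms IH /= /andP[mn le]] g1 Gg.
  inversion Gg as [f f1 |]; subst; exists (fun=> 1); split; first by apply: spn_gen; apply: GenNil.
  exact: topc_eq (topc_const _ (fun p => erefl _)) _.
inversion Gg as [|m' k ms1 Y g' g1' km Gg' gE]; subst.
have [f [Sf tf]] := IH le _ Gg'; rewrite /drop2 in km.
have [E|ne] := eqVneq m n.+2.
  rewrite E eqxx in km *; have E2 : k = n.+2 by lia.
  subst k m; have [X [b XY]] := det_rmx_dir_top Y.
  pose h p := \det (rmx n.+2 n.+2 p *m X) * f p.
  have Sh : minors n.+2 (n.+2 :: ms) h by apply: minors_cons Sf (fun p => erefl _); lia.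
  exists (fun p => (-1) ^+ b * h p); split; first exact: (spn_scale Sh).
  have lt : (n.+1 < n.+2.*2)%N by lia.
  have th := topc_mul (topc_det X lt) tf (fun p => erefl (h p)).
  have z0 : topc n.+1 (1 + count_mem n.+2 ms) (fun=> 0) (fun=> 0 : C) by apply: topc0.
  apply: topc_eq (topc_lin (c := (-1) ^+ b) th z0 _) _ => p; rewrite ?addr0 //.
  by rewrite gE XY !mulrA -expr2 sqrr_sign mul1r.
rewrite (negPf ne) in km *.
have nk : (n.+1 <= k)%N by lia.
have [|X [b XY]] := det_rmx_red Y nk; first by lia.
pose h p := \det (rmx n.+2 k.+2 p *m X) * f p.
have Sh : minors n.+2 (m :: ms) h by apply: minors_cons Sf (fun p => erefl _); lia.
exists (fun p => (-1) ^+ b * h p); split; first exact: (spn_scale Sh).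
have lt : (k.+1 < n.+2.*2)%N by lia.
have lt' : (n.+1 < k.+1)%N by lia.
have th := topc_mul (topc_det0 X lt lt') tf (fun p => erefl (h p)).
have z0 : topc n.+1 (0 + count_mem n.+2 ms) (fun=> 0) (fun=> 0 : C) by apply: topc0.
apply: topc_eq (topc_lin (c := (-1) ^+ b) th z0 _) _ => p; rewrite ?addr0 //.
by rewrite gE XY !mulrA -expr2 sqrr_sign mul1r.
Qed.

(** For n = 1 the line V_1 is spanned by p_0 v_- + v_+, so each factor with m = 1 may be taken as
    p_0 or as 1. *)
Lemma minors1_pow ms i : all (fun m => m <= 1)%N ms -> (i <= count_mem 1%N ms)%N ->
  minors 1 ms (fun p => p`_0 ^+ i).
Proof.
have colE k (p : {poly C}) (j : 'I_2) : \det (rmx 1 1 p *m delta_mx j 0) = vrow 1 p 0 0 j.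
  by rewrite -colE det_mx11 !mxE.
elim: ms i => [|m ms IH] i /=.
  by move=> _; rewrite leqn0 => /eqP ->; apply: spn_gen; apply: GenNil.
move=> /andP[m1 le]; have [->|m0] := eqVneq m 1%N.
  case: i => [|i]; last first.
    rewrite add1n ltnS => lei; apply: (minors_cons (k := 1) (X := delta_mx (lshift 1 0) 0) _ (IH i le lei)) => // p.
    by rewrite colE // /vrow /= /pr row_mxEl mxE mul1r exprS.
  move=> _; apply: (minors_cons (k := 1) (X := delta_mx (rshift 1 0) 0) _ (IH 0%N le _)) => // p.
  by rewrite colE // /vrow /= /pr row_mxEr mxE coef1 mul1r.
rewrite add0n => lei; have k2 : (2 + m = 1.*2)%N by lia.
apply: (minors_cons (n := 1) (X := (1%:M : 'M[C]_2)) k2 (IH i le lei)) => p; rewrite (mulmx1 (rmx 1 2 p : 'M_2)).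
have -> : \det (rmx 1 2 p : 'M_2) = 1.
  have R i1 (j : 'I_2) : (rmx 1 2 p : 'M_2) i1 j = vrow 1 p (1 - i1) 0 j by rewrite mxE.
  rewrite det_mx22 !R /vrow /= /pr.
  have E0 (u v : 'rV[C]_1) : (row_mx u v : 'rV_2) 0 0 = u 0 0.
    by rewrite mxE; case: splitP => l //= _; rewrite ord1.
  have E1 (u v : 'rV[C]_1) : (row_mx u v : 'rV_2) 0 1 = v 0 0.
    by rewrite mxE; case: splitP => l /=; rewrite ord1.
  by rewrite !E0 !E1 !mxE coef0 mul0r subr0 !coef1 eqxx mulr1.
by rewrite mul1r.
Qed.

Definition above ms j := count (fun m => j < m)%N ms.

(** Induction on n, then on the number c + 1 of occurrences of the largest size. Functions for the
    list with n + 2, s replaced by n + 1, s + 1 have smaller degree along t^(n+1); those for the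
    list with n + 2 replaced by n appear as leading coefficients. With A = [above ms s], the two
    bounds add up because (A + 1)(c + 2) = (A + 2)(c + 1) + (A - c). *)
Lemma minors_dim n ms : all (fun m => m <= n)%N ms ->
  dimge (\prod_(j < n) (above ms j).+1) (minors n ms).
Proof.
elim: n ms => [|n IHn] ms le.
  rewrite big_ord0; exists (fun _ _ => 1); split=> [_|c c0 i]; last first.
    by rewrite (ord1 i); have := c0 0; rewrite big_ord1 mulr1.
  elim: ms le => [|m ms IH] /=; first by move=> _; apply: spn_gen; apply: GenNil.
  move=> /andP[m0 le]; apply: (minors_cons (k := 0) (X := 0) _ (IH le)); first by lia.
  by move=> p; rewrite det_mx00 mul1r.
move Ec: (count_mem n.+1 ms) => c; elim: c ms Ec le => [|c IHc] ms Ec le.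
  have le' : all (fun m => m <= n)%N ms.
    apply/allP => m mms; have := allP le m mms; rewrite leq_eqVlt ltnS => /orP[/eqP E|//].
    by move/eqP: Ec; rewrite -leqn0 leqNgt -has_count => /hasPn/(_ m mms) /=; rewrite E eqxx.
  rewrite big_ord_recr /= (_ : above ms n = 0%N) ?muln1.
    by apply: dimge_sub (IHn _ le') => f; apply: minors_lift0.
  apply/eqP; rewrite -leqn0 leqNgt -has_count; apply/hasPn => m mms.
  by rewrite -leqNgt (allP le').
have aboveE j (s : seq nat) m : above (m :: s) j = ((j < m) + above s j)%N by [].
have top ms' : all (fun m => m <= n.+1)%N ms' -> above ms' n = count_mem n.+1 ms'.
  move=> le'; apply: eq_in_count => m /(allP le') /= mn.
  by rewrite eqn_leq mn.
case: n => [|n] in IHn IHc Ec le top *.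
  rewrite big_ord1 top // Ec; exists (fun i p => p`_0 ^+ i); split=> [i|co c0 i].
    by apply: minors1_pow => //; rewrite Ec -ltnS.
  have q0 : \poly_(l < c.+2) co (inord l) = 0.
    apply: poly_horner_eq0 => s; rewrite horner_poly -[RHS](c0 s%:P).
    by apply: eq_bigr => l _; rewrite inord_val coefC.
  by have := congr1 (fun q : {poly C} => q`_i) q0; rewrite coef_poly ltn_ord inord_val coef0.
(* The added size 0 only contributes constants, and guarantees that some size is at most n. *)
pose ms0 := 0%N :: ms.
pose P s := (s \in ms0) && (s <= n)%N.
have exP : exists s, P s by exists 0%N; rewrite /P inE.
have ubP s : P s -> (s <= n)%N by case/andP.
(* With s maximal no size lies in s + 1, ..., n, whence [abs] below. *)
case: (ex_maxnP exP ubP) => s /andP[sms sn] smax {exP ubP}.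
have Nms : n.+2 \in ms0.
  by rewrite inE; apply/orP; right; rewrite -has_pred1 has_count Ec.
have sms' : s \in rem n.+2 ms0 
  by move: sms; rewrite (perm_mem (perm_to_rem Nms)) inE => /orP[/eqP|//]; lia.
pose ms2 := rem s (rem n.+2 ms0).
have pe : perm_eq ms0 (n.+2 :: s :: ms2).
  by rewrite (perm_trans (perm_to_rem Nms)) // perm_cons perm_to_rem.
have le0 : all (fun m => m <= n.+2)%N ms0 by rewrite /= le.
have le2 : all (fun m => m <= n.+2)%N ms2.
  by move: le0; rewrite (perm_all _ pe) /= => /and3P[].
have Ec0 : count_mem n.+2 ms0 = c.+1 by rewrite /= Ec.
pose ms' := n.+1 :: s.+1 :: ms2.
have le' : all (fun m => m <= n.+2)%N ms' by rewrite /= le2 andbT; lia.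
have Ec' : count_mem n.+2 ms' = c.
  have := seq.permP pe (pred1 n.+2); rewrite Ec0 /= eqxx; move: sn; clear; lia.
pose ms'' := map (drop2 n) ms.
have le'' : all (fun m => m <= n.+1)%N ms''.
  by rewrite all_map; apply/allP => m /(allP le) /drop2_le.
have ab j : above ms j = ((j < n.+2) + (j < s) + above ms2 j)%N.
  have := seq.permP pe (fun m => j < m)%N; rewrite /= => E.
  by rewrite /above -addnA -E.
have ab' j : above ms' j = ((j < n.+1) + (j < s.+1) + above ms2 j)%N by rewrite /above /= addnA.
have ab'' j : (j < n)%N -> above ms'' j = above ms j.
  move=> jn; rewrite /above count_map; apply: eq_count => m /=.
  by rewrite drop2_lt.
have abn : (above ms n = above ms'' n + c.+1)%N.
  rewrite -Ec /above count_map; elim: (ms) le => //= m r IHr /andP[mn /IHr ->].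
  by rewrite (drop2_eq mn) addnACA.
have abs : above ms s = above ms n.
  apply: eq_in_count => m mms; apply/idP/idP => [sm|]; last exact: leq_ltn_trans.
  rewrite ltnNge; apply/negP => mn; have := smax m; rewrite /P inE mms orbT mn => /(_ isT).
  by rewrite leqNgt sm.
pose Q := (\prod_(j < n.+1 | j != s :> nat) (above ms j).+1)%N.
have sn1 : (s < n.+1)%N by [].
have prodE : (\prod_(j < n.+2) (above ms j).+1 = ((above ms s).+1 * Q) * c.+2)%N.
  by rewrite big_ord_recr /= top // Ec (bigD1 (Ordinal sn1)).
have prodE' : (\prod_(j < n.+2) (above ms' j).+1 = ((above ms s).+2 * Q) * c.+1)%N.
  rewrite big_ord_recr [above _ (@ord_max n.+1)]top // Ec' (bigD1 (Ordinal sn1)) //; congr ((_ * _) * _)%N.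
    by rewrite ab ab' /=; move: sn; clear; lia.
  apply: eq_bigr => j ne; rewrite ab ab'; congr _.+1.
  by have := ltn_ord j; move: ne; rewrite -val_eqE /=; clear; lia.
have Qn : Q = (\prod_(j < n) (above ms j).+1)%N.
  apply/eqP; rewrite -(eqn_pmul2l (ltn0Sn (above ms s))) {2}abs mulnC [X in _ == X]mulnC.
  rewrite -(big_ord_recr n (fun j => (above ms j).+1)) mulnC.
  by rewrite (bigD1 (Ordinal sn1)).
have prodE'' : (\prod_(j < n.+1) (above ms'' j).+1 = (above ms'' n).+1 * Q)%N.
  rewrite big_ord_recr mulnC Qn; congr (_ * _)%N; apply: eq_bigr => j _ /=.
  by rewrite ab''.
have -> : (\prod_(j < n.+2) (above ms j).+1 =
    \prod_(j < n.+2) (above ms' j).+1 + \prod_(j < n.+1) (above ms'' j).+1)%N.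
  by rewrite prodE prodE' prodE'' abs abn; clear; lia.
apply: (dimge_split (n := n.+1) (d := c.+1) (IHc _ Ec' le') (IHn _ le'')).
  move=> f Sf; split.
    apply: minors_cons0; apply: minors_perm (minors_exchange _ Sf); last by lia.
    by rewrite perm_sym.
  by have [g tg] := minors_topc le' Sf; apply: topc_weak tg _; rewrite Ec'.
by move=> g /(minors_lift le); rewrite Ec.
Qed.

End MinorDimension.

(** * The fusion product as a submodule of a tensor power of V_0 *)

Section Sl2String.
Variables (C : numFieldType) (T : lmodType C) (E F H : {linear T -> T}) (a : nat) (x : T).
Hypothesis EF : forall y, E (F y) - F (E y) = H y.
Hypothesis HE : forall y, H (E y) - E (H y) = E y *+ 2.
Hypothesis Fx : F x = 0.
Hypothesis Hx : H x = - (a.-1)%:R *: x.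
Hypothesis a_gt0 : (0 < a)%N.

Lemma sl2_weight k : H (iter k E x) = ((k.*2)%:R - (a.-1)%:R) *: iter k E x.
Proof.
elim: k => [|k IH]; first by rewrite sub0r.
rewrite iterS; have /eqP := HE (iter k E x); rewrite subr_eq => /eqP ->.
rewrite IH linearZ /= -scaler_nat -scalerDl doubleS -addn2 natrD; congr (_ *: _); ring.
Qed.

Lemma sl2_lower k : F (iter k E x) = (k%:R * (a%:R - k%:R)) *: iter k.-1 E x.
Proof.
elim: k => [|k IH]; first by rewrite Fx mul0r scale0r.
rewrite iterS; have /eqP := EF (iter k E x); rewrite subr_eq addrC -subr_eq => /eqP <-.
rewrite IH linearZ sl2_weight /=.
have -> : k%:R * (a%:R - k%:R) *: E (iter k.-1 E x) = (k%:R * (a%:R - k%:R)) *: iter k E x.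
  by case: k {IH} => [|k //]; rewrite !mul0r !scale0r.
rewrite -scalerBl; congr (_ *: _).
have Ea : a%:R = a.-1%:R + 1 :> C by rewrite -{1}(prednK a_gt0) -natr1.
rewrite Ea -mul2n natrM -natr1; ring.
Qed.

(** By [sl2_lower], F takes E^k x to a nonzero multiple of E^(k-1) x for every k > a, so vanishing
    descends from N to a. *)
Lemma sl2_bound N : iter N E x = 0 -> iter a E x = 0.
Proof.
have [le|lt] := leqP N a.
  by move=> N0; rewrite -(subnK le) iterD N0; elim: (a - N)%N => //= k ->; rewrite linear0.
elim: N lt => // N IH; rewrite ltnS leq_eqVlt => /orP[/eqP <-|lt]; last first.
  move=> N0; apply: IH => //; have := sl2_lower N.+1; rewrite N0 linear0 /= => /esym/eqP.
  rewrite scaler_eq0 mulf_eq0 pnatr_eq0 subr_eq0 eqr_nat /= => /orP[/eqP E1|/eqP //].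
  by move: lt; rewrite E1 ltnNge leqnSn.
move=> N0; have := sl2_lower a.+1; rewrite N0 linear0 /= => /esym/eqP.
rewrite scaler_eq0 mulf_eq0 pnatr_eq0 subr_eq0 eqr_nat /= => /orP[/eqP E1|/eqP //].
by exfalso; move: E1; clear; lia.
Qed.


End Sl2String.

(** * The current algebra acting on rows *)

Section CurrentMatrices.
Variable C : fieldType.

(** The operator x (x) N on V_0, with the coordinates of v_- before those of v_+; since rows are
    acted on, x enters transposed. *)
Definition xm n (x : 'M[C]_2) (N : 'M[C]_n) : 'M[C]_(n + n) :=
  block_mx (x 0 0 *: N) (x 1 0 *: N) (x 0 1 *: N) (x 1 1 *: N).

Lemma xmM n x y (N N' : 'M[C]_n) : xm x N *m xm y N' = xm (y *m x) (N *m N').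
Proof.
rewrite /xm mulmx_block !mulmx2E -!scalemxAl -!scalemxAr !scalerA -!scalerDl.
by congr block_mx; congr (_ *: _); rewrite mulrC [X in _ + X]mulrC.
Qed.

Lemma xm_linl n c x y (N : 'M[C]_n) : xm (c *: x + y) N = c *: xm x N + xm y N.
Proof.
rewrite /xm scale_block_mx add_block_mx !mxE.
by congr block_mx; rewrite scalerDl scalerA.
Qed.

Lemma xm_linr n c x (N N' : 'M[C]_n) : xm x (c *: N + N') = c *: xm x N + xm x N'.
Proof.
rewrite /xm scale_block_mx add_block_mx.
by congr block_mx; rewrite scalerDr !scalerA mulrC.
Qed.

Lemma xm0 n x : xm x (0 : 'M[C]_n) = 0.
Proof. by rewrite /xm !scaler0 -block_mx0. Qed.

Lemma xm0l n (N : 'M[C]_n) : xm 0 N = 0.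
Proof. by rewrite /xm !mxE !scale0r -block_mx0. Qed.

Lemma xmDl n x y (N : 'M[C]_n) : xm (x + y) N = xm x N + xm y N.
Proof. by rewrite -[x]scale1r xm_linl !scale1r. Qed.

Lemma xmZl n c x (N : 'M[C]_n) : xm (c *: x) N = c *: xm x N.
Proof. by rewrite -[c *: x]addr0 xm_linl xm0l addr0. Qed.

Lemma xm_sum n x (I : finType) (N : I -> 'M[C]_n) : xm x (\sum_i N i) = \sum_i xm x (N i).
Proof.
elim/big_rec2: _ => [|i y1 y2 _ <-]; first exact: xm0.
by rewrite -[N i]scale1r xm_linr !scale1r.
Qed.

(** The order reversals of [dp_comm] and [xmM] cancel, so this is an honest Lie algebra action. *)
Lemma dp_xm_comm (P : finType) n x y (N N' : 'M[C]_n) (v : tpow C P (n + n)) :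
  N *m N' = N' *m N ->
  dp (xm x N) (dp (xm y N') v) - dp (xm y N') (dp (xm x N) v) =
  dp (xm (x *m y - y *m x) (N *m N')) v.
Proof.
move=> NN'; rewrite dp_comm !xmM -NN'; congr (dp _ v).
by rewrite addrC -[x *m y - _]addrC -scaleN1r -[in RHS]scaleN1r xm_linl.
Qed.

Definition sl2_e : 'M[C]_2 := delta_mx 0 1.
Definition sl2_f : 'M[C]_2 := delta_mx 1 0.
Definition sl2_h : 'M[C]_2 := delta_mx 0 0 - delta_mx 1 1.

Lemma sl2_ef : sl2_e *m sl2_f - sl2_f *m sl2_e = sl2_h.
Proof. by rewrite /sl2_e /sl2_f !mul_delta_mx. Qed.

Lemma sl2_he : sl2_h *m sl2_e - sl2_e *m sl2_h = sl2_e *+ 2.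
Proof.
by apply: mx2_eq; rewrite mulr2n [LHS]mxE [X in _ + X = _]mxE !mulmx2E !mxE /=; ring.
Qed.

Lemma sl2_decomp (x : 'M[C]_2) : \tr x = 0 ->
  x = x 0 0 *: sl2_h + (x 0 1 *: sl2_e + x 1 0 *: sl2_f).
Proof.
have -> : \tr x = x 0 0 + x 1 1.
  by rewrite /mxtrace !big_ord_recl big_ord0 addr0; congr (_ + x _ _); apply: val_inj.
move=> /eqP; rewrite addr_eq0 => /eqP tx.
by apply: mx2_eq; rewrite !mxE /= ?tx; ring.
Qed.

Lemma xm_decomp n x (N : 'M[C]_n) : \tr x = 0 ->
  xm x N = x 0 0 *: xm sl2_h N + (x 0 1 *: xm sl2_e N + x 1 0 *: xm sl2_f N).
Proof. by move=> /sl2_decomp {1}->; rewrite xm_linl xm_linl xmZl. Qed.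

End CurrentMatrices.

(** * The intertwiner from the tensor product of evaluation modules *)

Section TensorEmbedding.
Variables (C : numFieldType) (n : nat) (a : 'I_n -> nat) (z : 'I_n -> C) (P : finType).
Variable w : tpow C P (n + n).
Hypothesis a_gt0 : forall i, (0 < a i)%N.

(** The copy of sl_2 at z_i, in a basis of eigenvectors of t, where the idempotent of the point is
    [delta_mx i i]. *)
Definition at_point (i : 'I_n) (x : 'M[C]_2) : tpow C P (n + n) -> tpow C P (n + n) :=
  dp (xm x (delta_mx i i)).
HB.instance Definition _ i x :=
  GRing.isLinear.Build C (tpow C P (n + n)) (tpow C P (n + n)) _ (at_point i x)
    (dp_is_linear (xm x (delta_mx i i))).

Hypothesis w_f : forall i, at_point i (sl2_f C) w = 0.
Hypothesis w_h : forall i, at_point i (sl2_h C) w = - (a i).-1%:R *: w.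

Lemma at_point_comm i x y v :
  at_point i x (at_point i y v) - at_point i y (at_point i x v) =
  at_point i (x *m y - y *m x) v.
Proof. by rewrite /at_point dp_xm_comm // mul_delta_mx. Qed.

Lemma at_point_neq i j x y v : i != j ->
  at_point i x (at_point j y v) = at_point j y (at_point i x v).
Proof.
move=> ij; apply/eqP; rewrite -subr_eq0 /at_point dp_xm_comm.
  by rewrite mul_delta_mx_0 // xm0 dp0.
by rewrite !mul_delta_mx_0 // eq_sym.
Qed.

Lemma at_point_iter i j x y v k : i != j ->
  at_point i x (iter k (at_point j y) v) = iter k (at_point j y) (at_point i x v).
Proof. by move=> ij; elim: k => //= k <-; rewrite at_point_neq. Qed.

Lemma at_point_EF i v : at_point i (sl2_e C) (at_point i (sl2_f C) v) -
  at_point i (sl2_f C) (at_point i (sl2_e C) v) = at_point i (sl2_h C) v.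
Proof. by rewrite at_point_comm sl2_ef. Qed.

Lemma at_point_HE i v : at_point i (sl2_h C) (at_point i (sl2_e C) v) -
  at_point i (sl2_e C) (at_point i (sl2_h C) v) = at_point i (sl2_e C) v *+ 2.
Proof.
by rewrite at_point_comm sl2_he /at_point !mulr2n xmDl dpD.
Qed.

Lemma at_point_nil i v : iter #|P|.+1 (at_point i (sl2_e C)) v = 0.
Proof.
by apply: iter_dp_eq0 => //; rewrite xmM /sl2_e mul_delta_mx_0 // xm0l.
Qed.

Definition string (s : seq 'I_n) (m : 'I_n -> nat) : tpow C P (n + n) :=
  foldr (fun i v => iter (m i) (at_point i (sl2_e C)) v) w s.

Lemma eq_string s m m' : {in s, m =1 m'} -> string s m = string s m'.
Proof.
elim: s => //= i s IH E; rewrite E ?inE ?eqxx // IH // => j js.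
by rewrite E // inE js orbT.
Qed.

Lemma string_notin s m i : i \notin s ->
  at_point i (sl2_f C) (string s m) = 0 /\
  at_point i (sl2_h C) (string s m) = - (a i).-1%:R *: string s m.
Proof.
elim: s => [|j s IH] //=; rewrite inE negb_or => /andP[ij /IH[F0 H0]].
rewrite !at_point_iter // F0 H0; split.
  by elim: (m j) => //= k ->; rewrite linear0.
by elim: (m j) => //= k ->; rewrite linearZ.
Qed.

Definition upd (m : 'I_n -> nat) i k j := if j == i then k else m j.

Lemma string_in s m i : uniq s -> i \in s ->
  [/\ at_point i (sl2_e C) (string s m) = string s (upd m i (m i).+1),
      at_point i (sl2_h C) (string s m) = ((m i).*2%:R - (a i).-1%:R) *: string s m,
      at_point i (sl2_f C) (string s m) =
        ((m i)%:R * ((a i)%:R - (m i)%:R)) *: string s (upd m i (m i).-1)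
    & (a i <= m i)%N -> string s m = 0].
Proof.
elim: s => [|j s IH] //= /andP[js us]; rewrite inE => /orP[/eqP Eij|ins].
  subst j; have E k : string s (upd m i k) = string s m.
    by apply: eq_string => l ls; rewrite /upd; case: eqP => // El; rewrite -El ls in js.
  have [F0 H0] := string_notin m js; rewrite !E /upd eqxx.
  have W := sl2_weight (at_point_HE i) H0.
  have L := sl2_lower (at_point_EF i) (at_point_HE i) F0 H0 (a_gt0 i).
  have B := sl2_bound (at_point_EF i) (at_point_HE i) F0 H0 (a_gt0 i) (at_point_nil i _).
  split; [by [] | exact: W | exact: L | move=> le; rewrite -(subnK le) iterD B].
  by elim: (m i - a i)%N => //= k ->; rewrite linear0.
have ij : i != j by apply: contraNneq js => <-.
have [E1 H1 F1 B1] := IH us ins; rewrite !at_point_iter // E1 H1 F1.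
have U k : upd m i k j = m j by rewrite /upd eq_sym (negPf ij).
rewrite !U; split=> //.
- by elim: (m j) => //= k ->; rewrite linearZ.
- by elim: (m j) => //= k ->; rewrite linearZ.
- by move=> /B1 ->; elim: (m j) => //= k ->; rewrite linear0.
Qed.

Definition estring (m : tidx a) := string (enum 'I_n) (fun i => m i).

(** The tensor product of the u_(m i) is obtained from the lowest weight vectors by the e_i^(m i),
    so its image has to be [estring m]. *)
Definition psi_tens (v : tens C a) : tpow C P (n + n) := \sum_m v m *: estring m.

Lemma psi_tens_is_linear : linear psi_tens.
Proof.
move=> c u v; rewrite /psi_tens scaler_sumr -big_split /=; apply: eq_bigr => m _.
by rewrite !ffunE scalerDl scalerA.
Qed.
HB.instance Definition _ :=
  GRing.isLinear.Build C (tens C a) (tpow C P (n + n)) _ psi_tens psi_tens_is_linear.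

Lemma tidx_updE (m : tidx a) i (k : 'I_(a i)) j :
  (tidx_upd m k j : nat) = upd (fun i => m i) i k j.
Proof.
rewrite /tidx_upd ffunE /upd; case: dfwithP => [|j' ne]; first by rewrite eqxx.
by rewrite eq_sym (negPf ne).
Qed.

Lemma tidx_updK (m : tidx a) i (k : 'I_(a i)) : tidx_upd (tidx_upd m k) (m i) = m.
Proof.
apply/ffunP => j; apply: ord_inj; rewrite tidx_updE /upd; case: eqP => [->|ne] //.
by rewrite tidx_updE /upd; case: eqP.
Qed.

Lemma tidx_upd_in (m : tidx a) i (k : 'I_(a i)) : tidx_upd m k i = k.
Proof. by apply: ord_inj; rewrite tidx_updE /upd eqxx. Qed.

Lemma estring_upd (m : tidx a) i (k : 'I_(a i)) :
  estring (tidx_upd m k) = string (enum 'I_n) (upd (fun i => m i) i k).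
Proof. by apply: eq_string => j _; rewrite tidx_updE. Qed.

Lemma estring_act (m : tidx a) i x : \tr x = 0 ->
  at_point i x (estring m) = \sum_(k < a i) irr_mx (a i) x k (m i) *: estring (tidx_upd m k).
Proof.
move=> trx; have [E1 H1 F1 _] := string_in (fun i => m i) (enum_uniq 'I_n) (mem_enum 'I_n i).
have -> : at_point i x (estring m) = x 0 0 *: at_point i (sl2_h C) (estring m) +
    (x 0 1 *: at_point i (sl2_e C) (estring m) + x 1 0 *: at_point i (sl2_f C) (estring m)).
  by rewrite /at_point xm_decomp // dp_lin dp_lin dpZ.
have -> : estring m = string (enum 'I_n) (fun i => m i) by [].
rewrite E1 H1 F1.
under eq_bigr => k _ do rewrite mxE 2!scalerDl.
rewrite 2!big_split /= -addrA; congr (_ + (_ + _)).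
- rewrite (bigD1 (m i)) //= eqxx mulr1n scalerA -[LHS]addr0; congr (_ *: _ + _).
    by apply: eq_string => j _; rewrite tidx_updE /upd; case: eqP => [->|].
  by rewrite big1 // => k /negPf ne; rewrite ne mulr0n scale0r.
- have [lt|ge] := ltnP (m i).+1 (a i).
    rewrite (bigD1 (Ordinal lt)) //= eqxx mulr1n -[LHS]addr0; congr (_ *: _ + _).
      by rewrite estring_upd.
    rewrite big1 // => k ne; case: eqP => [E|]; last by rewrite mulr0n scale0r.
    by case/eqP: ne; apply: val_inj.
  (* At the top of the string e_i^(a_i) annihilates the vector, by [sl2_bound], as e does in
     [irr_mx]. *)
  have [_ _ _ -> //] := string_in (upd (fun i => m i) i (m i).+1) (enum_uniq 'I_n) (mem_enum 'I_n i).
    rewrite scaler0 big1 // => k _; case: eqP => [E|]; last by rewrite mulr0n scale0r.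
    by move: (ltn_ord k); rewrite E ltnNge ge.
  by rewrite /upd eqxx.
- rewrite scalerA; case Emi: (m i : nat) => [|l].
    rewrite mul0r mulr0 scale0r big1 // => k _.
    by rewrite ?mul0n ?mulr0n ?scale0r.
  have lt : (l < a i)%N by rewrite -ltnS -Emi ltnS ltnW.
  rewrite (bigD1 (Ordinal lt)) //= eqxx mulr1n -[LHS]addr0; congr (_ + _).
    by rewrite estring_upd /= natrM natrB.
  rewrite big1 // => k ne; case: eqP => [[E]|]; last by rewrite mulr0n scale0r.
  by case/eqP: ne; apply: val_inj.
Qed.

Lemma psi_tens_act (v : tens C a) i x : \tr x = 0 ->
  psi_tens (tens_at i x v) = at_point i x (psi_tens v).
Proof.
move=> trx; rewrite /psi_tens [RHS]linear_sum /=.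
under [RHS]eq_bigr => m _ do rewrite linearZ /= estring_act // scaler_sumr.
under [LHS]eq_bigr => m _ do rewrite ffunE scaler_suml.
rewrite !pair_big /=.
(* Exchanging the old and the new value at i matches the terms of the two sums. *)
pose h (p : tidx a * 'I_(a i)) := (tidx_upd p.1 p.2, p.1 i).
have hK : involutive h.
  by case=> m k; rewrite /h /= tidx_updK tidx_upd_in.
rewrite (reindex_inj (inv_inj hK)) /=; apply: eq_bigr => -[m k] _ /=.
by rewrite tidx_updK tidx_upd_in scalerA mulrC.
Qed.

Lemma psi_tens_vbar : psi_tens (vbar C a) = w.
Proof.
pose m0 : tidx a := [ffun i => Ordinal (a_gt0 i)].
rewrite /psi_tens (bigD1 m0) //= big1 ?addr0 => [|m ne].
  rewrite ffunE (_ : [forall i, _]); last by apply/forallP => i; rewrite ffunE.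
  rewrite scale1r /estring; elim: (enum 'I_n) => //= i s ->.
  by rewrite ffunE.
rewrite ffunE; case: forallP => [H|]; last by rewrite scale0r.
by case/eqP: ne; apply/ffunP => i; apply: val_inj; rewrite ffunE /=; apply/eqP/H.
Qed.

Lemma psi_tens_current (v : tens C a) x j : \tr x = 0 ->
  psi_tens (current z x j v) = dp (xm x (\sum_i z i ^+ j *: delta_mx i i)) (psi_tens v).
Proof.
move=> trx; rewrite /current linear_sum xm_sum dp_sum; apply: eq_bigr => i _ /=.
rewrite linearZ /= psi_tens_act //.
by rewrite -[_ *: delta_mx i i]addr0 xm_linr xm0 addr0 dpZ.
Qed.

End TensorEmbedding.

(** * Blocks, their sizes and the points they contain *)

Section Blocks.
Variables (n : nat) (a : 'I_n -> nat).

(* The multiset of fundamental weights: the block r is a copy of the Pluecker *)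
(* embedding of V_m with m = bsize r, and point i occurs in a_i - 1 blocks.   *)
Definition nblk := (\max_i a i).-1.
Definition bsize (r : nat) := #|[set i | (r.+1 < a i)%N]|.
Definition bdim (r : 'I_nblk) := (n.*2 - bsize r)%N.

Lemma bsize_le r : (bsize r <= n)%N.
Proof. by rewrite -[X in (_ <= X)%N]card_ord max_card. Qed.

Lemma card_ord_ge m : (m <= n)%N -> #|[set j : 'I_n | (m <= j)%N]| = (n - m)%N.
Proof.
move=> mn; rewrite cardsCs card_ord; congr (_ - _)%N.
rewrite -[RHS]card_ord -cardsT -(card_imset _ (f := widen_ord mn)); last first.
  by move=> j1 j2 /(congr1 val) /= /val_inj.
apply: eq_card => j; rewrite !inE -ltnNge; apply/idP/imsetP => [jm|[j' _ ->]].
  by exists (Ordinal jm) => //; apply: val_inj.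
exact: (ltn_ord j').
Qed.

Lemma card_blk i : (0 < a i)%N -> #|[set r : 'I_nblk | (r.+1 < a i)%N]| = (a i).-1.
Proof.
move=> ai; have le : ((a i).-1 <= nblk)%N.
  by rewrite -ltnS !prednK ?(leq_bigmax i) // (leq_trans ai) // (leq_bigmax i).
rewrite -[RHS]card_ord -cardsT -(card_imset _ (f := widen_ord le)); last first.
  by move=> j1 j2 /(congr1 val) /= /val_inj.
apply: eq_card => j; rewrite !inE; apply/idP/imsetP => [jm|[j' _ ->]].
  have jm' : (j < (a i).-1)%N by lia.
  by exists (Ordinal jm') => //; apply: val_inj.
by have := ltn_ord j'; rewrite /=; lia.
Qed.

Hypothesis a_incr : forall i j : 'I_n, (i < j)%N -> (a i < a j)%N.

(** As [a] increases, the points counted by [bsize a r] form a final segment. *)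
Lemma mem_blk r (i : 'I_n) : (r.+1 < a i)%N = (n - bsize r <= i)%N.
Proof.
pose P m := [exists j : 'I_n, (j == m :> nat) && (r.+1 < a j)%N] || (m == n).
have exP : exists m, P m by exists n; rewrite /P eqxx orbT.
case: (ex_minnP exP) => m Pm min_m.
have mn : (m <= n)%N by apply: min_m; rewrite /P eqxx orbT.
have E (j : 'I_n) : (r.+1 < a j)%N = (m <= j)%N.
  apply/idP/idP => [aj|mj].
    by apply: min_m; apply/orP; left; apply/existsP; exists j; rewrite eqxx.
  have {Pm} /orP[/existsP[l /andP[/eqP lm al]]|/eqP E] := Pm; last first.
    by move: (leq_ltn_trans mj (ltn_ord j)); rewrite E ltnn.
  move: mj; rewrite -lm leq_eqVlt => /orP[/eqP/val_inj <-//|/a_incr/(ltn_trans al)//].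
rewrite E /bsize (_ : [set j | _] = [set j : 'I_n | (m <= j)%N]).
  by rewrite card_ord_ge // subKn.
by apply/setP => j; rewrite !inE E.
Qed.

(** The block r = a_(n-m) - 2 works: a_i > 1 makes it exist, and by strict growth exactly the points
    from n - m on satisfy r + 1 < a_i. *)
Lemma bsize_surj m : (forall i, (1 < a i)%N) -> (0 < m)%N -> (m <= n)%N ->
  exists r : 'I_nblk, bsize r = m.
Proof.
move=> a1 m0 mn; have lt : (n - m < n)%N by lia.
pose i := Ordinal lt; have rlt : ((a i).-2 < nblk)%N.
  have := leq_bigmax (F := a) i; have := a1 i; rewrite /nblk; lia.
exists (Ordinal rlt); rewrite /bsize /=.
rewrite (_ : [set j | _] = [set j : 'I_n | (n - m <= j)%N]).
  by rewrite card_ord_ge ?leq_subr // subKn.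
apply/setP => j; rewrite !inE; have := a1 i; case: (ltngtP (n - m) j) => ij.
- by have := @a_incr i j ij; lia.
- by have := @a_incr j i ij; lia.
- by have -> : j = i; [apply: val_inj | lia].
Qed.

End Blocks.

(** * Deforming the vector of [P] to distinct points z_i *)

Section Deformation.
Variables (C : numFieldType) (n : nat) (a : 'I_n -> nat) (z : 'I_n -> C).
Hypothesis a_incr : forall i j : 'I_n, (i < j)%N -> (a i < a j)%N.
Hypothesis a_gt0 : forall i, (0 < a i)%N.
Hypothesis z_inj : injective z.
Local Notation k := (@bdim n a).

(* From the monomials t^l to the eigenvectors of t in C[t]/prod_i (t - z_i).    *)
Definition vdm : 'M[C]_n := \matrix_(l, i) z i ^+ l.

Lemma vdm_unit : vdm \in unitmx.
Proof.
have -> : vdm = Vandermonde n (\row_i z i) by apply/matrixP => l i; rewrite !mxE.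
rewrite unitmxE det_Vandermonde unitfE; apply/prodf_neq0 => i _; apply/prodf_neq0 => j ij.
by rewrite !mxE subr_eq0; apply: contraTneq ij => /z_inj ->; rewrite ltnn.
Qed.

Definition dg (c : 'I_(n + n)) : nat := match split c with inl l => l | inr l => l end.

Definition clear_poly r : {poly C} := \prod_(i | (r.+1 < a i)%N) ('X - (z i)%:P).

Lemma clear_poly_monic r : clear_poly r \is monic.
Proof. by rewrite /clear_poly; apply: monic_prod => i _; apply: monicXsubC. Qed.

Lemma size_clear_poly r : size (clear_poly r) = (bsize a r).+1.
Proof.
rewrite /clear_poly (eq_bigl (fun i => i \in [set i | r.+1 < a i]%N)); last first.
  by move=> i; rewrite inE.
by rewrite -big_enum size_prod_XsubC -cardE.
Qed.

Lemma clear_poly_root r i : (r.+1 < a i)%N -> (clear_poly r).[z i] = 0.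
Proof.
by move=> ri; rewrite /clear_poly horner_prod (bigD1 i) //= hornerXsubC subrr mul0r.
Qed.

(* A deformation of V_m, for m = bsize a r, to C^2 (x) C[t]/prod_i (t - z_i):   *)
(* all of v_+, and the multiples of [clear_poly r] in v_-.                      *)
Definition trow (r : 'I_(nblk a)) v : 'rV[C]_(n + n) :=
  if (v < n)%N then pr n 0 'X^v else pr n ('X^(n.*2.-1 - v - bsize a r) * clear_poly r) 0.

Definition tmx r : 'M[C]_(k r, n + n) := \matrix_(i < k r) trow r ((k r).-1 - i).

Definition row_deg (v : nat) : nat := if (v < n)%N then v else (n.*2.-1 - v)%N.

Lemma pr_lshift (f g : {poly C}) l : pr n f g 0 (lshift n l) = f`_l.
Proof. by rewrite /pr row_mxEl mxE. Qed.

Lemma pr_rshift (f g : {poly C}) l : pr n f g 0 (rshift n l) = g`_l.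
Proof. by rewrite /pr row_mxEr mxE. Qed.

Lemma dg_lshift l : dg (lshift n l) = l.
Proof. by rewrite /dg (unsplitK (inl _)). Qed.

Lemma dg_rshift l : dg (rshift n l) = l.
Proof. by rewrite /dg (unsplitK (inr _)). Qed.

(** [clear_poly r] is monic of degree [bsize a r], so the leading terms of the deformed basis are
    the monomials spanning the subspace of [P]. *)
Lemma fil_tmx r : filmx dg (fun i : 'I_(k r) => row_deg ((k r).-1 - i)) 0
  (tmx r) (rmx n (k r) 0).
Proof.
move=> i c; rewrite !mxE addn0; set v := (_.-1 - i)%N.
have vlt : (v < n.*2 - bsize a r)%N by have := ltn_ord i; rewrite /v /bdim; lia.
rewrite /trow /row_deg /vrow mulr0; case: ifP => vn.
  have E : pr n (0 : {poly C}) 'X^v 0 c = if dg c == v then pr n 0 'X^v 0 c else 0.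
    case: (split_ordP c) => l ->; first by rewrite pr_lshift coef0 if_same.
    by rewrite pr_rshift dg_rshift coefXn; case: eqP.
  by split=> //; rewrite E; case: (dg c =P v) => [->|_]; rewrite ?eqxx.
case: (split_ordP c) => l ->; rewrite ?pr_lshift ?pr_rshift ?dg_lshift ?dg_rshift; last first.
  by rewrite coef0 eqxx if_same.
set d := (n.*2.-1 - v)%N; have dE : d = (bsize a r + (d - bsize a r))%N.
  by rewrite /d; have := bsize_le a r; lia.
set q := _ * _; have qm : q \is monic by rewrite monicMl ?monicXn // clear_poly_monic.
have sq : size q = d.+1.
  rewrite size_monicM ?monicXn ?monic_neq0 ?clear_poly_monic // size_polyXn size_clear_poly; lia.
rewrite coefXn; split.
  by apply: contraNT; rewrite -ltnNge => dl; rewrite nth_default // sq.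
case: eqP => [->|//]; move/monicP: qm; rewrite lead_coefE sq => ->.
by rewrite mulr1n.
Qed.

(** In the eigenvectors of t: v_+ at the point v, or v_- at the point v - n. The rows of [emx r] are
    thus v_+ at all points and v_- at the points i < n - m, m = [bsize a r]. *)
Definition erow v : 'rV[C]_(n + n) :=
  if (v < n)%N then row_mx 0 (\row_l (l == v :> nat)%:R)
  else row_mx (\row_l (l == v - n :> nat)%N%:R) 0.

Definition emx (r : 'I_(nblk a)) : 'M[C]_(k r, n + n) := \matrix_(i < k r) erow ((k r).-1 - i).

Lemma erow_sub r v : (v < k r)%N -> (erow v <= emx r)%MS.
Proof.
move=> vk; have lt : ((k r).-1 - v < k r)%N by lia.
have -> : erow v = row (Ordinal lt) (emx r) by rewrite rowK /=; congr (erow _); lia.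
exact: row_sub.
Qed.

Definition vdm2 : 'M[C]_(n + n) := xm 1%:M vdm.

Lemma pr_vdm2 (f g : {poly C}) : (size f <= n)%N -> (size g <= n)%N ->
  pr n f g *m vdm2 = row_mx (\row_i f.[z i]) (\row_i g.[z i]).
Proof.
have E (h : {poly C}) : (size h <= n)%N -> (\row_(l < n) h`_l) *m vdm = \row_i h.[z i].
  move=> sh; apply/rowP => i; rewrite !mxE (horner_coef_wide _ sh).
  by apply: eq_bigr => l _; rewrite !mxE.
move=> sf sg; rewrite /pr /vdm2 /xm mul_row_block !mxE /= !scale0r !scale1r.
by rewrite !mulmx0 addr0 add0r !E.
Qed.

(** Changing the basis evaluates polynomials at the z_i, and multiples of [clear_poly r] vanish at
    the points i with r + 1 < a_i, which by [mem_blk] are those with i >= n - m. *)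
Lemma tmx_vdm2_sub r : (tmx r *m vdm2 <= emx r)%MS.
Proof.
apply/row_subP => i; rewrite row_mul rowK; set v := (_.-1 - i)%N.
have vlt : (v < n.*2 - bsize a r)%N by have := ltn_ord i; rewrite /v /bdim; lia.
have bn := bsize_le a r.
rewrite /trow; case: ltnP => vn.
  rewrite pr_vdm2 ?size_poly0 ?size_polyXn //.
  have -> : row_mx (\row_i0 (0 : {poly C}).[z i0]) (\row_i0 'X^v.[z i0]) =
      \sum_(l < n) z l ^+ v *: erow l.
    apply/rowP => c; rewrite summxE; case: (split_ordP c) => l ->.
      rewrite row_mxEl mxE horner0 big1 // => l' _.
      by rewrite mxE /erow ltn_ord row_mxEl mxE mulr0.
    rewrite row_mxEr mxE hornerXn (bigD1 l) //= big1 => [|l' ne].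
      by rewrite mxE /erow ltn_ord row_mxEr mxE eqxx mulr1 addr0.
    by rewrite mxE /erow ltn_ord row_mxEr mxE val_eqE eq_sym (negPf ne) mulr0.
  apply: summx_sub => l _; apply: scalemx_sub; apply: erow_sub.
  by rewrite /bdim; have := ltn_ord l; lia.
set g := _ * _; rewrite pr_vdm2 ?size_poly0 //; last first.
  rewrite /g size_monicM ?monicXn ?monic_neq0 ?clear_poly_monic // size_polyXn size_clear_poly.
  by lia.
have -> : row_mx (\row_i0 g.[z i0]) (\row_i0 (0 : {poly C}).[z i0]) =
    \sum_(l < n | (l < n - bsize a r)%N) g.[z l] *: erow (n + l).
  apply/rowP => c; rewrite summxE; case: (split_ordP c) => l ->; last first.
    rewrite row_mxEr mxE horner0 big1 // => l' _.
    by rewrite mxE /erow ltnNge leq_addr row_mxEr mxE mulr0.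
  rewrite row_mxEl mxE; have [lt|ge] := ltnP l (n - bsize a r).
    rewrite (bigD1 l) //= big1 => [|l' /andP[_ ne]].
      by rewrite mxE /erow ltnNge leq_addr row_mxEl mxE addKn eqxx mulr1 addr0.
    by rewrite mxE /erow ltnNge leq_addr row_mxEl mxE addKn val_eqE eq_sym (negPf ne) mulr0.
  rewrite /g hornerM clear_poly_root ?mulr0 ?mem_blk // big1 // => l' l'lt.
  rewrite mxE /erow ltnNge leq_addr row_mxEl mxE addKn; case: eqP => [E|]; last by rewrite mulr0.
  by move: l'lt; rewrite -E ltnNge ge.
apply: summx_sub => l lt; apply: scalemx_sub; apply: erow_sub.
by rewrite /bdim; lia.
Qed.

Lemma sum_rev_pick r v (F : nat -> 'rV[C]_(n + n)) : (v < k r)%N ->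
  \sum_(i < k r) ((k r).-1 - i == v)%N%:R *: F ((k r).-1 - i)%N = F v.
Proof.
move=> vk; have lt : ((k r).-1 - v < k r)%N by lia.
rewrite (bigD1 (Ordinal lt)) //= big1 => [|i ne].
  have -> : ((k r).-1 - ((k r).-1 - v) = v)%N by lia.
  by rewrite eqxx scale1r addr0.
case: eqP => [E|]; last by rewrite scale0r.
by case/eqP: ne; apply: val_inj => /=; have := ltn_ord i; lia.
Qed.

Lemma erow_xm v x (i : 'I_n) : erow v *m xm x (delta_mx i i) =
  if (v < n)%N then (i == v :> nat)%:R *: (x 0 1 *: erow (n + i) + x 1 1 *: erow i)
  else (i == v - n :> nat)%N%:R *: (x 0 0 *: erow (n + i) + x 1 0 *: erow i).
Proof.
have D (w : nat) : (\row_(l < n) (l == w :> nat)%:R) *m delta_mx i i =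
    (i == w :> nat)%:R *: (\row_(l < n) (l == i :> nat)%:R) :> 'rV[C]_n.
  apply/rowP => l; rewrite !mxE (bigD1 i) //= big1 => [|l' ne].
    by rewrite !mxE eqxx addr0 -val_eqE.
  by rewrite !mxE (negPf ne) mulr0.
rewrite /erow (ltn_ord i) [(n + i < n)%N]ltnNge leq_addr addKn /= /xm.
case: ifP => vn; rewrite mul_row_block ?mul0mx ?add0r ?addr0 -!scalemxAr D;
  by rewrite !scale_row_mx !scaler0 add_row_mx addr0 add0r scale_row_mx !scalerA ![x _ _ * _]mulrC.
Qed.

(** f takes v_- to v_+, which is always in the space, and its matrix has no diagonal entries. *)
Lemma emx_f r i : exists2 A, emx r *m xm (sl2_f C) (delta_mx i i) = A *m emx r & \tr A = 0.
Proof.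
pose A : 'M[C]_(k r) := \matrix_(i1, i2)
  ((((k r).-1 - i1 == n + i)%N)%:R * ((k r).-1 - i2 == i)%N%:R).
exists A; last first.
  rewrite /mxtrace big1 // => i1 _; rewrite mxE -natrM mulnb; case: andP => // -[/eqP E1 /eqP E2].
  by have := ltn_ord i; lia.
apply/row_matrixP => i1; rewrite row_mul rowK erow_xm row_mul.
set v := ((k r).-1 - i1)%N.
have -> : row i1 A *m emx r = (v == n + i)%N%:R *: erow i.
  rewrite mulmx_sum_row.
  under eq_bigr => i2 _ do rewrite !mxE rowK -scalerA.
  rewrite -scaler_sumr sum_rev_pick //; have := ltn_ord i; have := bsize_le a r.
  by rewrite /bdim; lia.
rewrite !mxE /= ?mulr0n ?mulr1n !scale0r ?scale1r ?add0r ?addr0 ?scaler0.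
case: ifP => vn; last by congr (_%:R *: _); lia.
by have -> : (v == n + i)%N = false by [lia]; rewrite scale0r.
Qed.

(** At the point i the weight -1 of v_+ is cancelled by that of v_-, except when v_- is absent, that
    is when r + 1 < a_i. *)
Lemma emx_h r i : exists2 A, emx r *m xm (sl2_h C) (delta_mx i i) = A *m emx r &
  \tr A = - (r.+1 < a i)%N%:R.
Proof.
pose s (v : nat) : C := if (v < n)%N then - (i == v :> nat)%:R else (i == v - n :> nat)%N%:R.
exists (diag_mx (\row_i1 s ((k r).-1 - i1)%N)).
  apply/row_matrixP => i1; rewrite row_mul rowK erow_xm.
  set d := \row_i1 _; have -> : row i1 (diag_mx d *m emx r) = d 0 i1 *: row i1 (emx r).
    by apply/rowP => c; rewrite mul_diag_mx !mxE.
  rewrite rowK {}/d.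
  rewrite !mxE /= ?mulr0n ?mulr1n ?subrr ?subr0 ?sub0r !scale0r ?add0r ?addr0 /s; set v := (_.-1 - i1)%N.
  case: ifP => vn.
    rewrite scalerA mulrN1; case: eqP => [->//|_]; by rewrite oppr0 !scale0r.
  rewrite scale1r; case: eqP => [E|_]; last by rewrite !scale0r.
  by congr (_ *: erow _); lia.
have sE v : s v = (v == n + i)%N%:R - (v == i :> nat)%:R.
  rewrite /s; have := ltn_ord i; case: (ltnP v n) => vn iln.
    have -> : (v == n + i)%N = false by lia.
    by rewrite sub0r eq_sym.
  have -> : (v == i :> nat) = false by lia.
  rewrite subr0.
  by congr (_%:R); lia.
have pick (w : nat) : \sum_(v < k r) ((v == w :> nat)%:R : C) = (w < k r)%N%:R.
  have [lt|ge] := ltnP w (k r).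
    rewrite (bigD1 (Ordinal lt)) //= eqxx big1 ?addr0 // => v ne.
    by case: eqP => // E; case/eqP: ne; apply: val_inj.
  by rewrite big1 // => v _; case: eqP => // E; move: (ltn_ord v); rewrite E ltnNge ge.
rewrite mxtrace_diag; under eq_bigr => i1 _ do rewrite mxE.
rewrite (reindex_inj rev_ord_inj) /=.
transitivity (\sum_(v < k r) s v).
  by apply: eq_bigr => v _; congr (s _); have := ltn_ord v; lia.
under eq_bigr => v _ do rewrite sE.
rewrite sumrB !pick mem_blk //; have := ltn_ord i; have := bsize_le a r; rewrite /bdim => bn iln.
rewrite [(i < _)%N](_ : _ = true); last by lia.
case: (leqP (n - bsize a r) i) => le.
  by rewrite (_ : (n + i < _)%N = false) ?sub0r //; lia.
by rewrite (_ : (n + i < _)%N = true) ?subrr ?oppr0 //; lia.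
Qed.

Definition w_pt : tpow C (pos k) (n + n) := mvec (fun r => tmx r *m vdm2).

Lemma w_pt_at i x (t : 'I_(nblk a) -> C) :
  (forall r, exists2 A, emx r *m xm x (delta_mx i i) = A *m emx r & \tr A = t r) ->
  at_point i x w_pt = (\sum_r t r) *: w_pt.
Proof.
move=> HA; have [A A1 A2] := fin_all_exists2 HA.
have HG r : exists G, tmx r *m vdm2 = G *m emx r by have /submxP := tmx_vdm2_sub r.
have [G GP] := fin_all_exists HG.
rewrite /w_pt (eq_mvec GP) mvec_mull /at_point dpZr (dp_mvec A1).
by rewrite scalerA mulrC -scalerA; congr (_ *: _); apply: eq_bigr => r _; rewrite A2.
Qed.

Lemma w_pt_f i : at_point i (sl2_f C) w_pt = 0.
Proof. by rewrite (w_pt_at (emx_f ^~ i)) big1 ?scale0r. Qed.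

Lemma w_pt_h i : at_point i (sl2_h C) w_pt = - (a i).-1%:R *: w_pt.
Proof.
rewrite (w_pt_at (emx_h ^~ i)) sumrN -natr_sum; congr (- _%:R *: _).
by rewrite -card_blk // -sum1_card big_mkcond [RHS]big_mkcond; apply: eq_bigr => r _; rewrite inE; case: ifP.
Qed.

Definition vdm2_inv : 'M[C]_(n + n) := xm 1%:M (invmx vdm).

Lemma vdm2K : vdm2 *m vdm2_inv = 1%:M.
Proof.
rewrite xmM mulmx1 mulmxV ?vdm_unit // /xm !mxE /= scale1r scale0r.
by rewrite -scalar_mx_block.
Qed.

Definition psi1 (v : tens C a) : tpow C (pos k) (n + n) := tp vdm2_inv (psi_tens w_pt v).

Lemma psi1_is_linear : linear psi1.
Proof. by move=> c u v; rewrite /psi1 !linearP. Qed.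
HB.instance Definition _ :=
  GRing.isLinear.Build C (tens C a) (tpow C (pos k) (n + n)) _ psi1 psi1_is_linear.

Lemma psi1_vbar : psi1 (vbar C a) = mvec tmx.
Proof.
rewrite /psi1 psi_tens_vbar // tp_mvec; apply: eq_mvec => r.
by rewrite -mulmxA vdm2K mulmx1.
Qed.

(** Multiplication by t^j on C[t]/prod (t - z_i) in the basis of monomials. *)
Definition cur_mx j : 'M[C]_n := vdm *m (\sum_i z i ^+ j *: delta_mx i i) *m invmx vdm.

Lemma psi1_current v x j : \tr x = 0 ->
  psi1 (current z x j v) = dp (xm x (cur_mx j)) (psi1 v).
Proof.
move=> trx; rewrite /psi1 (psi_tens_current z a_gt0 w_pt_f w_pt_h) //.
apply: dp_tp; rewrite !xmM mulmx1 mul1mx; congr (xm _ _).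
by rewrite /cur_mx !mulmxA mulVmx ?mul1mx // vdm_unit.
Qed.

(** For i + j < n the product t^j t^i is a monomial; otherwise its remainder has degree below n,
    hence below i + j, and contributes nothing to the leading part. *)
Lemma fil_cur_mx x j : filmx dg dg j (xm x (cur_mx j)) (xm x (mulx n 'X^j)).
Proof.
have D : (\sum_i z i ^+ j *: delta_mx i i : 'M[C]_n) = diag_mx (\row_i z i ^+ j).
  apply/matrixP => i1 i2; rewrite summxE !mxE (bigD1 i1) //= big1 => [|i ne].
    by rewrite !mxE eqxx addr0 eq_sym; case: eqP => _; rewrite ?mulr1 ?mulr0.
  by rewrite !mxE eq_sym (negPf ne) mulr0.
have E (i l : 'I_n) : (cur_mx j i l != 0 -> (l <= i + j)%N) /\
    mulx n 'X^j i l = if (l == i + j :> nat)%N then cur_mx j i l else 0.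
  have -> : mulx n ('X^j : {poly C}) i l = (l == i + j :> nat)%N%:R by rewrite mxE -exprD coefXn addnC.
  rewrite /cur_mx D.
  have [lt|ge] := ltnP (i + j) n; last first.
    have ln : (l < i + j)%N by apply: leq_trans (ltn_ord l) ge.
    by rewrite (ltn_eqF ln); split=> // _; apply: ltnW.
  have -> : (vdm *m diag_mx (\row_i0 z i0 ^+ j) *m invmx vdm) i l = (l == Ordinal lt)%:R.
    transitivity ((row (Ordinal lt) vdm *m invmx vdm) 0 l); last first.
      by rewrite -row_mul mulmxV ?vdm_unit // !mxE eq_sym.
    rewrite mul_mx_diag [LHS]mxE [RHS]mxE; apply: eq_bigr => i0 _.
    by rewrite !mxE exprD.
  rewrite -val_eqE /=; have [->|_] := eqVneq (l : nat) (i + j)%N; first by split=> // _; exact: leqnn.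
  by rewrite eqxx.
have F (y : C) i l : (y * cur_mx j i l != 0 -> (l <= i + j)%N) /\
    y * mulx n 'X^j i l = if (l == i + j :> nat)%N then y * cur_mx j i l else 0.
  have [E1 ->] := E i l; split; last by case: ifP => _; rewrite ?mulr0.
  by rewrite mulf_eq0 negb_or => /andP[_ /E1].
have S (y : C) (N : 'M[C]_n) i l : (y *: N) i l = y * N i l by rewrite mxE.
move=> i c; rewrite /xm; case: (split_ordP i) => i' ->; case: (split_ordP c) => l ->;
  rewrite ?block_mxEul ?block_mxEur ?block_mxEdl ?block_mxEdr ?dg_lshift ?dg_rshift !S;
  exact: F.
Qed.

End Deformation.

(** * Passage to the associated graded module *)

Section Psi.
Variables (C : numFieldType) (n : nat) (a : 'I_n -> nat) (z : 'I_n -> C).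
Hypothesis a_incr : forall i j : 'I_n, (i < j)%N -> (a i < a j)%N.
Hypothesis a_gt0 : forall i, (0 < a i)%N.
Hypothesis z_inj : injective z.
Variable M : fusion_product a z.
Local Notation k := (@bdim n a).
Local Notation T := (tpow C (pos k) (n + n)).

Definition vac_deg := (\sum_(r < nblk a) \sum_(i < k r) row_deg n ((k r).-1 - i))%N.
Definition vac_vec : T := mvec (fun r => rmx n (k r) 0).

Local Notation dg := (@dg n).
Local Notation psi1 := (@psi1 C n a z).

Lemma psi1_vac : tsupp dg vac_deg (psi1 (vbar C a)) /\
  tcomp dg vac_deg (psi1 (vbar C a)) = vac_vec.
Proof. by rewrite psi1_vbar //; apply: fil_mvec => r; apply: fil_tmx. Qed.

Lemma monomial_supp s (v : tens C a) : monomial z s v -> tsupp dg (vac_deg + s) (psi1 v).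
Proof.
elim=> [|x j {}s {}v trx _ IH]; first by rewrite addn0; have [] := psi1_vac.
rewrite psi1_current // addnCA addnC.
by have [] := fil_dp (fil_cur_mx z_inj x j) IH.
Qed.

(** A linear map with kernel [tsupp dg d]: the filtration is defined through subspaces, so the
    support condition is needed as a subspace in order to be checked on monomials only. *)
Definition thigh d (x : T) : T := [ffun S => if (d < tdeg dg S)%N then x S else 0].

Lemma thigh_is_linear d : linear (thigh d).
Proof.
move=> c x y; apply/ffunP => S; rewrite !ffunE.
by case: ifP => // _; rewrite scaler0 addr0.
Qed.

Lemma thighP d x : reflect (tsupp dg d x) (thigh d x == 0).
Proof.
apply: (iffP eqP) => [/ffunP h0 S xS|sx].
  by rewrite leqNgt; apply: contraNN xS => lt; have := h0 S; rewrite !ffunE lt => ->.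
apply/ffunP => S; rewrite !ffunE; case: ltnP => // lt.
by apply/eqP; apply: contraTT lt => /sx; rewrite -leqNgt.
Qed.

Lemma filt_supp s (v : tens C a) : filt_lt z s.+1 v -> tsupp dg (vac_deg + s) (psi1 v).
Proof.
move=> Fv; have lin : linear (fun v => thigh (vac_deg + s) (psi1 v)).
  by move=> c x y; rewrite linearP thigh_is_linear.
have [L LE] := lfun_of_linear lin.
have : v \in lker L; last by rewrite memv_ker LE => /thighP.
apply: Fv => r u; rewrite ltnS => rs /monomial_supp su.
by rewrite memv_ker LE; apply/thighP; apply: tsuppW su; rewrite leq_add2l.
Qed.

Lemma filt_comp0 s (v : tens C a) : filt_lt z s v -> tcomp dg (vac_deg + s) (psi1 v) = 0.
Proof.
case: s => [|s] Fv; last by apply: tcomp_eq0 (filt_supp Fv) _; rewrite ltn_add2l.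
have : v \in (0 : {vspace tens C a})%VS by apply: Fv.
by rewrite memv0 => /eqP ->; rewrite !linear0.
Qed.

Lemma filt_lt0 s : filt_lt z s (0 : tens C a).
Proof. by move=> U _; apply: mem0v. Qed.

Lemma filt_lin s c u v : filt_lt z s u -> filt_lt z s v -> filt_lt z s (c *: u + v : tens C a).
Proof. by move=> Fu Fv U HU; rewrite memvD ?memvZ ?Fu ?Fv. Qed.

Lemma fp_cls0 s : fp_cls M s 0 = 0.
Proof. by apply/fp_cls_ker; apply: filt_lt0. Qed.

Definition gcomp s (v : tens C a) : T := tcomp dg (vac_deg + s) (psi1 v).

Lemma gcomp_lin s c u v : gcomp s (c *: u + v) = c *: gcomp s u + gcomp s v.
Proof. by rewrite /gcomp !linearP. Qed.

Lemma gcomp0 s : gcomp s 0 = 0.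
Proof. by rewrite /gcomp !linear0. Qed.

(** The graph of psi. An element of M is a sum of classes in many ways, so a relation comes first
    and [psi_rel_fun] makes it a map. *)
Definition psi_rel (m : M) (x : T) := exists N (v : nat -> tens C a),
  [/\ forall s, filt_lt z s.+1 (v s), forall s, (N <= s)%N -> v s = 0,
      m = \sum_(s < N) fp_cls M s (v s) & x = \sum_(s < N) gcomp s (v s)].

Lemma sum_extend (V : zmodType) (F : nat -> V) N N' : (N <= N')%N ->
  (forall s, (N <= s)%N -> F s = 0) -> \sum_(s < N') F s = \sum_(s < N) F s.
Proof.
move=> NN' F0; rewrite (big_ord_widen N' F NN') [RHS]big_mkcond /=.
by apply: eq_bigr => s _; case: ltnP => // /F0.
Qed.

Lemma psi_rel_total m : exists x, psi_rel m x.
Proof.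
have [N [v [Fv mE]]] := fp_cls_span m.
pose v' s := if (s < N)%N then v s else 0.
exists (\sum_(s < N) gcomp s (v' s)), N, v'; split=> //.
- by move=> s; rewrite /v'; case: ifP => _; rewrite ?Fv //; apply: filt_lt0.
- by move=> s; rewrite /v' ltnNge => ->.
- by rewrite mE; apply: eq_bigr => s _; rewrite /v' ltn_ord.
Qed.

Lemma psi_rel_lin c m x m' x' : psi_rel m x -> psi_rel m' x' -> psi_rel (c *: m + m') (c *: x + x').
Proof.
case=> N [v [Fv v0 -> ->]] [N' [v' [Fv' v0' -> ->]]].
exists (maxn N N'), (fun s => c *: v s + v' s); split=> [s|s||].
- exact: filt_lin.
- by rewrite geq_max => /andP[/v0 -> /v0' ->]; rewrite scaler0 addr0.
- rewrite -(@sum_extend _ (fun s => fp_cls M s (v s)) N (maxn N N')) ?leq_maxl //; last first.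
    by move=> s /v0 ->; rewrite fp_cls0.
  rewrite -(@sum_extend _ (fun s => fp_cls M s (v' s)) N' (maxn N N')) ?leq_maxr //; last first.
    by move=> s /v0' ->; rewrite fp_cls0.
  rewrite scaler_sumr -big_split /=; apply: eq_bigr => s _.
  by rewrite fp_cls_linear.
- rewrite -(@sum_extend _ (fun s => gcomp s (v s)) N (maxn N N')) ?leq_maxl //; last first.
    by move=> s /v0 ->; rewrite gcomp0.
  rewrite -(@sum_extend _ (fun s => gcomp s (v' s)) N' (maxn N N')) ?leq_maxr //; last first.
    by move=> s /v0' ->; rewrite gcomp0.
  rewrite scaler_sumr -big_split /=; apply: eq_bigr => s _.
  by rewrite gcomp_lin.
Qed.

(** By directness each class vanishes; thus [v s] is in F_(s-1), where [psi1] has no component of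
    degree [vac_deg + s]. *)
Lemma psi_rel0 x : psi_rel 0 x -> x = 0.
Proof.
case=> N [v [Fv _ /esym E ->]]; rewrite big1 // => s _.
apply: filt_comp0; apply/(fp_cls_ker M (Fv s)).
exact: (fp_cls_direct Fv E).
Qed.

Lemma psi_rel_fun m x x' : psi_rel m x -> psi_rel m x' -> x = x'.
Proof.
move=> R R'; have := psi_rel_lin (-1) R R'; rewrite !scaleN1r addNr => /psi_rel0 /eqP.
by rewrite addrC subr_eq0 => /eqP.
Qed.

Lemma psi_sig m : {x | psi_rel m x}.
Proof. exact: constructive_indefinite_description (psi_rel_total m). Qed.

Definition psi m : T := sval (psi_sig m).

Lemma psiP m : psi_rel m (psi m).
Proof. exact: svalP (psi_sig m). Qed.

Lemma psi_is_linear : linear psi.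
Proof.
by move=> c m m'; apply: psi_rel_fun (psiP _) (psi_rel_lin c (psiP m) (psiP m')).
Qed.
HB.instance Definition _ := GRing.isLinear.Build C M T _ psi psi_is_linear.

Lemma psi_cls s v : filt_lt z s.+1 v -> psi (fp_cls M s v) = gcomp s v.
Proof.
move=> Fv; apply: psi_rel_fun (psiP _) _.
exists s.+1, (fun s' => if s' == s then v else 0); split=> [s'|s'||].
- by case: eqP => [->|_] //; apply: filt_lt0.
- by move=> ss'; rewrite gtn_eqF.
- rewrite (bigD1 ord_max) //= eqxx big1 ?addr0 // => s' ne.
  rewrite (_ : (s' == s :> nat) = false) ?fp_cls0 //.
  by apply/negbTE; move: ne; rewrite -val_eqE.
- rewrite (bigD1 ord_max) //= eqxx big1 ?addr0 // => s' ne.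
  rewrite (_ : (s' == s :> nat) = false) ?gcomp0 //.
  by apply/negbTE; move: ne; rewrite -val_eqE.
Qed.

Lemma psi_act x j m : \tr x = 0 -> psi (fp_act M x j m) = dp (xm x (mulx n 'X^j)) (psi m).
Proof.
move=> trx; have [N [v [Fv v0 -> ->]]] := psiP m.
rewrite [fp_act _ _ _ _]linear_sum [LHS]linear_sum dp_sumr; apply: eq_bigr => s _ /=.
rewrite fp_act_cls // psi_cls; last by rewrite -addnS; apply: filt_current.
rewrite /gcomp psi1_current // addnCA addnC.
by have [_ ->] := fil_dp (fil_cur_mx z_inj x j) (filt_supp (Fv s)).
Qed.

Lemma psi_vac : psi (fp_vac M) = vac_vec.
Proof.
rewrite psi_cls; first by rewrite /gcomp addn0; have [] := psi1_vac.
by move=> U; apply; last exact: MonNil.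
Qed.

Lemma dim_tens : \dim {:tens C a} = (\prod_i a i)%N.
Proof.
rewrite dimvf.
transitivity (#|tidx a| * 1)%N; first by [].
rewrite muln1 card_dep_ffun foldrE big_image /=.
by apply: eq_bigr => i _; rewrite card_ord.
Qed.

(** Classes of degree less than N span at most dim F_(N-1) dimensions: each step adds the images of
    a basis of a complement of F_(N-1) in F_N. *)
Lemma dim_fusion : (\dim {:M} <= \prod_i a i)%N.
Proof.
pose U s := sval (span_vspace (fun v : tens C a => exists2 r, (r < s)%N & monomial z r v)).
have UE s w : w \in U s <-> filt_lt z s w.
  rewrite (svalP (span_vspace _) w); split=> H V PV; apply: H.
    by move=> v [r rs mv]; apply: PV mv.
  by move=> r v rs mv; apply: PV; exists r.
have H N : exists W : {vspace M},
    (forall s v, (s < N)%N -> filt_lt z s.+1 v -> fp_cls M s v \in W) /\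
    (\dim W <= \dim (U N))%N.
  elim: N => [|N [W [clsW dW]]]; first by exists 0%VS; rewrite dimv0.
  have UU : (U N <= U N.+1)%VS.
    apply/subvP => w /UE Fw; apply/UE => V PV; apply: Fw => r v rN; apply: PV.
    exact: leq_trans rN _.
  pose X := (U N.+1 :\: U N)%VS.
  have XU w : w \in X -> filt_lt z N.+1 w by move=> wX; apply/UE; apply: (subvP (diffvSl _ _)) wX.
  pose S := <<[seq fp_cls M N b | b <- vbasis X]>>%VS.
  have clsS w : w \in X -> fp_cls M N w \in S.
    move=> wX; rewrite (coord_vbasis wX).
    suff: filt_lt z N.+1 (\sum_i coord (vbasis X) i w *: (vbasis X)`_i) /\
      fp_cls M N (\sum_i coord (vbasis X) i w *: (vbasis X)`_i) \in S by case.
    elim/big_rec: _ => [|i y _ [Fy Sy]].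
      by split; [apply: filt_lt0 | rewrite fp_cls0 mem0v].
    have bX : (vbasis X)`_i \in X by rewrite vbasis_mem // mem_nth // size_tuple.
    split; first exact: filt_lin (XU _ bX) Fy.
    rewrite fp_cls_linear ?memvD ?memvZ //; last exact: XU.
    by apply: memv_span; apply: map_f; rewrite mem_nth // size_tuple.
  exists (W + S)%VS; split=> [s v|].
    rewrite ltnS leq_eqVlt => /orP[/eqP ->|sN Fv]; last first.
      by apply: (subvP (addvSl _ _)); apply: clsW.
    move=> /UE; rewrite -(addv_diff_cap (U N.+1) (U N)) => /memv_addP[u1 u1X [u2 u2U ->]].
    have u2N : filt_lt z N u2 by apply/UE; apply: (subvP (capvSr _ _)) u2U.
    have u2N1 : filt_lt z N.+1 u2 by apply/UE; apply: (subvP UU); apply/UE.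
    rewrite -[u1]scale1r fp_cls_linear //; last exact: XU.
    have /(fp_cls_ker M u2N1) -> : filt_lt z N u2 by [].
    by rewrite addr0 memvZ // (subvP (addvSr _ _)) // clsS.
  apply: leq_trans (dimv_add_leqif _ _) _.
  apply: (@leq_trans (\dim (U N) + \dim X)); last first.
    by rewrite -(dimv_cap_compl (U N.+1) (U N)) (capv_idPr UU).
  apply: leq_add => //; apply: leq_trans (dim_span _) _.
  by rewrite size_map size_tuple.
have HM m : exists N, forall W : {vspace M},
    (forall s v, (s < N)%N -> filt_lt z s.+1 v -> fp_cls M s v \in W) -> m \in W.
  have [N [v [Fv ->]]] := fp_cls_span m; exists N => W HW.
  by apply: memv_suml => s _; apply: HW.
have [N NP] := fin_all_exists (fun i : 'I_(\dim {:M}) => HM (vbasis {:M})`_i).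
have [W [clsW dW]] := H (\max_i N i)%N.
have WM : (fullv <= W)%VS.
  apply/subvP => m _; rewrite (coord_vbasis (memvf m)); apply: memv_suml => i _.
  apply: memvZ; apply: NP => s v sN; apply: clsW; apply: leq_trans sN _.
  exact: leq_bigmax.
apply: leq_trans (dimvS WM) _; apply: leq_trans dW _.
by rewrite -dim_tens dimvS ?subvf.
Qed.

End Psi.

(** * Injectivity by counting dimensions *)

Section PsiInjective.
Variables (C : numFieldType) (n : nat) (a : 'I_n -> nat) (z : 'I_n -> C).
Hypothesis a_incr : forall i j : 'I_n, (i < j)%N -> (a i < a j)%N.
Hypothesis a_gt0 : forall i, (0 < a i)%N.
Hypothesis z_inj : injective z.
Variable M : fusion_product a z.
Local Notation k := (@bdim n a).
Local Notation T := (tpow C (pos k) (n + n)).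
Local Notation psi := (@psi C n a z M).

Definition cell_vec (p : {poly C}) : T := mvec (fun r => rmx n (k r) p).

Lemma cell_vecE p : cell_vec p = tp (umx n p) (vac_vec C a).
Proof. by rewrite tp_mvec; apply: eq_mvec => r; rewrite rmx_umx add0r. Qed.

Lemma mulx_sum (p : {poly C}) : mulx n p = \sum_(j < n) p`_j *: mulx n 'X^j.
Proof.
apply/matrixP => i l; rewrite summxE mxE coefMXn.
under eq_bigr => j _ do rewrite mxE mxE -exprD coefXn.
case: ltnP => il.
  rewrite big1 // => j _; rewrite (_ : (l == j + i :> nat)%N = false) ?mulr0 //.
  by apply/negbTE; rewrite neq_ltn (leq_trans il) ?leq_addl.
have lt : (l - i < n)%N by apply: leq_ltn_trans (leq_subr _ _) (ltn_ord l).
rewrite (bigD1 (Ordinal lt)) //= subnK // eqxx mulr1 big1 ?addr0 // => j ne.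
rewrite (_ : (l == j + i :> nat)%N = false) ?mulr0 //; apply/negbTE.
by apply: contraNN ne => /eqP E; apply/eqP/val_inj; rewrite /= E addnK.
Qed.

Lemma psi_actp x (p : trunc C n) m : \tr x = 0 ->
  psi (fp_actp M x p m) = dp (xm x (mulx n (p : {poly C}))) (psi m).
Proof.
move=> trx; rewrite /fp_actp sum_lfunE linear_sum mulx_sum xm_sum dp_sum.
apply: eq_bigr => j _; rewrite scale_lfunE linearZ /= psi_act //.
by rewrite -[_ *: mulx n _]addr0 xm_linr xm0 addr0 dpZ.
Qed.

Lemma umxE (p : {poly C}) : umx n p = 1%:M + xm (sl2_e C) (mulx n p).
Proof.
rewrite /umx /xm !mxE /= !scale0r scale1r scalar_mx_block add_block_mx.
by rewrite !addr0 !add0r.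
Qed.

Lemma xm_e_sq (N : 'M[C]_n) : xm (sl2_e C) N *m xm (sl2_e C) N = 0.
Proof. by rewrite xmM /sl2_e mul_delta_mx_0 // xm0l. Qed.

(** The image of psi contains w and is stable under the operators e (x) t^j, hence under their
    exponentials. *)
Lemma cell_vec_psi p : exists m, psi m = cell_vec p.
Proof.
have I m : exists m', psi m' = dp (xm (sl2_e C) (mulx n p)) (psi m).
  exists (\sum_(j < n) p`_j *: fp_act M (sl2_e C) j m).
  rewrite linear_sum mulx_sum xm_sum dp_sum; apply: eq_bigr => j _ /=.
  rewrite linearZ /= psi_act //; last first.
    by rewrite /mxtrace !big_ord_recl big_ord0 !mxE /= !addr0.
  by rewrite -[_ *: mulx n _]addr0 xm_linr xm0 addr0 dpZ.
have {}I q : exists m, psi m = iter q (dp (xm (sl2_e C) (mulx n p))) (vac_vec C a).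
  elim: q => [|q [m IH]]; first by exists (fp_vac M); rewrite psi_vac.
  by rewrite iterS -IH; apply: I.
have [m mP] := fin_all_exists (fun q : 'I_#|pos k|.+1 => I q).
exists (\sum_(q < #|pos k|.+1) q`!%:R^-1 *: m q).
rewrite cell_vecE umxE (tp_exp _ (xm_e_sq _) (ltnSn _)) linear_sum; apply: eq_bigr => q _.
by rewrite linearZ /= mP.
Qed.

Definition blk_sizes := map (fun r : 'I_(nblk a) => bsize a r) (enum 'I_(nblk a)).

Lemma gen_blocks (s : seq 'I_(nblk a)) f : uniq s -> gen n (map (fun r : 'I_(nblk a) => bsize a r) s) f ->
  exists X : forall r, 'M[C]_(n + n, k r), forall p, f p = \prod_(r <- s) \det (rmx n (k r) p *m X r).
Proof.
elim: s f => [|r s IH] f /= => [_|/andP[rs us]] Gf.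
  inversion Gf as [f' f1 |]; subst.
  by exists (fun r => 0) => p; rewrite big_nil f1.
inversion Gf as [|m' k1 ms1 Y f1 g1 k1m Gf1 fE]; subst.
have [X XP] := IH _ us Gf1.
have E : k1 = k r by rewrite /bdim; lia.
subst k1; exists (dfwith X Y) => p; rewrite big_cons dfwith_in fE XP; congr (_ * _).
apply: eq_big_seq => r' r's; rewrite dfwith_out //.
by apply: contraNneq rs => ->.
Qed.

(** The Pluecker coordinates of all blocks are multiplied in T, so a product with one minor for each
    block is linear there. *)
Lemma minors_functional f : minors n blk_sizes f ->
  exists L : 'Hom(T, C^o), forall p, f p = L (cell_vec p).
Proof.
elim=> {f} [f f0 | c g f h Gg _ [L LE] hE].
  by exists 0 => p; rewrite lfunE f0.
have [X XP] := gen_blocks (enum_uniq _) Gg.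
pose la (x : T) : C^o := \sum_(S : {ffun pos k -> 'I_(n + n)})
  (\prod_r \prod_j X r (slot S r j) j) * x S.
have la_lin : linear la.
  move=> b x y; rewrite /la scaler_sumr -big_split /=; apply: eq_bigr => S _.
  by rewrite !ffunE mulrDr /GRing.scale /= mulrCA.
have [L' L'E] := lfun_of_linear la_lin.
exists (c *: L' + L) => p; rewrite hE LE add_lfunE scale_lfunE L'E XP; congr (_ * _ + _).
rewrite /la big_enum /=.
under eq_bigr => r _.
  have -> : rmx n (k r) p *m X r = \matrix_(i, j) (rmx n (k r) p *m X r) i (id j).
    by apply/matrixP => i j; rewrite mxE.
  rewrite (det_mul_col (rmx n (k r) p) (fun=> X r) id).
  over.
rewrite -(sum_slot (fun r s => \prod_j X r (s j) j * \det (colsub s (rmx n (k r) p)))).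
by apply: eq_bigr => S _; rewrite big_split /= ffunE.
Qed.

(** Exactly a_i - 1 blocks have size greater than n - 1 - i. *)
Lemma prod_above : (\prod_(j < n) (above blk_sizes j).+1 = \prod_i a i)%N.
Proof.
rewrite (reindex_inj rev_ord_inj) /=; apply: eq_bigr => i _.
rewrite -[RHS](prednK (a_gt0 i)); congr _.+1; rewrite -card_blk // /above count_map.
rewrite cardE size_filter -enumT; apply: eq_count => r; rewrite /= inE mem_blk //.
by have := bsize_le a r; have := ltn_ord i; lia.
Qed.

Lemma psi_inj : injective psi.
Proof.
have [P PE] := lfun_of_linear (@psi_is_linear C n a z a_incr a_gt0 z_inj M).
suff kP : lker P == 0%VS by move=> x y E; apply: (lker0P kP); rewrite !PE.
have [F [MF indF]] : dimge (\prod_i a i)%N (minors (C := C) n blk_sizes).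
  rewrite -prod_above; apply: minors_dim; apply/allP => m /mapP[r _ ->].
  exact: bsize_le.
have [L LE] := fin_all_exists (fun i => minors_functional (MF i)).
move: (dim_fusion M) F MF indF L LE; set N := (\prod_i a i)%N => dimM F MF indF L LE.
have {}dimM : (\dim {:M} <= N)%N by [].
pose d := \dim (limg P); pose A : 'M[C]_(d, N) := \matrix_(j, i) L i (vbasis (limg P))`_j.
(* If the image had fewer than N dimensions, some combination of the N functionals would vanish on
   it, hence on all cell vectors, against the independence of the [F i]. *)
have Ndim : (N <= d)%N.
  rewrite leqNgt; apply/negP => dN.
  have [c cA c0] : exists2 c : 'rV[C]_N, c *m A^T = 0 & c != 0.
    have : (kermx A^T != 0).
      rewrite kermx_eq0 -row_leq_rank -ltnNge.
      by apply: leq_ltn_trans (rank_leq_col _) dN.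
    by move=> /rowV0Pn[c /sub_kermxP cA c0]; exists c.
  case/eqP: c0; apply/rowP => i; rewrite mxE; apply: (indF (fun i => c 0 i)) => p.
  under eq_bigr => i' _ do rewrite LE.
  have [m <-] := cell_vec_psi p.
  have : P m \in limg P by rewrite memv_img ?memvf.
  rewrite PE => /coord_vbasis ->.
  under eq_bigr => i' _ do rewrite linear_sum mulr_sumr.
  rewrite exchange_big big1 //= => j _.
  under eq_bigr => i' _ do rewrite linearZ /= mulrCA.
  rewrite -mulr_sumr.
  have /rowP/(_ j) := cA; rewrite !mxE => E.
  rewrite (_ : \sum_i _ = 0) ?mulr0 // -[RHS]E; apply: eq_bigr => i' _.
  by rewrite !mxE.
have := limg_ker_dim P fullv; rewrite capfv => dimP.
have : (\dim (lker P) == 0)%N.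
  by move: dimP dimM Ndim; rewrite /d; lia.
by rewrite dimv_eq0.
Qed.

End PsiInjective.

(** * The group action and the flags *)

Section NilpotentExponential.
Variables (C : numFieldType) (M : vectType C).

Lemma iter_lfun (N : 'End(M)) q (m : M) :
  iter q (fun S => (N \o S)%VF) \1%VF m = iter q N m.
Proof. by elim: q => [|q IH] /=; rewrite ?id_lfunE // comp_lfunE IH. Qed.

(** The images of the powers of N decrease strictly until they are 0; this justifies the cutoff in
    [nexp]. *)
Lemma iter_nilp (N : 'End(M)) K q m : (forall m, iter K N m = 0) -> (\dim {:M} <= q)%N ->
  iter q N m = 0.
Proof.
move=> N0 dq; pose W q := iter q (fun U => (N @: U)%VS) fullv.
have WS i : (W i.+1 <= W i)%VS.
  by elim: i => [|i IH]; [exact: subvf | exact: limgS].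
have memW i x : iter i N x \in W i.
  by elim: i => [|i IH]; [exact: memvf | exact: memv_img].
have WK : W K = 0%VS.
  apply/eqP; rewrite -subv0; apply/subvP => y.
  have : forall i y, y \in W i -> exists x, y = iter i N x.
    elim=> [|i IH] x; first by exists x.
    by case/memv_imgP => x' /IH[x'' ->] ->; exists x''.
  by move=> H /H[x ->]; rewrite N0 mem0v.
have stab i : W i.+1 = W i -> W i = 0%VS.
  move=> Ei; have E j : W (i + j)%N = W i.
    by elim: j => [|j IH]; rewrite ?addn0 // addnS /W iterS -/(W _) IH.
  have [iK|Ki] := leqP i K; first by rewrite -(E (K - i)%N) subnKC.
  apply/eqP; rewrite -subv0 -WK -(subnKC (ltnW Ki)); elim: (i - K)%N => [|j IH].
    by rewrite addn0.
  by rewrite addnS; apply: subv_trans (WS _) IH.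
have dW i : W i = 0%VS \/ (\dim (W i) + i <= \dim {:M})%N.
  elim: i => [|i [IH|IH]]; first by right; rewrite addn0.
    by left; apply/eqP; rewrite -subv0 -IH.
  have [/stab Wi0|ne] := eqVneq (W i.+1) (W i).
    by left; apply/eqP; rewrite -subv0 -Wi0.
  right; apply: leq_trans IH; rewrite addnS ltn_add2r ltn_neqAle dimvS // andbT.
  by apply: contraNN ne => /eqP E; rewrite eqEdim WS E leqnn.
have Wq : W q = 0%VS.
  case: (dW q) => // le; apply/eqP; rewrite -dimv_eq0.
  by move: le; move: (\dim (W q)) => d le; rewrite -leqn0 -(leq_add2r q) add0n; apply: leq_trans le _.
by have := memW q m; rewrite Wq memv0 => /eqP.
Qed.

(** Injectivity of f carries nilpotency over to N; the two exponentials are then compared at the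
    larger of their cutoffs. *)
Lemma nexp_intertwine (P : finType) D (f : {linear M -> tpow C P D}) (N : 'End(M)) (A : 'M[C]_D) m :
  injective f -> A *m A = 0 -> (forall m, f (N m) = dp A (f m)) ->
  f (nexp N m) = tp (1%:M + A) (f m).
Proof.
move=> finj A2 fN; have fit q m' : f (iter q N m') = iter q (dp A) (f m').
  by elim: q => //= q IH; rewrite fN IH.
have N0 m' : iter #|P|.+1 N m' = 0.
  by apply: finj; rewrite fit iter_dp_eq0 ?linear0.
pose B := maxn (\dim {:M}).+1 #|P|.+1.
rewrite (tp_exp (N := B)) //; last by rewrite leq_max ltnSn orbT.
rewrite /nexp sum_lfunE linear_sum.
under eq_bigr => q _ do rewrite scale_lfunE linearZ /= iter_lfun fit.
apply/esym/(sum_extend (F := fun q => q`!%:R^-1 *: iter q (dp A) (f m))).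
  exact: leq_maxl.
by move=> q dq; rewrite -fit (iter_nilp _ N0) ?linear0 ?scaler0 // ltnW.
Qed.

End NilpotentExponential.

(** * Monomial coordinates on V_0 and the matrices of SL_2(C[t]/t^n) *)

Section TruncCoordinates.
Variables (C : numFieldType) (n : nat).
Hypothesis n_gt0 : (0 < n)%N.
Local Notation R := (trunc C n).

Lemma coef_rmodp (f : {poly C}) l : (l < n)%N ->
  (Pdiv.CommonRing.rmodp f (mk_monic 'X^n))`_l = f`_l.
Proof.
move=> ln; rewrite mk_monic_Xn prednK // -Pdiv.IdomainMonic.modpE ?monicXn //.
by rewrite -Pdiv.IdomainMonic.take_poly_modp coef_take_poly ln.
Qed.

Lemma size_trunc (p : R) : (size (p : {poly C}) <= n)%N.
Proof.
apply: leq_trans (size_npoly p) _; by rewrite mk_monic_Xn size_polyXn /= prednK.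
Qed.

Lemma coef_truncM (p q : R) l : (l < n)%N ->
  ((p * q : R) : {poly C})`_l = ((p : {poly C}) * (q : {poly C}))`_l.
Proof. by move=> ln; rewrite poly_of_qpolyM coef_rmodp. Qed.

Lemma coef_in_qpoly (f : {poly C}) l : (l < n)%N ->
  ((in_qpoly 'X^n f : R) : {poly C})`_l = f`_l.
Proof. by move=> ln; rewrite /= coef_rmodp. Qed.

Lemma truncP (p q : R) : (forall l, (l < n)%N -> (p : {poly C})`_l = (q : {poly C})`_l) -> p = q.
Proof.
move=> E; apply: val_inj; apply/polyP => l; have [/E //|le] := ltnP l n.
by rewrite !nth_default // (leq_trans (size_trunc _)).
Qed.

Lemma coef_qX k l : (l < n)%N -> (('qX ^+ k : R) : {poly C})`_l = (l == k)%:R.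
Proof.
move=> ln; elim: k l ln => [|k IH] l ln; first by rewrite expr0 /= coefC; case: l ln.
rewrite exprS coef_truncM // coefM.
case: l ln => [|l] ln.
  rewrite big_ord1 coef_in_qpoly // coefX mul0r //.
rewrite (bigD1 (inord 1)) //= inordK // coef_in_qpoly; last by apply: leq_ltn_trans ln.
rewrite coefX mul1r subSS subn0 IH ?(ltnW ln) // eqSS big1 ?addr0 // => i ne.
have iln : (i < n)%N by apply: leq_trans (ltn_ord i) ln.
rewrite coef_in_qpoly // coefX; case: eqP => [E|]; last by rewrite mul0r.
by case/eqP: ne; apply: val_inj; rewrite /= inordK.
Qed.

Lemma coef_qXM (p : R) l : (l < n)%N -> (('qX * p : R) : {poly C})`_l = ('X * (p : {poly C}))`_l.
Proof.
move=> ln; rewrite coef_truncM // !coefM; apply: eq_bigr => j _; congr (_ * _).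
have jn : (j < n)%N by apply: leq_ltn_trans ln; rewrite -ltnS.
by rewrite -['qX]expr1 coef_qX // coefX.
Qed.

Definition nv (v : V0 C n) : 'rV[C]_(n + n) := pr n (v.1 : {poly C}) (v.2 : {poly C}).

Lemma nv_is_linear : linear nv.
Proof.
by move=> c u v; rewrite /nv /= prD prZ.
Qed.
HB.instance Definition _ := GRing.isLinear.Build C (V0 C n) 'rV[C]_(n + n) _ nv nv_is_linear.

Lemma nv_inj : injective nv.
Proof.
move=> [p q] [p' q'] /eq_row_mx[/rowP Ep /rowP Eq]; congr pair; apply: truncP => l ln.
  by have := Ep (Ordinal ln); rewrite !mxE.
by have := Eq (Ordinal ln); rewrite !mxE.
Qed.

Definition vn (r : 'rV[C]_(n + n)) : V0 C n :=
  (in_qpoly 'X^n (rVpoly (lsubmx r)), in_qpoly 'X^n (rVpoly (rsubmx r))).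

Lemma vnK : cancel vn nv.
Proof.
move=> r; rewrite -[RHS]hsubmxK /nv /pr; congr row_mx; apply/rowP => l;
  by rewrite mxE coef_in_qpoly // coef_rVpoly_ord.
Qed.

Lemma nvK : cancel nv vn.
Proof. by move=> v; apply: nv_inj; rewrite vnK. Qed.

Lemma pr_eq_low (f g f' g' : {poly C}) : (forall l, (l < n)%N -> f`_l = f'`_l) ->
  (forall l, (l < n)%N -> g`_l = g'`_l) -> pr n f g = pr n f' g'.
Proof.
by move=> E E'; congr row_mx; apply/rowP => l; rewrite !mxE ?E ?E'.
Qed.

Definition gmx (g : 'M[R]_2) : 'M[C]_(n + n) :=
  block_mx (mulx n (g 0 0 : {poly C})) (mulx n (g 1 0 : {poly C}))
           (mulx n (g 0 1 : {poly C})) (mulx n (g 1 1 : {poly C})).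

Lemma nv_gmul g v : nv (gmul g v) = nv v *m gmx g.
Proof.
rewrite {2}/nv /pr mul_row_block !row_mulx.
have -> (f1 f2 f3 f4 : {poly C}) : row_mx (\row_(l < n) f1`_l + \row_l f2`_l)
    (\row_(l < n) f3`_l + \row_l f4`_l) = pr n (f1 + f2) (f3 + f4).
  by congr row_mx; apply/rowP => l; rewrite !mxE coefD.
by apply: pr_eq_low => l ln; rewrite !coefD !coef_truncM.
Qed.

Lemma mulx_trunc1 : mulx n ((1 : R) : {poly C}) = 1%:M.
Proof. by apply/matrixP => i l; rewrite !mxE mul1r coefXn eq_sym. Qed.

Lemma mulx_trunc0 : mulx n ((0 : R) : {poly C}) = 0.
Proof. by apply/matrixP => i l; rewrite !mxE mul0r coef0. Qed.

Lemma gmx_unip_up (p : R) : gmx (unip_up p) = 1%:M + xm (sl2_e C) (mulx n (p : {poly C})).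
Proof.
have E i j : unip_up p i j = (i == j)%:R + p * ((i == 0) && (j == 1))%:R by rewrite !mxE.
have -> : gmx (unip_up p) = block_mx (mulx n ((1 : R) : {poly C})) (mulx n ((0 : R) : {poly C}))
    (mulx n (p : {poly C})) (mulx n ((1 : R) : {poly C})).
  by rewrite /gmx !E [_ * 0%:R]mulr0 [_ * 1%:R]mulr1 ![_ + 0]addr0 [0%:R + p]add0r.
by rewrite -umxE mulx_trunc1 mulx_trunc0.
Qed.

Lemma gmx_unip_lo (p : R) : gmx (unip_lo p) = 1%:M + xm (sl2_f C) (mulx n (p : {poly C})).
Proof.
have E i j : unip_lo p i j = (i == j)%:R + p * ((i == 1) && (j == 0))%:R by rewrite !mxE.
have -> : gmx (unip_lo p) = block_mx (mulx n ((1 : R) : {poly C})) (mulx n (p : {poly C}))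
    (mulx n ((0 : R) : {poly C})) (mulx n ((1 : R) : {poly C})).
  by rewrite /gmx !E [_ * 0%:R]mulr0 [_ * 1%:R]mulr1 ![_ + 0]addr0 [0%:R + p]add0r.
rewrite mulx_trunc1 mulx_trunc0.
rewrite /xm !mxE /= !scale0r scale1r scalar_mx_block add_block_mx.
by rewrite !addr0 !add0r.
Qed.

Lemma gmulM (g h : 'M[R]_2) v : gmul (g *m h) v = gmul g (gmul h v).
Proof.
by case: v => v1 v2; rewrite /gmul /= !mulmx2E !mulrDl !mulrDr !mulrA; congr pair; rewrite addrACA.
Qed.

Lemma gmul1 v : gmul (1%:M : 'M[R]_2) v = v.
Proof. by case: v => v1 v2; rewrite /gmul /= !mxE /= !mul1r !mul0r addr0 add0r. Qed.

Lemma gmxM (g h : 'M[R]_2) : gmx (g *m h) = gmx h *m gmx g.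
Proof.
by apply/row_matrixP => i; rewrite !rowE mulmxA -[delta_mx 0 i]vnK -!nv_gmul gmulM.
Qed.

Lemma gmx1 : gmx 1%:M = 1%:M.
Proof.
by apply/row_matrixP => i; rewrite !rowE mulmx1 -[delta_mx 0 i]vnK -nv_gmul gmul1.
Qed.

End TruncCoordinates.

Section PsiGroup.
Variables (C : numFieldType) (n : nat) (a : 'I_n -> nat) (z : 'I_n -> C).
Hypothesis n_gt0 : (0 < n)%N.
Hypothesis a_incr : forall i j : 'I_n, (i < j)%N -> (a i < a j)%N.
Hypothesis a_gt0 : forall i, (0 < a i)%N.
Hypothesis z_inj : injective z.
Variable M : fusion_product a z.

Lemma group_act_det g (Tm : 'End(M)) : group_act M g Tm -> \det g = 1.
Proof.
elim=> [p|p|g1 T1 g2 T2 _ E1 _ E2].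
- have E i j : unip_up p i j = (i == j)%:R + p * ((i == 0) && (j == 1))%:R by rewrite !mxE.
  by rewrite det_mx22 !E [_ * 0%:R]mulr0 [_ * 1%:R]mulr1 ![_ + 0]addr0 mulr1 mulr0 subr0.
- exact: det_lo.
- by rewrite det_mulmx E1 E2 mulr1.
Qed.

(** Only the generators matter: there both actions are exponentials of operators intertwined by
    psi. *)
Lemma psi_group : exists f : 'Hom(M, tpow C (pos (@bdim n a)) (n + n)),
  [/\ injective f, f (fp_vac M) = vac_vec C a &
      forall g (Tm : 'End(M)) m, group_act M g Tm -> f (Tm m) = tp (gmx g) (f m)].
Proof.
have [P PE] := lfun_of_linear (@psi_is_linear C n a z a_incr a_gt0 z_inj M).
have Pinj : injective P by move=> x y; rewrite !PE; apply: (psi_inj a_incr a_gt0 z_inj).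
exists P; split=> //; first by rewrite PE psi_vac.
have tr0 (i j : 'I_2) : i != j -> \tr (delta_mx i j : 'M[C]_2) = 0.
  move=> ne; rewrite /mxtrace big1 // => l _; rewrite mxE.
  by case: eqP => // ->; rewrite (negPf ne).
have PA x (p : trunc C n) m : \tr x = 0 ->
    P (fp_actp M x p m) = dp (xm x (mulx n (p : {poly C}))) (P m).
  by move=> trx; rewrite !PE psi_actp.
move=> g Tm m H; elim: H m => {g Tm} [p|p|g1 T1 g2 T2 _ E1 _ E2] m.
- by rewrite gmx_unip_up; apply: nexp_intertwine; rewrite ?xm_e_sq // => m'; exact: PA (tr0 _ _ _).
- rewrite gmx_unip_lo; apply: nexp_intertwine => // [|m']; last exact: PA (tr0 _ _ _).
  by rewrite xmM /sl2_f mul_delta_mx_0 // xm0l.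
- by rewrite comp_lfunE E1 E2 gmxM // tpM.
Qed.

End PsiGroup.

(** * Subspaces of V_0 as row spaces *)

Section FlagCoordinates.
Variables (C : numFieldType) (n : nat).
Hypothesis n_gt0 : (0 < n)%N.
Local Notation R := (trunc C n).
Local Notation D := (\dim {:V0 C n}).

(** The coordinates in which [flag_space] takes Pluecker coordinates, as opposed to the monomial
    ones [nv]; [nc_mx] and [cn_mx] translate. *)
Definition cv (v : V0 C n) : 'rV[C]_D := \row_c coord (vbasis {:V0 C n}) c v.
Definition vc (r : 'rV[C]_D) : V0 C n := \sum_c r 0 c *: (vbasis {:V0 C n})`_c.

Lemma cv_is_linear : linear cv.
Proof. by move=> c u v; apply/rowP => j; rewrite !mxE linearP. Qed.
HB.instance Definition _ := GRing.isLinear.Build C (V0 C n) 'rV[C]_D _ cv cv_is_linear.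

Lemma cvK : cancel cv vc.
Proof.
move=> v; rewrite [RHS](coord_vbasis (memvf v)).
by apply: eq_bigr => c _; rewrite mxE.
Qed.

Lemma vcK : cancel vc cv.
Proof.
move=> r; apply/rowP => c; rewrite mxE coord_sum_free //.
exact: basis_free (vbasisP _).
Qed.

Lemma vc_is_linear : linear vc.
Proof. by move=> c u v; apply: (can_inj cvK); rewrite linearP /= !vcK. Qed.
HB.instance Definition _ := GRing.isLinear.Build C 'rV[C]_D (V0 C n) _ vc vc_is_linear.

Definition nc_mx : 'M[C]_(n + n, D) := \matrix_i cv (vn (delta_mx 0 i)).
Definition cn_mx : 'M[C]_(D, n + n) := \matrix_i nv (vc (delta_mx 0 i)).

Lemma nv_nc v : nv v *m nc_mx = cv v.
Proof.
rewrite -[in RHS](nvK n_gt0 v) -[LHS]vcK; congr cv; move: (nv v) => {v} r.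
rewrite [in RHS](row_sum_delta r) mulmx_sum_row.
have vnD c x y : vn (c *: x + y) = c *: vn x + vn y :> V0 C n.
  by apply: (nv_inj n_gt0); rewrite linearP /= !(vnK n_gt0).
have vn0 : vn 0 = 0 :> V0 C n by apply: (nv_inj n_gt0); rewrite linear0 /= (vnK n_gt0).
rewrite linear_sum /= (big_morph (@vn C n) (id1 := 0) (op1 := +%R)) //.
  apply: eq_bigr => i _; rewrite linearZ /= rowK cvK.
  by rewrite -[_ *: delta_mx 0 i]addr0 vnD vn0 addr0.
by move=> x y; rewrite -[x]scale1r vnD !scale1r.
Qed.

Lemma cv_cn v : cv v *m cn_mx = nv v.
Proof.
rewrite -[in RHS](cvK v); move: (cv v) => {v} r.
rewrite [in RHS](row_sum_delta r) mulmx_sum_row [vc _]linear_sum [RHS]linear_sum.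
apply: eq_bigr => i _; rewrite rowK.
have E : vc (r 0 i *: delta_mx 0 i) = r 0 i *: vc (delta_mx 0 i) by rewrite linearZ.
by rewrite -[RHS]/(nv (vc (r 0 i *: delta_mx 0 i))) E [RHS]linearZ.
Qed.

Lemma nc_cn : nc_mx *m cn_mx = 1%:M.
Proof.
apply/row_matrixP => i; rewrite !rowE mulmxA mulmx1 -[delta_mx 0 i](vnK n_gt0).
by rewrite nv_nc cv_cn.
Qed.

Lemma cn_nc : cn_mx *m nc_mx = 1%:M.
Proof.
apply/row_matrixP => i; rewrite !rowE mulmxA mulmx1 -[delta_mx 0 i]vcK.
by rewrite cv_cn nv_nc.
Qed.

Lemma dim_V0 : D = n.*2.
Proof.
by apply/eqP; rewrite eqn_leq -addnn (mulmx1_min nc_cn) (mulmx1_min cn_nc).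
Qed.

Definition cg (g : 'M[R]_2) : 'M[C]_D := cn_mx *m gmx g *m nc_mx.

Lemma cv_gmul g v : cv (gmul g v) = cv v *m cg g.
Proof. by rewrite -nv_nc nv_gmul // /cg !mulmxA cv_cn. Qed.

Lemma nc_cg g : nc_mx *m cg g = gmx g *m nc_mx.
Proof. by rewrite /cg !mulmxA nc_cn mul1mx. Qed.

Definition basis_mx k (U : {vspace V0 C n}) (A : 'M[C]_(k, D)) :=
  row_free A /\ forall v, (v \in U) = (cv v <= A)%MS.

Definition bmx k (B : k.-tuple (V0 C n)) : 'M[C]_(k, D) :=
  \matrix_(r, c) coord (vbasis {:V0 C n}) c (tnth B r).

Lemma mul_bmx k (B : k.-tuple (V0 C n)) (u : 'rV_k) : u *m bmx B = cv (\sum_i u 0 i *: B`_i).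
Proof.
apply/rowP => c; rewrite !mxE linear_sum; apply: eq_bigr => i _.
by rewrite mxE linearZ (tnth_nth 0).
Qed.

Lemma basis_bmx k (U : {vspace V0 C n}) (B : k.-tuple (V0 C n)) : basis_of U B ->
  basis_mx U (bmx B).
Proof.
move=> bB; split=> [|v].
  rewrite -kermx_eq0; apply/rowV0P => u /sub_kermxP; rewrite mul_bmx => E.
  have {}E : \sum_i u 0 i *: B`_i = 0 by apply: (can_inj cvK); rewrite E linear0.
  apply/rowP => i; rewrite mxE -[LHS](coord_sum_free (fun i => u 0 i) i (basis_free bB)).
  by rewrite E linear0.
apply/idP/submxP => [vU|[u]].
  by exists (\row_i coord B i v); rewrite mul_bmx [in LHS](coord_basis bB vU);
     congr cv; apply: eq_bigr => i _; rewrite mxE.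
rewrite mul_bmx => /(can_inj cvK) ->; apply: memv_suml => i _.
by rewrite memvZ // (basis_mem bB) // mem_nth // size_tuple.
Qed.

Lemma basis_mx_scale k (U : {vspace V0 C n}) (A A' : 'M[C]_(k, D)) :
  basis_mx U A -> basis_mx U A' -> exists2 G, G \in unitmx & A' = G *m A.
Proof.
have sub (B B' : 'M[C]_(k, D)) : basis_mx U B -> basis_mx U B' -> (B' <= B)%MS.
  move=> [_ UB] [_ UB']; apply/row_subP => i.
  by rewrite -[row i B']vcK -UB UB' vcK row_sub.
move=> bA bA'; have /submxP[G E] := sub _ _ bA bA'; exists G => //.
have [fA' _] := bA'; move: fA'; rewrite -row_free_unit /row_free E => /eqP rk.
by rewrite eqn_leq rank_leq_row -{1}rk mxrankM_maxl.
Qed.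

Lemma basis_mx_dim k (U : {vspace V0 C n}) : \dim U = k ->
  exists B : k.-tuple (V0 C n), basis_of U B.
Proof. by move=> <-; exists (vbasis U); exact: vbasisP. Qed.

Lemma basis_mx_gmul k (U : {vspace V0 C n}) (A : 'M[C]_(k, D)) (g : 'M[R]_2) : \det g = 1 ->
  basis_mx U A -> basis_mx (linfun (gmul g) @: U)%VS (A *m cg g).
Proof.
move=> dg [fA UA].
have cgK : cg g *m cg (\adj g) = 1%:M.
  rewrite /cg -!mulmxA (mulmxA nc_mx) nc_cn mul1mx (mulmxA (gmx g)) -gmxM //.
  by rewrite mul_adj_mx dg gmx1 // mul1mx cn_nc.
split.
  by rewrite /row_free mxrankMfree // row_free_unit; have [] := mulmx1_unit cgK.
move=> v; apply/memv_imgP/idP => [[u uU ->]|].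
  by rewrite lfunE /= cv_gmul submxMr // -UA.
move=> vA; exists (gmul (\adj g) v); last first.
  by rewrite lfunE /= -gmulM mul_mx_adj dg gmul1.
rewrite UA cv_gmul; have := submxMr (cg (\adj g)) vA.
by rewrite -mulmxA cgK mulmx1.
Qed.

End FlagCoordinates.

Section BaseFlag.
Variables (C : numFieldType) (n : nat).
Hypothesis n_gt0 : (0 < n)%N.
Local Notation R := (trunc C n).

Lemma pix_lt i : (i < n.*2)%N -> ((if (i < n)%N then n + i else n.*2.-1 - i)%N < n + n)%N.
Proof. by move=> ?; case: ifP; lia. Qed.

Lemma vrow0E i (lt : (i < n.*2)%N) : vrow n (0 : {poly C}) i = delta_mx 0 (Ordinal (pix_lt lt)).
Proof.
apply/rowP => c; rewrite /vrow mxE /= eq_sym -val_eqE /=.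
case: (split_ordP c) => l -> /=; case: ifP => il.
- by rewrite row_mxEl mxE mulr0 coef0; case: eqP => //; have := ltn_ord l; lia.
- by rewrite row_mxEl mxE coefXn eq_sym.
- by rewrite row_mxEr mxE coefXn eqn_add2l eq_sym.
- by rewrite row_mxEr mxE coef0; case: eqP => //; have := ltn_ord l; lia.
Qed.

Lemma rmx0_sub m (w : 'rV[C]_(n + n)) : (m <= n)%N ->
  (w <= rmx n (n.*2 - m) (0 : {poly C}))%MS <-> forall c : 'I_(n + n), (c < m)%N -> w 0 c = 0.
Proof.
move=> mn; split=> [/submxP[u ->] c cm|w0].
  rewrite mxE big1 // => i _; have lt : ((n.*2 - m).-1 - i < n.*2)%N by have := ltn_ord i; lia.
  rewrite mxE (vrow0E lt) mxE /= -val_eqE /=; case: eqP => [E|]; last by rewrite mulr0.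
  by exfalso; have := ltn_ord i; move: E; case: ifP; lia.
rewrite (row_sum_delta w); apply: summx_sub => c _.
have [/w0 ->|mc] := ltnP c m; first by rewrite scale0r sub0mx.
pose i := (if (n <= c)%N then c - n else n.*2.-1 - c)%N.
have i1 : (i < n.*2)%N by rewrite /i; case: ifP; have := ltn_ord c; lia.
have i2 : (i < n.*2 - m)%N by rewrite /i; case: ifP; have := ltn_ord c; lia.
rewrite (_ : c = Ordinal (pix_lt i1)); last first.
  apply: val_inj; rewrite /= /i; move: (nat_of_ord c) (ltn_ord c) => e; clear.
  by move=> en; case: (leqP n e) => ?; case: ifP; lia.
by apply: scalemx_sub; rewrite -vrow0E; apply: vrow_sub.
Qed.

Lemma rmx0_free m : (m <= n)%N -> row_free (rmx n (n.*2 - m) (0 : {poly C})).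
Proof.
move=> mn; rewrite -kermx_eq0; apply/rowV0P => u /sub_kermxP E; apply/rowP => i.
have lt (j : 'I_(n.*2 - m)) : ((n.*2 - m).-1 - j < n.*2)%N by have := ltn_ord j; lia.
have := congr1 (fun w : 'rV_(n + n) => w 0 (Ordinal (pix_lt (lt i)))) E.
rewrite !mxE (bigD1 i) //= big1 ?addr0 => [|j ne].
  by rewrite mxE (vrow0E (lt i)) mxE !eqxx mulr1.
rewrite mxE (vrow0E (lt j)) mxE /= -val_eqE /=; case: eqP => [E'|]; last by rewrite mulr0.
case/eqP: ne; apply: val_inj; move: E'; rewrite /=.
by have := ltn_ord i; have := ltn_ord j; case: ifP; case: ifP; lia.
Qed.

Lemma rmx0_basis m (U : {vspace V0 C n}) : (m <= n)%N ->
  (forall v : V0 C n, v \in U <-> forall l, (l < m)%N -> (v.1 : {poly C})`_l = 0) ->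
  basis_mx U (rmx n (n.*2 - m) 0 *m nc_mx C n).
Proof.
move=> mn UP; have ncf : row_free (nc_mx C n) by apply/row_freeP; exists (cn_mx C n); exact: nc_cn.
split=> [|v]; first by rewrite /row_free mxrankMfree //; exact: rmx0_free.
rewrite -nv_nc // submxMfree //; apply/idP/idP => [/UP vm|].
  apply/rmx0_sub => // c cm; have cn : (c < n)%N by apply: leq_trans mn.
  rewrite (_ : c = lshift n (Ordinal cn)); last exact: val_inj.
  by rewrite /nv row_mxEl mxE vm.
move/(rmx0_sub _ mn) => vm; apply/UP => l lm; have ln := leq_trans lm mn.
by have := vm (lshift n (Ordinal ln)) lm; rewrite /nv row_mxEl mxE.
Qed.

Lemma qX_eq0 k : (n <= k)%N -> 'qX ^+ k = 0 :> R.
Proof.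
move=> nk; apply: (truncP n_gt0) => l ln; rewrite coef_qX // coef0.
by case: eqP => // E; move: ln; rewrite E ltnNge nk.
Qed.

Lemma nv_minus (p : R) (l : 'I_(n + n)) : nv (v_minus p) 0 l = if (l < n)%N then (p : {poly C})`_l else 0.
Proof.
by rewrite /nv; case: (split_ordP l) => j ->; rewrite ?row_mxEl ?row_mxEr mxE ?coef0.
Qed.

Lemma nv_plus (p : R) (l : 'I_(n + n)) : nv (v_plus p) 0 l = if (l < n)%N then 0 else (p : {poly C})`_(l - n).
Proof.
rewrite /nv; case: (split_ordP l) => j ->; rewrite ?row_mxEl ?row_mxEr mxE ?coef0 //.
by rewrite /= addKn.
Qed.

Lemma V0_sum (v : V0 C n) : v =
  \sum_(k < n) (v.1 : {poly C})`_k *: v_minus ('qX ^+ k)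
  + \sum_(k < n) (v.2 : {poly C})`_k *: v_plus ('qX ^+ k).
Proof.
apply: (nv_inj n_gt0); rewrite linearD !linear_sum /=; apply/rowP => l.
rewrite [RHS]mxE !summxE.
under eq_bigr => k _ do rewrite linearZ /= mxE nv_minus.
under [X in _ = _ + X]eq_bigr => k _ do rewrite linearZ /= mxE nv_plus.
rewrite /nv; case: (split_ordP l) => j ->; rewrite ?row_mxEl ?row_mxEr mxE /=.
  rewrite [X in _ + X]big1 ?addr0 => [|k _]; last by rewrite mulr0.
  rewrite (bigD1 j) //= coef_qX // eqxx mulr1 big1 ?addr0 // => k ne.
  by rewrite coef_qX // val_eqE eq_sym (negPf ne) mulr0.
rewrite big1 ?add0r => [|k _]; last by rewrite mulr0.
rewrite addKn (bigD1 j) //= coef_qX // eqxx mulr1 big1 ?addr0 // => k ne.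
by rewrite coef_qX // val_eqE eq_sym (negPf ne) mulr0.
Qed.

Lemma mem_flag_P (i : 'I_n.+1) (v : V0 C n) :
  v \in flag_P C n i <-> forall l, (l < i)%N -> (v.1 : {poly C})`_l = 0.
Proof.
have iin : (i <= n)%N by rewrite -ltnS.
rewrite ffunE; split=> [/coord_span vE l li|v0].
  have ln : (l < n)%N by apply: leq_trans iin.
  transitivity (nv v 0 (lshift n (Ordinal ln))); first by rewrite /nv row_mxEl mxE.
  rewrite vE linear_sum summxE big1 // => j _; rewrite linearZ mxE /=.
  set X := _ ++ _; suff -> : nv X`_j 0 (lshift n (Ordinal ln)) = 0 by rewrite mulr0.
  have : X`_j \in X.
    by apply: mem_nth; rewrite size_cat !size_map !size_iota ltn_ord.
  rewrite mem_cat => /orP[] /mapP[k]; rewrite mem_iota => /andP[k1 k2] ->.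
    by rewrite nv_plus /= ln.
  rewrite nv_minus /= ln coef_qX //; case: eqP => // E.
  by move: li; rewrite E ltnNge k1.
rewrite (V0_sum v); apply: memvD; apply: memv_suml => k _.
  have [/v0 ->|ik] := ltnP k i; first by rewrite scale0r mem0v.
  apply/memvZ/memv_span; rewrite mem_cat; apply/orP; right; apply: map_f.
  by rewrite mem_iota ik subnKC // ltn_ord.
apply/memvZ/memv_span; rewrite mem_cat; apply/orP; left; apply: map_f.
by rewrite mem_iota /= ltn_ord.
Qed.

End BaseFlag.

(** * Products of matrices K(s) and the cell exp(e(p)) [P] *)

Section MatrixIdentities.
Variables (R : comUnitRingType) (X : R).

Definition mx2 (T : Type) (x00 x01 x10 x11 : T) : 'M[T]_2 :=
  \matrix_(i, j) (if i == 0 then (if j == 0 then x00 else x01)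
                  else (if j == 0 then x10 else x11)).

Lemma mx2E T (x00 x01 x10 x11 : T) : [/\ mx2 x00 x01 x10 x11 0 0 = x00,
  mx2 x00 x01 x10 x11 0 1 = x01, mx2 x00 x01 x10 x11 1 0 = x10 & mx2 x00 x01 x10 x11 1 1 = x11].
Proof. by split; rewrite mxE. Qed.

Lemma mx2_eta T (A : 'M[T]_2) : A = mx2 (A 0 0) (A 0 1) (A 1 0) (A 1 1).
Proof.
have o (k : 'I_2) : k = 0 \/ k = 1.
  by case: k => [[|[|k]] lk] //; [left|right]; apply: val_inj.
by apply/matrixP => i j; rewrite mxE; case: (o i) => ->; case: (o j) => ->.
Qed.

Lemma mx2M (a b c d a' b' c' d' : R) : mx2 a b c d *m mx2 a' b' c' d' =
  mx2 (a * a' + b * c') (a * b' + b * d') (c * a' + d * c') (c * b' + d * d').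
Proof.
have [e1 e2 e3 e4] := mx2E a b c d; have [f1 f2 f3 f4] := mx2E a' b' c' d'.
by rewrite [LHS]mx2_eta !mulmx2E e1 e2 e3 e4 f1 f2 f3 f4.
Qed.

Lemma det_mx2 (a b c d : R) : \det (mx2 a b c d) = a * d - b * c.
Proof. by have [e1 e2 e3 e4] := mx2E a b c d; rewrite det_mx22 e1 e2 e3 e4. Qed.

Lemma up_mx2 (p : R) : 1 + p *: delta_mx 0 1 = mx2 1 p 0 1.
Proof.
rewrite [LHS]mx2_eta !mxE /= ?mulr0n ?mulr1n ?mulr0 ?mulr1.
by congr mx2; ring.
Qed.

Lemma id_mx2 : 1%:M = mx2 1 0 0 (1 : R).
Proof. by rewrite [LHS]mx2_eta !mxE. Qed.

(** Here w is the lower right entry of A K(c). When it is a unit, row and column operations split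
    off a unipotent factor and leave one more power of X. *)
Lemma cell_step i (A : 'M[R]_2) (c w : R) : \det A = 1 -> w = c * A 1 0 + A 1 1 ->
  w \is a GRing.unit ->
  mx2 (X ^+ i) 0 0 1 *m (A *m mx2 X c 0 1) =
  mx2 1 (X ^+ i * ((c * A 0 0 + A 0 1) * w^-1)) 0 1
    *m (mx2 (X ^+ i.+1) 0 0 1 *m mx2 w^-1 0 (X * A 1 0) w).
Proof.
rewrite {4}(mx2_eta A) det_mx22.
move: (A 0 0) (A 0 1) (A 1 0) (A 1 1) => a b a' b' dA wE wU.
have wV : w * w^-1 = 1 by rewrite divrr.
move: (w^-1) wV => v wV; rewrite !mx2M exprS; move: (X ^+ i) => Xi.
congr mx2.
- have E : a = (1 + (c * a + b) * a') * v.
    have -> : 1 + (c * a + b) * a' = a * w by rewrite wE -dA; ring.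
    by rewrite -mulrA wV mulr1.
  by rewrite {1}E; ring.
- by ring: wV.
- by ring.
- by rewrite wE; ring.
Qed.

End MatrixIdentities.

Section Cells.
Variables (C : fieldType) (R : comUnitRingType) (iota : {rmorphism C -> R}) (X : R).
Hypothesis unit_addX : forall u y, u \is a GRing.unit -> u + X * y \is a GRing.unit.

Definition kmx (s : C) : 'M[R]_2 := mx2 X (iota s) 0 1.
Definition cmx (Q : 'M[C]_2) : 'M[R]_2 := map_mx iota Q.
Definition dmx i : 'M[R]_2 := mx2 (X ^+ i) 0 0 1.
Definition upm (x : R) : 'M[R]_2 := mx2 1 x 0 1.

(** The head of the list is the last factor, so that [drop] yields the initial products, one for
    each subspace of the flag. *)
Fixpoint hmx (qs : seq 'M[C]_2) (s : C) : 'M[R]_2 :=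
  if qs is q :: qs' then hmx qs' s *m (cmx q *m kmx s) else 1%:M.

Lemma kmxE s : kmx s = kmx 0 + iota s *: delta_mx 0 1.
Proof.
rewrite [RHS]mx2_eta /kmx !mxE /= rmorph0.
by congr mx2; ring.
Qed.

Lemma upm_dmx i (x : R) : dmx i *m upm x = upm (X ^+ i * x) *m dmx i.
Proof. by rewrite /dmx /upm !mx2M !(mul0r, mulr0, mul1r, mulr1, addr0, add0r). Qed.

Lemma upmD (x y : R) : upm x *m upm y = upm (x + y).
Proof. by rewrite /upm !mx2M !(mul0r, mulr0, mul1r, mulr1, addr0, add0r) addrC. Qed.

Lemma det_upm (x : R) : \det (upm x) = 1.
Proof. by rewrite /upm det_mx2 mulr0 mulr1 subr0. Qed.

Definition generic (qs : seq 'M[C]_2) (s : C) := all (fun q : 'M[C]_2 => s * q 1 0 + q 1 1 != 0) qs.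

(** In the application V_j of [P] is [dmx j] applied to V_0, so all the products give subspaces of
    one flag exp(e(p)) [P]. A further factor changes p by a multiple of X^i, which for j <= i is
    absorbed by g_j. The condition on the lower row of the last g makes the next w a unit. *)
Lemma hmx_cell qs s : all (fun q : 'M[C]_2 => \det q == 1) qs -> generic qs s ->
  exists p : R, forall j, (j <= size qs)%N ->
  exists g, [/\ \det g = 1, hmx (drop (size qs - j) qs) s = upm p *m (dmx j *m g) &
    j = size qs -> g 1 1 \is a GRing.unit /\ exists y, g 1 0 = X * y].
Proof.
elim: qs => [|q qs IH] /=.
  move=> _ _; exists 0 => j; rewrite leqn0 => /eqP ->; exists 1%:M; split.
  - by rewrite det1.
  - by rewrite mulmx1 /upm /dmx expr0 -!id_mx2 mulmx1.
  - by move=> _; rewrite !mxE unitr1; split=> //; exists 0; rewrite mulr0.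
case/andP=> /eqP dq dqs /andP[sq gqs]; have [p IHp] := IH dqs gqs.
have [g [dg E /(_ erefl)[gU [y gy]]]] := IHp _ (leqnn _).
rewrite subnn drop0 in E; set i := size qs in IHp E *.
pose A := g *m cmx q; pose w := iota s * A 1 0 + A 1 1.
have dA : \det A = 1 by rewrite det_mulmx dg mul1r /cmx det_map_mx dq rmorph1.
have wU : w \is a GRing.unit.
  have -> : w = g 1 1 * iota (s * q 1 0 + q 1 1) + X * (y * iota (s * q 0 0 + q 0 1)).
    have qE i1 i2 : cmx q i1 i2 = iota (q i1 i2) by rewrite mxE.
    by rewrite /w /A !mulmx2E !qE gy !rmorphD !rmorphM; ring.
  by apply: unit_addX; rewrite unitrM gU rmorph_unit ?unitfE.
pose e : R := (iota s * A 0 0 + A 0 1) * w^-1; pose p1 := p + X ^+ i * e.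
have step : hmx (q :: qs) s = upm p1 *m (dmx i.+1 *m mx2 w^-1 0 (X * A 1 0) w).
  have S : dmx i *m (A *m kmx s) =
      upm (X ^+ i * e) *m (dmx i.+1 *m mx2 w^-1 0 (X * A 1 0) w).
    by apply: cell_step.
  by rewrite /= E -!mulmxA (mulmxA g) -/A S mulmxA upmD.
exists p1 => j; rewrite leq_eqVlt => /orP[/eqP ->|jn].
  exists (mx2 w^-1 0 (X * A 1 0) w); have [_ _ g3 g4] := mx2E w^-1 0 (X * A 1 0) w.
  rewrite subnn drop0; split=> // [|_].
    by rewrite det_mx2 mulVr // mul0r subr0.
  by rewrite g3 g4; split=> //; exists (A 1 0).
have [gj [dgj Ej _]] := IHp j jn; exists (upm (- (X ^+ (i - j) * e)) *m gj); split.
- by rewrite det_mulmx det_upm dgj mul1r.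
- rewrite subSn //= Ej !mulmxA; congr (_ *m gj).
  rewrite -mulmxA upm_dmx mulmxA upmD; congr (upm _ *m _).
  rewrite /p1; have -> : X ^+ i = X ^+ j * X ^+ (i - j) by rewrite -exprD subnKC.
  by ring.
- by move=> E'; move: jn; rewrite E' ltnn.
Qed.

End Cells.

Section FlagCells.
Variables (C : numFieldType) (n : nat).
Hypothesis n_gt0 : (0 < n)%N.
Local Notation R := (trunc C n).
Local Notation D := (\dim {:V0 C n}).

Lemma qX_nunit : ('qX : R) \isn't a GRing.unit.
Proof.
by apply/negP => U; have := unitrX n U; rewrite qX_eq0 ?leqnn // unitr0.
Qed.

Lemma unit_addqX (u y : R) : u \is a GRing.unit -> u + 'qX * y \is a GRing.unit.
Proof.
move=> U; apply: (@trunc_unitVunit C n 'qX (u + 'qX * y) (- (y * u^-1)) (- u^-1)); last exact: qX_nunit.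
have uV : u * u^-1 = 1 by rewrite divrr.
by move: (u^-1) uV => v uV; rewrite mulrN mulrN opprK mulrDl uV addrCA mulrA addNr addr0.
Qed.

Lemma unip_upE (p : R) : unip_up p = upm p.
Proof. exact: (@up_mx2 R p). Qed.

Local Notation hm := (@hmx C R (in_alg R) 'qX).

Lemma cg_linear (g g' : 'M[R]_2) (s : C) : cg (g + s%:A *: g') = cg g + s *: cg g'.
Proof.
apply/row_matrixP => i; rewrite linearD linearZ /= !rowE -[delta_mx 0 i]vcK -!cv_gmul //.
rewrite -linearZ -linearD; congr cv; rewrite /gmul !mxE; congr pair => /=;
  by rewrite !mulrDl -!scalerAl !mul1r scalerDr addrACA.
Qed.

Lemma cgM (g h : 'M[R]_2) : cg (g *m h) = cg h *m cg g.
Proof. by rewrite {2}/cg -mulmxA nc_cg // mulmxA -(mulmxA (cn_mx C n)) -gmxM. Qed.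

Lemma hmx_poly (qs : seq 'M[C]_2) : exists H : 'M[{poly C}]_D,
  forall s, cg (hm qs s) = map_mx (horner_eval s) H.
Proof.
elim: qs => [|q qs [H HE]] /=.
  exists 1%:M => s; rewrite map_mx1 /cg gmx1 // mulmx1; exact: cn_nc.
pose K0 := cg (cmx (in_alg R) q *m kmx (in_alg R) 'qX 0).
pose K1 := cg (cmx (in_alg R) q *m (delta_mx 0 1 : 'M[R]_2)).
exists ((map_mx polyC K0 + 'X *: map_mx polyC K1) *m H) => s.
rewrite cgM map_mxM /= -HE kmxE mulmxDr -scalemxAr cg_linear; congr (_ *m _).
by apply/matrixP => i j; rewrite !mxE /horner_eval !hornerE.
Qed.

End FlagCells.

(** * Factorization of a flag and its deformation into the cell *)

Section FlagFactor.
Variables (C : numFieldType) (n : nat).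
Hypothesis n_gt0 : (0 < n)%N.
Local Notation R := (trunc C n).
Local Notation D := (\dim {:V0 C n}).
Local Notation hm := (@hmx C R (in_alg R) 'qX).
Local Notation cm := (@cmx C R (in_alg R)).
Local Notation km := (@kmx C R (in_alg R) 'qX).

Definition e_minus : V0 C n := v_minus 1.
Definition e_plus : V0 C n := v_plus 1.

Lemma trunc_const (p : R) : exists c r, p = c%:A + 'qX * r.
Proof.
exists (p : {poly C})`_0, (in_qpoly 'X^n (\poly_(l < n) (p : {poly C})`_l.+1)).
apply: (truncP n_gt0) => l ln.
rewrite coefD coefZ coef_qXM //.
rewrite coefXM; case: l ln => [|l] ln /=; first by rewrite coefC mulr1 addr0.
by rewrite coefC mulr0 add0r (coef_in_qpoly n_gt0) ?(ltnW ln) // coef_poly ltnW.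
Qed.

Lemma V0_const (v : V0 C n) : exists c d v', v = c *: e_minus + d *: e_plus + tmul v'.
Proof.
case: v => p q; have [c [r pE]] := trunc_const p; have [d [r' qE]] := trunc_const q.
exists c, d, (r, r'); rewrite pE qE; congr pair => /=.
  by rewrite scaler0 addr0.
by rewrite scaler0 add0r.
Qed.

Lemma gmul_tmul (g : 'M[R]_2) v : gmul g (tmul v) = tmul (gmul g v).
Proof. by congr pair => /=; rewrite mulrDr; congr (_ + _); rewrite mulrCA. Qed.

Lemma gmul_km (u : V0 C n) : gmul (km 0) u = ('qX * u.1, u.2).
Proof.
have [k1 k2 k3 k4] := mx2E ('qX : R) (in_alg R 0) 0 1.
rewrite /gmul /kmx k1 k2 k3 k4; congr pair; last by rewrite mul0r mul1r add0r.
by rewrite rmorph0 mul0r addr0.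
Qed.

Lemma sl2_column (x y : C) : (x != 0) || (y != 0) ->
  exists q : 'M[C]_2, [/\ \det q = 1, q 0 1 = x & q 1 1 = y].
Proof.
have [->/= y0|x0 _] := eqVneq x 0.
  exists (mx2 y^-1 0 0 y); have [_ q1 _ q2] := mx2E y^-1 0 0 y.
  by rewrite det_mx2 mulVf // mulr0 subr0.
exists (mx2 0 x (- x^-1) y); have [_ q1 _ q2] := mx2E 0 x (- x^-1) y.
by rewrite det_mx2 mul0r mulrN divff // sub0r opprK.
Qed.

(* V_(i+1) / t V_i is a line in the plane V_i / t V_i, which is spanned by the *)
(* images of e_- and e_+.                                                      *)
Lemma flag_step (V W : {vspace V0 C n}) (h : 'M[R]_2) : (W <= V)%VS -> \dim V = (\dim W).+1 ->
  (forall v, v \in V -> tmul v \in W) -> (forall v, v \in V <-> exists u, v = gmul h u) ->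
  exists2 q : 'M[C]_2, \det q = 1 &
    forall v, v \in W <-> exists u, v = gmul (h *m (cm q *m km 0)) u.
Proof.
move=> WV dV tV Vh; have hV u : gmul h u \in V by apply/Vh; exists u.
(* A combination of the images of e_- and e_+ that lies in W. Its coefficients become the second
   column of q, so that h q takes e_+ into W. *)
have [x [y [xy0 xyW]]] : exists x y, (x != 0) || (y != 0) /\
    x *: gmul h e_minus + y *: gmul h e_plus \in W.
  have [aW|aW] := boolP (gmul h e_minus \in W).
    by exists 1, 0; rewrite oner_neq0 scale0r addr0 scale1r.
  have VE : (W + <[gmul h e_minus]>)%VS = V.
    apply/eqP; rewrite eqEdim subv_add WV -memvE hV /= dV ltnNge; apply/negP => le.
    case/negP: aW; have /eqP -> : W == (W + <[gmul h e_minus]>)%VS by rewrite eqEdim addvSl.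
    by rewrite memvE addvSr.
  have := hV e_plus; rewrite -VE => /memv_addP[w wW [_ /vlineP[c ->] E]].
  exists (- c), 1; rewrite oner_neq0 orbT; split=> //.
  by rewrite scale1r E addrCA scaleNr addNr addr0.
have [q [dq qx qy]] := sl2_column xy0; exists q => //; pose G := h *m cm q.
have dcq : \det (cm q) = 1 by rewrite /cmx det_map_mx dq rmorph1.
have VG v : v \in V <-> exists u, v = gmul G u.
  split=> [/Vh[u ->]|[u ->]]; last by rewrite gmulM.
  by exists (gmul (\adj (cm q)) u); rewrite -gmulM -mulmxA mul_mx_adj dcq mulmx1.
have GV u : gmul G u \in V by apply/VG; exists u.
have GD c d v : gmul G (c *: e_minus + d *: e_plus + tmul v) =
    c *: gmul G e_minus + d *: gmul G e_plus + tmul (gmul G v).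
  by rewrite linearD linearD linearZ linearZ /= gmul_tmul.
have BW : gmul G e_plus \in W.
  rewrite gmulM; suff -> : gmul (cm q) e_plus = x *: e_minus + y *: e_plus.
    by rewrite linearD linearZ linearZ.
  rewrite /gmul /e_plus /e_minus /v_plus /v_minus /cmx !mxE qx qy; congr pair => /=.
    by rewrite mulr0 mulr1 add0r scaler0 addr0.
  by rewrite mulr0 mulr1 add0r scaler0 add0r.
have AW : gmul G e_minus \notin W.
  apply/negP => AW; suff : (V <= W)%VS by move/dimvS; rewrite dV ltnn.
  apply/subvP => v /VG[u ->]; have [c [d [v' ->]]] := V0_const u.
  by rewrite GD !memvD ?memvZ ?tV.
move=> v; rewrite mulmxA -/G; split=> [vW|[u ->]].
  have /VG[u uE] := subvP WV _ vW; have [c [d [v' u'E]]] := V0_const u.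
  have c0 : c = 0.
    apply/eqP; apply: contraNT AW => c0.
    have : c *: gmul G e_minus \in W.
      move: vW; rewrite uE u'E GD -addrA => vW.
      have := memvB vW (memvD (memvZ d BW) (tV _ (GV v'))).
      by rewrite addrK.
    by move/(memvZ c^-1); rewrite scalerA mulVf // scale1r.
  exists (v'.1, d%:A + 'qX * v'.2); rewrite gmulM gmul_km uE u'E c0; congr gmul.
  by congr pair => /=; rewrite ?scale0r ?scaler0 ?add0r.
rewrite gmulM gmul_km; have [d [r ->]] := trunc_const u.2.
have -> : ('qX * u.1, d%:A + 'qX * r) = 0 *: e_minus + d *: e_plus + tmul (u.1, r) :> V0 C n.
  by congr pair => /=; rewrite ?scale0r ?scaler0 ?add0r.
by rewrite GD scale0r add0r memvD ?memvZ ?tV.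
Qed.

Lemma flag_factor (V : flag C n) : is_flag V ->
  exists qs : seq 'M[C]_2, [/\ size qs = n, all (fun q : 'M[C]_2 => \det q == 1) qs &
    forall j, (j <= n)%N -> forall v, v \in V (inord j) <->
      exists u, v = gmul (hm (drop (n - j) qs) 0) u].
Proof.
case=> V0f Vs; suff H i : (i <= n)%N -> exists qs : seq 'M[C]_2,
    [/\ size qs = i, all (fun q : 'M[C]_2 => \det q == 1) qs &
    forall j, (j <= i)%N -> forall v, v \in V (inord j) <->
      exists u, v = gmul (hm (drop (i - j) qs) 0) u] by exact: H.
elim: i => [|i IH] lt.
  exists [::]; split=> // j; rewrite leqn0 => /eqP -> v.
  rewrite (_ : inord 0 = ord0) ?V0f ?memvf; last by apply: val_inj; rewrite /= inordK.
  by split=> // _; exists v; rewrite /= gmul1.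
have [qs [sz dqs E]] := IH (ltnW lt); have [WV dV tV] := Vs i lt.
have := E i (leqnn i); rewrite subnn drop0 => Ei.
have [q dq Eq] := flag_step WV dV tV Ei.
exists (q :: qs); split=> /=; [by rewrite sz | by rewrite dq eqxx |].
move=> j; rewrite leq_eqVlt => /orP[/eqP -> v|ji v]; first by rewrite subnn drop0 Eq.
by rewrite subSn //= E.
Qed.

(** The family comes from replacing every K(0) in [flag_factor] by K(s); the roots of b are the
    values of s that are not [generic]. *)
Lemma flag_cell_family (K : nat) (m : 'I_K -> nat) (V : flag C n)
    (A : forall r : 'I_K, 'M[C]_(n.*2 - m r, D)) :
  is_flag V -> (forall r, (m r <= n)%N) ->
  (forall r, basis_mx (V (inord (m r))) (A r)) ->
  exists (F : forall r, 'M[{poly C}]_(n.*2 - m r, D)) (b : {poly C}),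
  [/\ b != 0, forall r, map_mx (horner_eval 0) (F r) = A r &
    forall s, b.[s] != 0 -> exists (p : R) (G : forall r, 'M[C]_(n.*2 - m r)), forall r,
      map_mx (horner_eval s) (F r)
      = G r *m (rmx n (n.*2 - m r) (0 : {poly C}) *m nc_mx C n *m cg (unip_up p))].
Proof.
move=> flV mn bA; have [qs [sz dqs Vh]] := flag_factor flV.
have [H HE] := fin_all_exists (fun r => hmx_poly n_gt0 (drop (n - m r) qs)).
have AX r : exists X : 'M[C]_(n.*2 - m r, D), A r = X *m cg (hm (drop (n - m r) qs) 0).
  apply/submxP/row_subP => i; have [_ bAr] := bA r.
  have : vc (row i (A r)) \in V (inord (m r)) by rewrite bAr vcK row_sub.
  case/(Vh _ (mn r)) => u uE; rewrite -[row i _]vcK uE cv_gmul //.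
  exact: submxMl.
have [X XE] := fin_all_exists AX.
exists (fun r => map_mx polyC (X r) *m H r), (\prod_(q <- qs) (q 1 0 *: 'X + (q 1 1)%:P)); split.
- rewrite prodf_seq_neq0; apply/allP => q /(allP dqs) /eqP dq /=; apply/negP => /eqP q0.
  have q1 : q 1 0 = 0.
    by have := congr1 (fun f : {poly C} => f`_1) q0; rewrite coefD coefZ coefX coefC coef0 mulr1 addr0.
  have q2 : q 1 1 = 0.
    by have := congr1 (fun f : {poly C} => f`_0) q0; rewrite coefD coefZ coefX coefC coef0 mulr0 add0r.
  by move/eqP: dq; rewrite det_mx22 q1 q2 !mulr0 subr0 eq_sym oner_eq0.
- move=> r; rewrite map_mxM /= -HE XE; congr (_ *m _).
  by apply/matrixP => i j; rewrite !mxE /horner_eval hornerC.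
move=> s; rewrite horner_prod prodf_seq_neq0 => gen.
have {}gen : generic qs s.
  by apply/allP => q /(allP gen); rewrite /= hornerD hornerZ hornerX hornerC mulrC.
have [p cell] := hmx_cell (in_alg R) (unit_addqX n_gt0) dqs gen.
have GE r : exists G : 'M[C]_(n.*2 - m r), map_mx (horner_eval s) (map_mx polyC (X r) *m H r)
      = G *m (rmx n (n.*2 - m r) (0 : {poly C}) *m nc_mx C n *m cg (unip_up p)).
  apply/submxP; rewrite map_mxM /= -HE.
  have -> : map_mx (horner_eval s) (map_mx polyC (X r)) = X r.
    by apply/matrixP => i j; rewrite !mxE /horner_eval hornerC.
  apply/row_subP => i; rewrite row_mul -[row i _]vcK -cv_gmul //.
  have [g [_ E _]] := cell _ (eq_ind_r (fun k => (m r <= k)%N) (mn r) sz).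
  rewrite sz in E; rewrite E gmulM cv_gmul // -unip_upE; apply: submxMr.
  rewrite gmulM; move: (gmul g _) => u.
  rewrite -nv_nc //; apply: submxMr; apply/rmx0_sub => // c cm.
  have cn : (c < n)%N by apply: leq_trans (mn r).
  rewrite (_ : c = lshift n (Ordinal cn)); last exact: val_inj.
  have [d1 d2 _ _] := mx2E (('qX : R) ^+ m r) 0 0 1.
  have uE : (gmul (dmx ('qX : R) (m r)) u).1 = 'qX ^+ m r * u.1.
    by rewrite -[LHS]/(dmx _ _ 0 0 * u.1 + dmx _ _ 0 1 * u.2) d1 d2 mul0r addr0.
  rewrite /nv row_mxEl mxE uE coef_truncM // coefM big1 // => j _.
  rewrite coef_qX //; last by apply: leq_ltn_trans (cn); rewrite -ltnS.
  case: eqP => [E'|]; last by rewrite mul0r.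
  by move: (ltn_ord j); rewrite E' ltnS leqNgt cm.
by have [G GP] := fin_all_exists GE; exists p, G.
Qed.

End FlagFactor.

(** * The isomorphism *)

Section MultihomogeneousForms.
Variables (C : fieldType) (P : mproj C).
Implicit Types (p q : Defs.form P) (d : mp_blk P -> nat).

Definition cform (j : mp_crd P) : Defs.form P := 'X_(enum_rank j).

Lemma form_eval_cform j x : form_eval (cform j) x = x j.
Proof. by rewrite /form_eval mevalXU enum_rankK. Qed.

Lemma form_evalD p q x : form_eval (p + q) x = form_eval p x + form_eval q x.
Proof. exact: mevalD. Qed.

Lemma form_evalM p q x : form_eval (p * q) x = form_eval p x * form_eval q x.
Proof. exact: mevalM. Qed.

Lemma form_evalC c x : form_eval (c%:MP : Defs.form P) x = c.
Proof. exact: mevalC. Qed.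

Lemma form_eval_sum (I : finType) (F : I -> Defs.form P) x :
  form_eval (\sum_i F i) x = \sum_i form_eval (F i) x.
Proof. exact: raddf_sum. Qed.

Lemma form_eval_prod (I : finType) (F : I -> Defs.form P) x :
  form_eval (\prod_i F i) x = \prod_i form_eval (F i) x.
Proof. exact: rmorph_prod. Qed.

Lemma mhom0 d : multihomog d (0 : Defs.form P).
Proof. by move=> m; rewrite msupp0. Qed.

Lemma mhomC c : multihomog (fun=> 0%N) (c%:MP : Defs.form P).
Proof.
move=> m; rewrite msuppC; case: ifP => // _; rewrite inE => /eqP -> i.
by rewrite big1 // => k _; rewrite mnm0E.
Qed.

Lemma mhom1 : multihomog (fun=> 0%N) (1 : Defs.form P).
Proof. by have := @mhomC 1; rewrite mpolyC1. Qed.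

Lemma mhom_cform j : multihomog (fun i => (mp_blkof j == i) : nat) (cform j).
Proof.
move=> m; rewrite msuppX inE => /eqP -> i.
have [E|ne] := eqVneq (mp_blkof j) i.
  rewrite (bigD1 (enum_rank j)) /= ?enum_rankK ?E // mnm1E eqxx big1 // => k /andP[_ ne].
  by rewrite mnm1E eq_sym (negPf ne).
rewrite big1 // => k /eqP ki; rewrite mnm1E; case: eqP => // E.
by case/eqP: ne; rewrite -ki -E enum_rankK.
Qed.

Lemma mhomD d p q : multihomog d p -> multihomog d q -> multihomog d (p + q).
Proof. by move=> dp dq m /msuppD_le; rewrite mem_cat => /orP[/dp|/dq]. Qed.

Lemma mhom_sum (I : finType) d (F : I -> Defs.form P) :
  (forall i, multihomog d (F i)) -> multihomog d (\sum_i F i).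
Proof. by move=> dF; apply: big_ind => [|p q|i _]; [exact: mhom0 | exact: mhomD | exact: dF]. Qed.

Lemma mhomM d d' p q : multihomog d p -> multihomog d' q ->
  multihomog (fun i => d i + d' i)%N (p * q).
Proof.
move=> dp dq m /msuppM_le /allpairsP[[m1 m2] /= [/dp E1 /dq E2 ->]] i.
by rewrite -E1 -E2 -big_split; apply: eq_bigr => k _; rewrite mnmDE.
Qed.

Lemma eq_mhom d d' p : d =1 d' -> multihomog d p -> multihomog d' p.
Proof. by move=> E dp m /dp H i; rewrite H. Qed.

Lemma mhom_prod (I : finType) (d : I -> mp_blk P -> nat) (F : I -> Defs.form P) :
  (forall i, multihomog (d i) (F i)) -> multihomog (fun b => \sum_i d i b)%N (\prod_i F i).
Proof.
move=> dF; suff H (s : seq I) : multihomog (fun b => \sum_(i <- s) d i b)%N (\prod_(i <- s) F i).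
  by apply: eq_mhom (H (index_enum I)) => b.
elim: s => [|i s IH]; first by rewrite big_nil; apply: (eq_mhom _ mhom1) => b; rewrite big_nil.
rewrite big_cons; apply: (eq_mhom _ (mhomM (dF i) IH)) => b; by rewrite big_cons.
Qed.

End MultihomogeneousForms.

(** * Recovering a matrix from its minors *)

Section NormalizedMultivectors.
Variables (C : numFieldType) (K : nat) (k : 'I_K -> nat) (D : nat).
Implicit Types (S : {ffun pos k -> 'I_D}).

Definition set_at S (q : pos k) (c : 'I_D) : {ffun pos k -> 'I_D} :=
  [ffun q' => if q' == q then c else S q'].

(** Changing one column of an identity submatrix leaves a single entry as determinant. *)
Lemma mvec_normal (B : forall r, 'M[C]_(k r, D)) S q c :
  (forall r, colsub (slot S r) (B r) = 1%:M) -> mvec B (set_at S q c) = B (tag q) (tagged q) c.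
Proof.
case: q => r j B1; set q : pos k := existT _ r j; rewrite ffunE (bigD1 r) //=.
rewrite big1 ?mulr1 => [|r' ne]; last first.
  rewrite (_ : slot (set_at S q c) r' = slot S r') ?B1 ?det1 //.
  apply/ffunP => i; rewrite !ffunE; case: eqP => // /(congr1 tag) /= E.
  by rewrite E eqxx in ne.
have E i l : colsub (slot (set_at S q c) r) (B r) i l = if l == j then B r i c else (i == l)%:R.
  rewrite mxE !ffunE /mkpos eq_Tagged /= -[_ == _]/(l == j); case: ifP => // _.
  by have /matrixP/(_ i l) := B1 r; rewrite !mxE !ffunE.
rewrite (expand_det_col _ j) (bigD1 j) //= big1 ?addr0 => [|i ne].
  rewrite E eqxx /cofactor -signr_odd oddD addbb expr0 mul1r.
  rewrite (_ : row' j _ = 1%:M) ?det1 ?mulr1 //; apply/matrixP => x y.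
  by rewrite mxE [LHS]mxE E [RHS]mxE eq_sym (negPf (neq_lift _ _)) (inj_eq lift_inj).
rewrite /cofactor; case: (unliftP i j) => [i'|] ji; last by rewrite ji eqxx in ne.
rewrite (expand_det_row _ i') big1 ?mulr0 // => y _.
by rewrite mxE [X in X * _]mxE -ji E eq_sym !(negPf (neq_lift _ _)) mul0r.
Qed.

Lemma row_free_minor m (A : 'M[C]_(m, D)) : row_free A ->
  exists s : {ffun 'I_m -> 'I_D}, \det (colsub s A) != 0.
Proof.
move=> fA; have fAT : row_full A^T by rewrite /row_full mxrank_tr.
exists [ffun i => fullrankfun fAT i]; rewrite -unitfE -[_ \is a _]/(_ \in unitmx).
rewrite -unitmx_tr.
have -> : (colsub [ffun i => fullrankfun fAT i] A)^T = rowsub (fullrankfun fAT) A^T.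
  by apply/matrixP => i j; rewrite !mxE ffunE.
exact: fullrowsub_unit.
Qed.

Lemma mvec_neq0 (A : forall r, 'M[C]_(k r, D)) : (forall r, row_free (A r)) ->
  exists S, mvec A S != 0.
Proof.
move=> fA; have [s sP] := fin_all_exists (fun r => row_free_minor (fA r)).
by exists (unslot s); rewrite ffunE; apply/prodf_neq0 => r _; rewrite slotK.
Qed.

(** An identity submatrix reads off the coefficients of a combination of rows, which turns inclusion
    of row spaces into an equation. *)
Lemma sub_normal m m' (W : 'M[C]_(m', D)) (B : 'M[C]_(m, D)) (s : 'I_m -> 'I_D) :
  colsub s B = 1%:M -> (W <= B)%MS = (W == colsub s W *m B).
Proof.
move=> B1; apply/submxP/eqP => [[X ->]|->]; last by exists (colsub s W).
congr (_ *m _); rewrite -[LHS]mulmx1 -B1; apply/matrixP => i j; rewrite !mxE.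
by apply: eq_bigr => l _; rewrite !mxE.
Qed.

Lemma normal_row_free m (B : 'M[C]_(m, D)) (s : 'I_m -> 'I_D) :
  colsub s B = 1%:M -> row_free B.
Proof.
move=> B1; rewrite -kermx_eq0; apply/rowV0P => u /sub_kermxP E.
by rewrite -[u]mulmx1 -B1 mulmx_colsub E; apply/matrixP => i j; rewrite !mxE.
Qed.

End NormalizedMultivectors.

Section Goodness.
Variables (C : numFieldType) (n : nat).
Hypothesis n_gt0 : (0 < n)%N.
Local Notation R := (trunc C n).
Local Notation D := (\dim {:V0 C n}).

(* The incidence conditions that cut out F_n, without the dimensions. *)
Definition nested (V : flag C n) :=
  [/\ V ord0 = fullv, forall i i' : 'I_n.+1, (i <= i')%N -> (V i' <= V i)%VS &
      forall i i' : 'I_n.+1, i' = i.+1 :> nat -> forall v, v \in V i -> tmul v \in V i'].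

Lemma tmul_gmul (v : V0 C n) : tmul v = gmul ('qX)%:M v.
Proof.
by rewrite /gmul /tmul !mxE /= !mulr1n !mulr0n !mul0r addr0 add0r.
Qed.

Lemma nested_P : nested (flag_P C n).
Proof.
split=> [|i i' le|i i' E v].
- by apply/eqP; rewrite eqEsubv subvf /=; apply/subvP => v _; apply/(mem_flag_P n_gt0).
- apply/subvP => v /(mem_flag_P n_gt0) v0; apply/(mem_flag_P n_gt0) => l li.
  by apply: v0; apply: leq_trans le.
move/(mem_flag_P n_gt0) => v0; apply/(mem_flag_P n_gt0) => l li.
have ln : (l < n)%N by apply: leq_trans li _; rewrite -ltnS.
rewrite coef_qXM // coefXM; case: l li ln => //= l; rewrite E ltnS => li _.
exact: v0.
Qed.

Lemma nested_act g (V : flag C n) : \det g = 1 -> nested V -> nested (flag_act g V).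
Proof.
move=> dg [V0f Vi Vt]; split=> [|i i' le|i i' E v].
- apply/eqP; rewrite ffunE V0f eqEsubv subvf /=; apply/subvP => v _.
  apply/memv_imgP; exists (gmul (\adj g) v); first exact: memvf.
  by rewrite lfunE /= -gmulM mul_mx_adj dg gmul1.
- by rewrite !ffunE; apply/limgS/Vi.
rewrite !ffunE => /memv_imgP[u uV ->]; rewrite lfunE /= -gmul_tmul.
by apply/memv_imgP; exists (tmul u); [exact: Vt uV | rewrite lfunE].
Qed.

Lemma is_flag_dim (V : flag C n) : is_flag V -> forall i : 'I_n.+1, \dim (V i) = (n.*2 - i)%N.
Proof.
case=> V0f Vs i; rewrite -[i in LHS]inord_val; have := leq_ord i; move: {i}(nat_of_ord i) => i.
elim: i => [|i IH] lt.
  by rewrite subn0 -(dim_V0 C n_gt0) -V0f; congr (\dim (V _)); apply: val_inj; rewrite /= inordK.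
have [_ dV _] := Vs i lt; move: (IH (ltnW lt)); rewrite dV => E; lia.
Qed.

Lemma flag_bases (V : flag C n) (i : 'I_n.+1) : \dim (V i) = (n.*2 - i)%N ->
  exists A : 'M[C]_(n.*2 - i, D), basis_mx (V i) A.
Proof. by case/basis_mx_dim => B bB; exists (bmx B); apply: basis_bmx. Qed.

Lemma basis_mx_dimE k (U : {vspace V0 C n}) (A : 'M[C]_(k, D)) : basis_mx U A -> \dim U = k.
Proof.
move=> bA; have bB := basis_bmx (vbasisP U); have [fA UA] := bA; have [fB UB] := bB.
have sub k1 k2 (A1 : 'M[C]_(k1, D)) (A2 : 'M[C]_(k2, D)) :
    basis_mx U A1 -> basis_mx U A2 -> (A1 <= A2)%MS.
  move=> [_ U1] [_ U2]; apply/row_subP => i.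
  by rewrite -[row i A1]vcK -U2 U1 vcK row_sub.
apply/eqP; rewrite eqn_leq -(eqP fA) -(eqP fB).
by rewrite !mxrankS // sub.
Qed.

Lemma span_rows k (B : 'M[C]_(k, D)) :
  exists U : {vspace V0 C n}, forall v, (v \in U) = (cv v <= B)%MS.
Proof.
have lin : linear (fun u : 'rV[C]_k => vc (u *m B) : V0 C n).
  by move=> c u v; apply: (can_inj (@cvK C n)); rewrite vcK mulmxDl -scalemxAl linearP /= !vcK.
have [L LE] := lfun_of_linear lin; exists (limg L) => v.
apply/memv_imgP/submxP => [[u _ ->]|[u E]]; first by exists u; rewrite LE vcK.
by exists u; [exact: memvf | rewrite LE -E cvK].
Qed.

End Goodness.

Section Density.
Variables (C : numFieldType) (n K : nat) (ir : 'I_K -> 'I_n.+1).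
Hypothesis n_gt0 : (0 < n)%N.
Local Notation R := (trunc C n).
Local Notation D := (\dim {:V0 C n}).
Local Notation k := (fun r => (n.*2 - ir r)%N).
Local Notation T := (tpow C (pos k) D).

Definition bases_of (V : flag C n) (A : forall r, 'M[C]_(k r, D)) :=
  forall r, basis_mx (V (ir r)) (A r).

Definition base_mx r : 'M[C]_(k r, D) := rmx n (k r) 0 *m nc_mx C n.

Lemma bases_of_P : bases_of (flag_P C n) base_mx.
Proof.
move=> r; apply: rmx0_basis => // [|v]; [exact: leq_ord | exact: mem_flag_P].
Qed.

Lemma bases_of_act g (V : flag C n) A : \det g = 1 -> bases_of V A ->
  bases_of (flag_act g V) (fun r => A r *m cg g).
Proof. by move=> dg bA r; rewrite ffunE; apply: basis_mx_gmul. Qed.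

Lemma bases_of_scale (V : flag C n) A A' : bases_of V A -> bases_of V A' ->
  exists2 c, c != 0 & mvec A' = c *: mvec A.
Proof.
move=> bA bA'; have H r : exists G : 'M[C]_(k r), G \in unitmx /\ A' r = G *m A r.
  by have [G] := basis_mx_scale (bA r) (bA' r); exists G.
have [G GP] := fin_all_exists H; exists (\prod_r \det (G r)).
  by apply/prodf_neq0 => r _; rewrite -unitfE; case: (GP r).
by rewrite -mvec_mull; apply: eq_mvec => r; case: (GP r).
Qed.

Lemma bases_of_exists (V : flag C n) : (forall i : 'I_n.+1, \dim (V i) = (n.*2 - i)%N) ->
  exists A, bases_of V A.
Proof.
move=> dV; have H r : exists A : 'M[C]_(k r, D), basis_mx (V (ir r)) A by apply: flag_bases.
by have [A AP] := fin_all_exists H; exists A.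
Qed.

Lemma tpow_sum (Y : T) : Y = \sum_S Y S *: [ffun S' => (S' == S)%:R].
Proof.
apply/ffunP => S; rewrite sum_ffunE (bigD1 S) //= !ffunE eqxx big1 ?addr0 => [|S' ne].
  by rewrite -[RHS]/(_ * 1) mulr1.
by rewrite !ffunE eq_sym (negPf ne) -[LHS]/(_ * 0) mulr0.
Qed.

(* A polynomial condition that holds along exp(e(p)) [P] holds on every flag:  *)
(* every flag is a limit of points of the cell.                                *)
Lemma cell_dense (V : flag C n) A N (q : {mpoly C[N]}) (L : 'I_N -> 'Hom(T, C^o)) :
  is_flag V -> bases_of V A ->
  (forall (p : R) c, c != 0 -> q.@[fun i => L i (c *: tp (cg (unip_up p)) (mvec base_mx))] = 0) ->
  q.@[fun i => L i (mvec A)] = 0.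
Proof.
move=> flV bA q0.
have [F [b [b0 FA Fcell]]] : exists (F : forall r, 'M[{poly C}]_(k r, D)) (b : {poly C}),
  [/\ b != 0, forall r, map_mx (horner_eval 0) (F r) = A r &
    forall s, b.[s] != 0 -> exists (p : R) (G : forall r, 'M[C]_(k r)), forall r,
      map_mx (horner_eval s) (F r) = G r *m (base_mx r *m cg (unip_up p))].
  apply: flag_cell_family flV _ _ => // r; first exact: leq_ord.
  by rewrite inord_val; apply: bA.
pose W (S : {ffun pos k -> 'I_D}) : {poly C} := \prod_r \det (colsub (slot S r) (F r)).
have WE s S : mvec (fun r => map_mx (horner_eval s) (F r)) S = (W S).[s].
  rewrite ffunE horner_prod; apply: eq_bigr => r _.
  by rewrite -map_mxsub det_map_mx.
pose Lp i : {poly C} := \sum_S L i [ffun S' => (S' == S)%:R] *: W S.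
have LpE s i : L i (mvec (fun r => map_mx (horner_eval s) (F r))) = (Lp i).[s].
  rewrite [X in L i X]tpow_sum linear_sum horner_sum; apply: eq_bigr => S _.
  by rewrite linearZ WE hornerZ /= mulrC.
pose Q : {poly C} := \sum_(m <- msupp q) q@_m *: \prod_i Lp i ^+ m i.
have QE s : q.@[fun i => L i (mvec (fun r => map_mx (horner_eval s) (F r)))] = Q.[s].
  rewrite mevalE horner_sum; apply: eq_bigr => m _; rewrite hornerZ horner_prod.
  by congr (_ * _); apply: eq_bigr => i _; rewrite horner_exp LpE.
have AE : mvec A = mvec (fun r => map_mx (horner_eval 0) (F r)).
  by apply: eq_mvec => r; rewrite FA.
have [S1 S1P] := mvec_neq0 (fun r => proj1 (bA r)).
have W0 : W S1 != 0.
  by apply: contraNneq S1P => W0; rewrite AE WE W0 horner0.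
suff Q0 : Q = 0 by rewrite AE QE Q0 horner0.
(* The factor b discards the s outside the cell, and [W S1] those where the vector may vanish, so
   that the scalar c in [q0] is nonzero. *)
suff /eqP : b * W S1 * Q = 0 by rewrite !mulf_eq0 (negPf b0) (negPf W0) => /eqP.
apply: poly_horner_eq0 => s; rewrite !hornerM.
have [->|bs] := eqVneq b.[s] 0; first by rewrite !mul0r.
have [->|Ws] := eqVneq (W S1).[s] 0; first by rewrite mulr0 mul0r.
have [p [G GE]] := Fcell s bs.
have cE : mvec (fun r => map_mx (horner_eval s) (F r)) =
    (\prod_r \det (G r)) *: tp (cg (unip_up p)) (mvec base_mx).
  by rewrite tp_mvec -mvec_mull; apply: eq_mvec => r; rewrite GE.
rewrite -QE cE q0 ?mulr0 //; apply: contraNneq Ws => c0.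
by rewrite -WE cE c0 scale0r ffunE.
Qed.

End Density.

Section Lines.
Variables (C : numFieldType) (M : vectType C).

Lemma line_scale c (v : M) : c != 0 -> <[c *: v]>%VS = <[v]>%VS.
Proof.
move=> c0; apply/eqP; rewrite eqEsubv -!memvE memvZ ?memv_line //=.
by rewrite -[v in v \in _](scalerK c0) memvZ // memv_line.
Qed.

Lemma line_eq (u v : M) : u != 0 -> <[u]>%VS = <[v]>%VS -> exists2 c, c != 0 & v = c *: u.
Proof.
move=> u0 E; have : v \in <[u]>%VS by rewrite E memv_line.
case/vlineP=> c vE; exists c => //; apply: contraNneq u0 => c0.
have : u \in <[v]>%VS by rewrite -E memv_line.
by case/vlineP=> d ->; rewrite vE c0 scale0r scaler0.
Qed.

Definition cmb (x : 'I_(\dim {:M}) -> C) : M := \sum_k x k *: (vbasis {:M})`_k.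

Lemma coord_cmb x k : coord (vbasis {:M}) k (cmb x) = x k.
Proof. by rewrite coord_sum_free // (basis_free (vbasisP _)). Qed.

Lemma cmb_coord v : cmb (fun k => coord (vbasis {:M}) k v) = v.
Proof. by rewrite [RHS](coord_vbasis (memvf v)). Qed.

End Lines.

(** * Equations of flags in ratios of coordinates *)

Section NormalizedBases.
Variables (C : numFieldType) (n K : nat) (ir : 'I_K -> 'I_n.+1).
Hypothesis n_gt0 : (0 < n)%N.
Local Notation R := (trunc C n).
Local Notation D := (\dim {:V0 C n}).
Local Notation k := (fun r => (n.*2 - ir r)%N).
Local Notation T := (tpow C (pos k) D).
Implicit Types (Y : T) (S : {ffun pos k -> 'I_D}).

(* For Y proportional to mvec B with the columns S_r of B_r forming identity   *)
(* matrices, the entries of B are recovered from Y.                            *)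
Definition bof Y S (r : 'I_K) : 'M[C]_(k r, D) :=
  \matrix_(j, c) (Y (set_at S (@mkpos K k r j) c) / Y S).

Local Notation ct := (cg (('qX : R)%:M)).

(** In order: normalization, decomposability of Y, nesting of the subspaces, t V_i in V_(i+1), and t
    V_0 in V_1, inclusions being written as in [sub_normal]. V_0 has no block, hence the separate
    last clause. *)
Definition flag_ids S Y := [/\
  forall r, colsub (slot S r) (bof Y S r) = 1%:M,
  Y = Y S *: mvec (bof Y S),
  forall r r', (ir r <= ir r')%N -> bof Y S r' = colsub (slot S r) (bof Y S r') *m bof Y S r,
  forall r r', ir r' = (ir r).+1 :> nat ->
    bof Y S r *m ct = colsub (slot S r') (bof Y S r *m ct) *m bof Y S r' &
  forall r, ir r = 1%N :> nat -> ct = colsub (slot S r) ct *m bof Y S r].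

Lemma bof_mvec (V : flag C n) (A : forall r : 'I_K, 'M[C]_(k r, D)) c Y S :
  bases_of V A -> Y = c *: mvec A -> Y S != 0 ->
  [/\ bases_of V (bof Y S), forall r, colsub (slot S r) (bof Y S r) = 1%:M &
      Y = Y S *: mvec (bof Y S)].
Proof.
move=> bA YE YS; pose G r := colsub (slot S r) (A r).
have GU r : G r \in unitmx.
  rewrite unitmxE unitfE; apply: contraNneq YS => G0.
  by rewrite YE ffunE ffunE (bigD1 r) //= -/(G r) G0 mul0r scaler0.
pose B r : 'M[C]_(k r, D) := invmx (G r) *m A r.
have B1 r : colsub (slot S r) (B r) = 1%:M.
  by rewrite /B -mulmx_colsub mulVmx.
have YB : Y = (c * \prod_r \det (G r)) *: mvec B.
  rewrite -scalerA -mvec_mull YE; congr (_ *: _); apply: eq_mvec => r.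
  by rewrite /B mulKVmx.
have YSE : Y S = c * \prod_r \det (G r).
  have BS : mvec B S = 1 by rewrite ffunE big1 // => r _; rewrite B1 det1.
  by rewrite {1}YB ffunE BS -[LHS]/(_ * 1) mulr1.
have BE r : bof Y S r = B r.
  apply/matrixP => j d; rewrite mxE.
  have -> : Y (set_at S (mkpos j) d) = Y S * mvec B (set_at S (mkpos j) d) by rewrite {1}YB ffunE YSE.
  by rewrite mvec_normal // mulrAC divff // mul1r.
split=> [r|r|]; rewrite ?BE //; last first.
  by rewrite {1}YB -YSE; congr (_ *: _); apply: eq_mvec => r; rewrite BE.
have [fA UA] := bA r; split=> [|v].
  by rewrite /row_free /B mxrankMfree // mxrank_unit ?unitmx_inv.
rewrite UA; have uG : row_full (invmx (G r)) by rewrite row_full_unit unitmx_inv.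
by rewrite /B (eqmxMfull _ uG).
Qed.

Lemma nested_ids (V : flag C n) (A : forall r : 'I_K, 'M[C]_(k r, D)) c Y S :
  nested V -> bases_of V A -> Y = c *: mvec A -> Y S != 0 -> flag_ids S Y.
Proof.
move=> [V0f Vi Vt] bA YE YS; have [bB B1 YB] := bof_mvec bA YE YS.
have rowsV r i : vc (row i (bof Y S r)) \in V (ir r).
  by have [_ ->] := bB r; rewrite vcK row_sub.
split=> // [r r' le|r r' E|r E]; apply/eqP; rewrite -(sub_normal _ (B1 _)); apply/row_subP => i.
- rewrite -[row i _]vcK; have [_ <-] := bB r.
  exact: (subvP (Vi _ _ le)).
- rewrite row_mul -[row i (bof _ _ _)]vcK -cv_gmul // -tmul_gmul; have [_ <-] := bB r'.
  by apply: (Vt (ir r)) => //; apply: rowsV.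
- rewrite rowE -[delta_mx 0 i]vcK -cv_gmul // -tmul_gmul; have [_ <-] := bB r.
  by apply: (Vt ord0) => //; rewrite V0f memvf.
Qed.

(** The identity submatrices give the dimensions; blocks of equal index define the same subspace by
    the nesting identity used in both directions. *)
Lemma ids_flag Y S : (forall r, 0 < ir r)%N -> (forall i : 'I_n.+1, (0 < i)%N -> exists r, ir r = i) ->
  flag_ids S Y -> exists2 V : flag C n, is_flag V & bases_of V (bof Y S).
Proof.
move=> ir_gt0 ir_surj [B1 _ I3 I4 I5].
have [U UB] := fin_all_exists (fun r => span_rows (bof Y S r)).
pose V : flag C n := [ffun i => if [pick r | ir r == i] is Some r then U r else fullv].
have VU r v : (v \in V (ir r)) = (cv v <= bof Y S r)%MS.
  rewrite ffunE; case: pickP => [r' /eqP E|/(_ r)]; last by rewrite eqxx.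
  by rewrite UB; apply/idP/idP => H; apply: submx_trans H _; rewrite (sub_normal _ (B1 _)); apply/eqP/I3;
    rewrite E.
have bB : bases_of V (bof Y S).
  move=> r; split=> [|v]; last exact: VU.
  exact: normal_row_free (B1 r).
have V0f : V ord0 = fullv.
  by rewrite ffunE; case: pickP => // r /eqP E; have := ir_gt0 r; rewrite E.
exists V => //; split=> // i lt.
have lt1 : (i.+1 < n.+1)%N by []; have lt0 : (i < n.+1)%N by apply: ltnW.
have [r' E'] : exists r', ir r' = inord i.+1 by apply: ir_surj; rewrite inordK.
have rE' : ir r' = i.+1 :> nat by rewrite E' inordK.
have dim' : \dim (V (inord i.+1)) = (n.*2 - i.+1)%N.
  by rewrite -E' (basis_mx_dimE (bB r')) rE'.
have [i0|i_gt0] := posnP i.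
  have -> : inord i = ord0 :> 'I_n.+1 by apply: val_inj; rewrite /= inordK.
  rewrite V0f dim_V0 // dim'; split=> [||v _]; [exact: subvf | lia |].
  rewrite -E' VU tmul_gmul cv_gmul //.
  rewrite (I5 r') ?mulmxA ?submxMl // rE' i0 //.
have [r E] : exists r, ir r = inord i by apply: ir_surj; rewrite inordK.
have rE : ir r = i :> nat by rewrite E inordK.
rewrite dim' -{1 2 3}E -E' (basis_mx_dimE (bB r)) rE; split=> [||v]; last first.
- rewrite !VU tmul_gmul cv_gmul // => /submxP[u ->].
  by rewrite -mulmxA (I4 r r') ?rE ?rE' // mulmxA submxMl.
- lia.
- apply/subvP => v; rewrite !VU => H; apply: submx_trans H _.
  by rewrite (sub_normal _ (B1 _)); apply/eqP/I3; rewrite rE rE'.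
Qed.

End NormalizedBases.

(** * The map from flags to lines, its inverse, and regularity of both *)

Section Embedding.
Variables (C : numFieldType) (n K : nat) (ir : 'I_K -> 'I_n.+1).
Hypothesis n_gt0 : (0 < n)%N.
Hypothesis ir_gt0 : forall r, (0 < ir r)%N.
Hypothesis ir_surj : forall i : 'I_n.+1, (0 < i)%N -> exists r, ir r = i.
Local Notation R := (trunc C n).
Local Notation D := (\dim {:V0 C n}).
Local Notation k := (fun r => (n.*2 - ir r)%N).
Local Notation T := (tpow C (pos k) D).
Local Notation mats := (forall r : 'I_K, 'M[C]_(k r, D)).
Implicit Types (Y : T) (S : {ffun pos k -> 'I_D}).

Variables (M : vectType C) (Psi : 'Hom(M, T)) (vac : M) (act : 'M[R]_2 -> 'End(M) -> Prop).
Hypothesis Psi_inj : injective Psi.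
Hypothesis act_det : forall g Tm, act g Tm -> \det g = 1.
Hypothesis act_up : forall p, exists Tm, act (unip_up p) Tm.
Hypothesis Psi_vac : Psi vac = mvec (base_mx C ir).
Hypothesis Psi_act : forall g Tm m, act g Tm -> Psi (Tm m) = tp (cg g) (Psi m).

Definition orbit (l : {vspace M}) := exists g Tm, act g Tm /\ l = <[Tm vac]>%VS.
Definition orbit_closure : {vspace M} -> Prop := @zariski_closure C (proj_space M) orbit.
Local Notation Sch := orbit_closure.
Local Notation Theta := (Psi^-1)%VF.

Lemma ThetaK m : Theta (Psi m) = m.
Proof. by apply: lker0_lfunK; apply/lker0P. Qed.

Lemma Psi_coord m : m != 0 -> exists S, Psi m S != 0.
Proof.
move=> m0; apply: NNPP => nS; case/eqP: m0; apply: Psi_inj; rewrite linear0; apply/ffunP => S.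
by rewrite [RHS]ffunE; apply/eqP; apply: contraT => nz; case: nS; exists S.
Qed.

Lemma orbit_bases g Tm : act g Tm -> exists V (A : mats),
  [/\ nested V, bases_of V A & Psi (Tm vac) = mvec A].
Proof.
move=> H; have dg := act_det H; exists (flag_act g (flag_P C n)), (fun r => base_mx C ir r *m cg g).
split.
- by apply: nested_act => //; apply: nested_P.
- by apply: bases_of_act => //; apply: bases_of_P.
by rewrite (Psi_act _ H) Psi_vac tp_mvec.
Qed.

Lemma bases_neq0 (V : flag C n) (A : mats) : bases_of V A -> mvec A != 0.
Proof.
move=> bA; have [S] := mvec_neq0 (fun r => proj1 (bA r)).
by apply: contraNneq => ->; rewrite ffunE.
Qed.

Lemma orbit_neq0 g Tm : act g Tm -> Tm vac != 0.
Proof.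
case/orbit_bases=> V [A [_ bA E]]; apply: contraNneq (bases_neq0 bA) => T0.
by rewrite -E T0 linear0.
Qed.

(** A function of the ratios Y S' / Y S on the chart where Y S is nonzero, which multiplied by the
    d-th power of Y S becomes a form of degree d on P(M). *)
Definition rfun_deg S d (Phi : T -> C) := exists p : Defs.form (proj_space M),
  multihomog (fun=> d) p /\ forall x, Psi (cmb x) S != 0 ->
    form_eval p x = Psi (cmb x) S ^+ d * Phi (Psi (cmb x)).

Definition rfun S Phi := exists d, rfun_deg S d Phi.

Definition lform S : Defs.form (proj_space M) :=
  \sum_(j < \dim {:M}) (Psi (vbasis {:M})`_j S)%:MP * @cform C (proj_space M) j.

Lemma lform_eval S x : form_eval (lform S) x = Psi (cmb x) S.
Proof.
rewrite form_eval_sum /cmb linear_sum sum_ffunE; apply: eq_bigr => j _.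
by rewrite form_evalM form_evalC form_eval_cform linearZ ffunE mulrC.
Qed.

Lemma mhom_lform S : multihomog (fun=> 1%N) (lform S).
Proof.
apply: mhom_sum => j; apply: (eq_mhom _ (mhomM (@mhomC _ _ _) (@mhom_cform C (proj_space M) j))).
by case.
Qed.

Lemma rfunC S c : rfun S (fun=> c).
Proof.
exists 0%N, c%:MP; split; first exact: mhomC.
by move=> x _; rewrite form_evalC mul1r.
Qed.

Lemma rfun_ratio S S' : rfun S (fun Y => Y S' / Y S).
Proof.
exists 1%N, (lform S'); split=> [|x x0]; first exact: mhom_lform.
by rewrite lform_eval mulrCA divff ?mulr1.
Qed.

Lemma rfunM S Phi Phi' : rfun S Phi -> rfun S Phi' -> rfun S (fun Y => Phi Y * Phi' Y).
Proof.
move=> [d [p [dp pE]]] [d' [p' [dp' pE']]]; exists (d + d')%N, (p * p'); split=> [|x x0].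
  exact: mhomM.
by rewrite form_evalM pE // pE' // exprD mulrACA.
Qed.

Lemma rfun_lift S Phi d e : rfun_deg S d Phi -> rfun_deg S (d + e) Phi.
Proof.
move=> [p [dp pE]]; elim: e => [|e [q [dq qE]]]; first by exists p; rewrite addn0.
exists (q * lform S); split=> [|x x0].
  by apply: (eq_mhom _ (mhomM dq (@mhom_lform S))) => b; rewrite addn1 addnS.
by rewrite form_evalM lform_eval qE // addnS exprSr mulrAC.
Qed.

Lemma rfunD S Phi Phi' : rfun S Phi -> rfun S Phi' -> rfun S (fun Y => Phi Y + Phi' Y).
Proof.
move=> [d H] [d' H']; have [p [dp pE]] := rfun_lift d' H; have [p' [dp' pE']] := rfun_lift d H'.
exists (d + d')%N, (p + p'); split=> [|x x0]; first by apply: mhomD => //; rewrite addnC.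
by rewrite form_evalD pE // pE' // [(d' + d)%N]addnC mulrDr.
Qed.

Lemma eq_rfun S Phi Phi' : Phi =1 Phi' -> rfun S Phi -> rfun S Phi'.
Proof. by move=> E [d [p [dp pE]]]; exists d, p; split=> // x x0; rewrite -E pE. Qed.

Lemma rfun_sum (I : finType) S (Phi : I -> T -> C) : (forall i, rfun S (Phi i)) ->
  rfun S (fun Y => \sum_i Phi i Y).
Proof.
move=> H; elim: (index_enum I) => [|i s IH].
  by apply: eq_rfun (rfunC S 0) => Y; rewrite big_nil.
by apply: eq_rfun (rfunD (H i) IH) => Y; rewrite big_cons.
Qed.

Lemma rfun_prod (I : finType) S (Phi : I -> T -> C) : (forall i, rfun S (Phi i)) ->
  rfun S (fun Y => \prod_i Phi i Y).
Proof.
move=> H; elim: (index_enum I) => [|i s IH].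
  by apply: eq_rfun (rfunC S 1) => Y; rewrite big_nil.
by apply: eq_rfun (rfunM (H i) IH) => Y; rewrite big_cons.
Qed.

(* Equations between functions of the ratios Y S' / Y S extend from the orbit  *)
(* to its closure.                                                             *)
Lemma rfun_closure S Phi l x : rfun S Phi -> Sch l -> @mp_hc C (proj_space M) l x ->
  Psi (cmb x) S != 0 ->
  (forall g Tm c, act g Tm -> (c *: Psi (Tm vac)) S != 0 -> Phi (c *: Psi (Tm vac)) = 0) ->
  Phi (Psi (cmb x)) = 0.
Proof.
move=> [d [p [dp pE]]] [_ cl] hx xS Phi0.
(* The extra factor [lform S] makes the form vanish also at the points of the orbit outside the
   chart. *)
have := cl _ _ (mhomM dp (@mhom_lform S)) _ x hx; rewrite form_evalM lform_eval pE // => H.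
have {}H : Psi (cmb x) S ^+ d * Phi (Psi (cmb x)) * Psi (cmb x) S = 0.
  apply: H => v y [g [Tm [gT ->]]] [y0 lE]; rewrite form_evalM lform_eval.
  have [->|yS] := eqVneq (Psi (cmb y) S) 0; first by rewrite mulr0.
  rewrite pE //; have [c c0 E] := line_eq (orbit_neq0 gT) lE.
  have PE : Psi (cmb y) = c *: Psi (Tm vac) by rewrite -linearZ; congr (Psi _).
  by rewrite PE (Phi0 _ _ _ gT) -?PE // mulr0 mul0r.
by move/eqP: H; rewrite !mulf_eq0 expf_eq0 (negPf xS) andbF orbF => /eqP.
Qed.

Definition mfun S a b (B : T -> 'M[C]_(a, b)) := forall i j, rfun S (fun Y => B Y i j).

Lemma mfun_closure S a b (B B' : T -> 'M[C]_(a, b)) l x : mfun S B -> mfun S B' ->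
  Sch l -> @mp_hc C (proj_space M) l x -> Psi (cmb x) S != 0 ->
  (forall Y, Y S != 0 -> flag_ids S Y -> B Y = B' Y) -> B (Psi (cmb x)) = B' (Psi (cmb x)).
Proof.
move=> fB fB' cl hx xS BB'; apply/matrixP => i j; apply/eqP; rewrite -subr_eq0; apply/eqP.
have fd : rfun S (fun Y => B Y i j - B' Y i j).
  by apply: eq_rfun (rfunD (fB i j) (rfunM (rfunC S (-1)) (fB' i j))) => Y; rewrite mulN1r.
apply: (rfun_closure fd cl hx xS) => g Tm c gT YS.
have [V [A [nV bA E]]] := orbit_bases gT.
rewrite BB' ?subrr //; apply: (nested_ids n_gt0 nV bA _ YS).
by rewrite E.
Qed.

Lemma mfun_const S a b (A : 'M[C]_(a, b)) : mfun S (fun=> A).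
Proof. by move=> i j; apply: rfunC. Qed.

Lemma mfun_bof S r : mfun S (fun Y => bof Y S r).
Proof.
move=> i j; apply: eq_rfun (rfun_ratio S (set_at S (mkpos i) j)) => Y.
by rewrite mxE.
Qed.

Lemma mfun_colsub S a b b' (s : 'I_b' -> 'I_b) (B : T -> 'M[C]_(a, b)) : mfun S B ->
  mfun S (fun Y => colsub s (B Y)).
Proof. by move=> fB i j; apply: eq_rfun (fB i (s j)) => Y; rewrite mxE. Qed.

Lemma mfunM S a b c (A : T -> 'M[C]_(a, b)) (B : T -> 'M[C]_(b, c)) : mfun S A -> mfun S B ->
  mfun S (fun Y => A Y *m B Y).
Proof.
move=> fA fB i j; apply: eq_rfun (rfun_sum (fun l => rfunM (fA i l) (fB l j))) => Y.
by rewrite mxE.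
Qed.

Lemma rfun_det S a (A : T -> 'M[C]_a) : mfun S A -> rfun S (fun Y => \det (A Y)).
Proof.
move=> fA; apply: (rfun_sum (Phi := fun (s : 'S_a) Y => (-1) ^+ s * \prod_i A Y i (s i))) => s.
by apply: rfunM; [exact: rfunC | apply: rfun_prod].
Qed.

Arguments mfun_bof S r : clear implicits.
Arguments mfun_const S {a b} A.
Arguments mfun_colsub {S a b b'} s {B} fB.

(** Each identity equates functions of the ratios and holds on the orbit by [nested_ids], so
    [mfun_closure] applies. *)
Lemma closure_ids S l x : Sch l -> @mp_hc C (proj_space M) l x -> Psi (cmb x) S != 0 ->
  flag_ids S (Psi (cmb x)).
Proof.
move=> cl hx xS; split=> [r||r r' le|r r' E|r E].
- have := mfun_closure (mfun_colsub (slot S r) (mfun_bof S r)) (mfun_const S 1%:M) cl hx xS.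
  by apply=> Y _ [].
- apply/ffunP => S'; rewrite ffunE.
  have f1 : mfun S (fun Y => (Y S' / Y S)%:M : 'M_1).
    by move=> i j; apply: eq_rfun (rfun_ratio S S') => Y; rewrite !ord1 mxE.
  have f2 : mfun S (fun Y => (mvec (bof Y S) S')%:M : 'M_1).
    move=> i j; have H r := rfun_det (mfun_colsub (slot S' r) (mfun_bof S r)).
    by apply: eq_rfun (rfun_prod H) => Y; rewrite !ord1 mxE ffunE.
  suff E : (Psi (cmb x) S' / Psi (cmb x) S)%:M =
      (mvec (bof (Psi (cmb x)) S) S')%:M :> 'M_1.
    move/matrixP/(_ 0 0): E; rewrite [LHS]mxE [RHS]mxE !mulr1n => <-.
    by rewrite -[RHS]/(_ * _) mulrC divfK.
  have := mfun_closure f1 f2 cl hx xS; apply=> Y Y0 [_ YE _ _ _].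
  congr _%:M; rewrite {1}YE [X in X / _]ffunE.
  by rewrite -[X in X / _]/(_ * _) mulrAC divff // mul1r.
- have := mfun_closure (mfun_bof S r')
    (mfunM (mfun_colsub (slot S r) (mfun_bof S r')) (mfun_bof S r)) cl hx xS.
  by apply=> Y _ [_ _ I3 _ _]; apply: I3.
- have fc := mfunM (mfun_bof S r) (mfun_const S (cg (('qX : R)%:M))).
  have := mfun_closure fc (mfunM (mfun_colsub (slot S r') fc) (mfun_bof S r')) cl hx xS.
  by apply=> Y _ [_ _ _ I4 _]; apply: I4.
- have fc := mfun_const S (cg (('qX : R)%:M)).
  have := mfun_closure fc (mfunM (mfun_colsub (slot S r) fc) (mfun_bof S r)) cl hx xS.
  by apply=> Y _ [_ _ _ _ I5]; apply: I5.
Qed.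

Lemma closure_flag l : Sch l -> exists V (A : mats),
  [/\ is_flag V, bases_of V A & l = <[Theta (mvec A)]>%VS].
Proof.
move=> cl; have [[x hx] _] := cl; have [x0 lE] := hx.
have [S xS] := Psi_coord x0.
have ids := closure_ids cl hx xS.
have [V flV bV] := ids_flag n_gt0 ir_gt0 ir_surj ids; exists V, (bof (Psi (cmb x)) S); split=> //.
have [_ E _ _ _] := ids; have E2 : cmb x = Psi (cmb x) S *: Theta (mvec (bof (Psi (cmb x)) S)).
  by rewrite -[LHS]ThetaK {1}E linearZ.
by rewrite lE -[LHS]/(<[cmb x]>%VS) {1}E2 line_scale.
Qed.

Lemma cell_dense_fun (V : flag C n) (A : mats) N
    (q : {mpoly C[N]}) (L : 'I_N -> T -> C^o) :
  is_flag V -> bases_of V A -> (forall i, linear (L i)) ->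
  (forall g Tm c, act g Tm -> c != 0 -> q.@[fun i => L i (c *: Psi (Tm vac))] = 0) ->
  q.@[fun i => L i (mvec A)] = 0.
Proof.
move=> flV bA linL q0; have H i := lfun_of_linear (linL i).
rewrite -(@meval_eq _ _ (fun i => sval (H i) (mvec A))) => [|i]; last by rewrite (svalP (H i)).
apply: cell_dense n_gt0 _ _ _ _ (fun i => sval (H i)) flV bA _ => p c c0.
have [Tm up] := act_up p; rewrite -[RHS](q0 _ _ c up c0); apply: meval_eq => i.
by rewrite (svalP (H i)) (Psi_act _ up) Psi_vac.
Qed.

(** Lying in the image of Psi is a linear condition; it holds on the cell, hence for every flag by
    density. *)
Lemma flag_im (V : flag C n) (A : mats) : is_flag V -> bases_of V A ->
  Psi (Theta (mvec A)) = mvec A.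
Proof.
move=> flV bA; apply/ffunP => S; apply/eqP; rewrite -subr_eq0; apply/eqP.
pose L (i : 'I_1) (Y : T) : C^o := Psi (Theta Y) S - Y S.
have -> : Psi (Theta (mvec A)) S - mvec A S = ('X_0 : {mpoly C[1]}).@[fun i => L i (mvec A)].
  by rewrite mevalXU.
apply: cell_dense_fun flV bA _ _ => [i c Y Y'|g Tm c _ _].
  rewrite /L !linearP !ffunE scalerBr opprD.
  by rewrite -[c *: Y S]/(c * _) addrACA.
by rewrite mevalXU /L -linearZ ThetaK subrr.
Qed.

Lemma Theta_neq0 (V : flag C n) (A : mats) : is_flag V -> bases_of V A ->
  Theta (mvec A) != 0.
Proof.
move=> flV bA; apply: contraNneq (bases_neq0 bA) => E.
by rewrite -(flag_im flV bA) E linear0.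
Qed.

(** Another choice of bases rescales the tensor ([bases_of_scale]), so the line does not depend on
    the one made by [epsilon]. *)
Definition phi (V : flag C n) : {vspace M} :=
  <[Theta (mvec (epsilon (inhabits (fun r => 0%R)) (fun A : mats =>
     bases_of V A)))]>%VS.

Lemma phiE (V : flag C n) (A : mats) : bases_of V A ->
  phi V = <[Theta (mvec A)]>%VS.
Proof.
move=> bA; rewrite /phi; set A' := epsilon _ _.
have bA' : bases_of V A'.
  by apply: (epsilon_spec (inhabits (fun r => 0)) (fun A : mats =>
     bases_of V A)); exists A.
by have [c c0 ->] := bases_of_scale bA bA'; rewrite linearZ line_scale.
Qed.

Lemma flag_has_bases (V : flag C n) : is_flag V ->
  exists A : mats, bases_of V A.
Proof. by move=> flV; apply/bases_of_exists/is_flag_dim. Qed.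

(** A form vanishing on the orbit is a polynomial condition on [mvec A], to which density
    applies. *)
Lemma phi_closure (V : flag C n) : is_flag V -> Sch (phi V).
Proof.
move=> flV; have [A bA] := flag_has_bases flV; rewrite (phiE bA).
have t0 := Theta_neq0 flV bA; split.
  exists (fun j => coord (vbasis {:M}) j (Theta (mvec A))).
  by rewrite /= -/(cmb _) cmb_coord.
move=> d p dp p0 x [x0 E]; have [c c0 xE] := line_eq t0 E.
pose L (i : 'I_#|mp_crd (proj_space M)|) (Y : T) : C^o :=
  c * coord (vbasis {:M}) (enum_val i) (Theta Y).
have -> : form_eval p x = p.@[fun i => L i (mvec A)].
  apply: meval_eq => i; rewrite -(coord_cmb x) /L.
  by rewrite -[cmb x]/(\sum_j x j *: (vbasis {:M})`_j) xE linearZ.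
apply: cell_dense_fun flV bA _ _ => [i b Y Y'|g Tm b gT b0].
  by rewrite /L !linearP mulrDr mulrCA.
rewrite -(p0 <[Tm vac]>%VS (fun j => coord (vbasis {:M}) j ((c * b) *: Tm vac))).
- apply: meval_eq => i; rewrite /L !linearZ /= ThetaK; exact: mulrA.
- by exists g, Tm.
rewrite /= -/(cmb _) cmb_coord scaler_eq0 !mulf_eq0 (negPf c0) (negPf b0) (negPf (orbit_neq0 gT)).
by rewrite line_scale // mulf_neq0.
Qed.

Lemma phi_surj l : Sch l -> exists2 V, is_flag V & phi V = l.
Proof.
by move=> /closure_flag[V [A [flV bA ->]]]; exists V => //; apply: phiE.
Qed.

(** Proportional tensors have the same normalized bases [bof], and every V_i with i > 0 has a
    block. *)
Lemma phi_inj (V V' : flag C n) : is_flag V -> is_flag V' -> phi V = phi V' -> V = V'.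
Proof.
move=> flV flV'; have [A bA] := flag_has_bases flV; have [A' bA'] := flag_has_bases flV'.
rewrite (phiE bA) (phiE bA') => /(line_eq (Theta_neq0 flV bA))[c c0 E].
have {}E : mvec A' = c *: mvec A by rewrite -(flag_im flV bA) -(flag_im flV' bA') E linearZ.
have [S S0] := mvec_neq0 (fun r => proj1 (bA' r)).
have [b1 _ _] := bof_mvec bA E S0.
have [b2 _ _] := bof_mvec bA' (esym (scale1r _)) S0.
apply/ffunP => i; have [i0|/ir_surj[r <-]] := posnP i.
  have -> : i = ord0 by apply: val_inj.
  by case: flV => -> _; case: flV' => -> _.
by apply/vspaceP => v; have [_ ->] := b1 r; have [_ ->] := b2 r.
Qed.

Lemma phi_act g Tm (V : flag C n) : act g Tm -> is_flag V -> phi (flag_act g V) = (Tm @: phi V)%VS.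
Proof.
move=> gT flV; have [A bA] := flag_has_bases flV.
rewrite (phiE bA) (phiE (bases_of_act n_gt0 (act_det gT) bA)) limg_line -tp_mvec.
by rewrite -(flag_im flV bA) -(Psi_act _ gT) !ThetaK.
Qed.

Lemma phi_P : phi (flag_P C n) = <[vac]>%VS.
Proof. by rewrite (phiE (bases_of_P C ir n_gt0)) -Psi_vac ThetaK. Qed.

Definition pidx : Type := {i : 'I_n.+1 & {ffun 'I_(n.*2 - i) -> 'I_D}}.
Definition prow (j : pidx) : 'I_n.+1 := tag j.
Definition pcol (j : pidx) : {ffun 'I_(n.*2 - prow j) -> 'I_D} := tagged j.

Lemma pluecker_bases (V : flag C n) x : @mp_hc _ (flag_space C n) V x ->
  exists A : forall i : 'I_n.+1, 'M[C]_(n.*2 - i, D), (forall i, basis_mx (V i) (A i)) /\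
    forall j : mp_crd (flag_space C n), x j = \det (colsub (pcol j) (A (prow j))).
Proof.
move=> hx; have H (i : 'I_n.+1) : exists A : 'M[C]_(n.*2 - i, D), basis_mx (V i) A /\
    forall S : {ffun 'I_(n.*2 - i) -> 'I_D},
      x (Tagged (fun i : 'I_n.+1 => {ffun 'I_(n.*2 - i) -> 'I_D}) S) = \det (colsub S A).
  have [B bB xB] := hx i; exists (bmx B); split=> [|S]; first exact: basis_bmx.
  by rewrite xB; congr (\det _); apply/matrixP => r c; rewrite !mxE.
have [A AP] := fin_all_exists H; exists A; split=> [i|[i S]]; first by case: (AP i).
by case: (AP i) => _ /(_ S).
Qed.

Lemma pluecker_exists (V : flag C n) : is_flag V -> exists x, @mp_hc _ (flag_space C n) V x.
Proof.
move=> flV; have H (i : 'I_n.+1) := basis_mx_dim (is_flag_dim n_gt0 flV i).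
have [B bB] := fin_all_exists H.
exists (fun j => \det (\matrix_(r, c) coord (vbasis {:V0 C n}) (pcol j c) (tnth (B (prow j)) r))).
by move=> i; exists (B i).
Qed.

Definition crd r S : mp_crd (flag_space C n) :=
  Tagged (fun i : 'I_n.+1 => {ffun 'I_(n.*2 - i) -> 'I_D}) (slot S r : {ffun 'I_(n.*2 - ir r) -> 'I_D}).

(** The tensor is a product of Pluecker coordinates with one factor for each block and Theta is
    linear; the degree in the coordinates of V_i is the number of blocks of index i. *)
Lemma phi_regular : @regular_map C (flag_space C n) (proj_space M) (@flag_variety C n) phi.
Proof.
pose F (j : mp_crd (proj_space M)) : Defs.form (flag_space C n) :=
  \sum_(S : {ffun pos k -> 'I_D})
    (coord (vbasis {:M}) j (Theta [ffun S' => (S' == S)%:R]))%:MP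
    * \prod_(r < K) cform (crd r S).
have FE V x : @mp_hc _ (flag_space C n) V x -> exists A : mats,
    bases_of V A /\ forall j, form_eval (F j) x = coord (vbasis {:M}) j (Theta (mvec A)).
  move=> /pluecker_bases[A [bA xA]]; exists (fun r => A (ir r)); split=> [r|j]; first exact: bA.
  rewrite form_eval_sum [X in Theta X]tpow_sum !linear_sum; apply: eq_bigr => S _.
  rewrite form_evalM form_evalC form_eval_prod !linearZ mulrC /= ffunE.
  by congr (_ * _); apply: eq_bigr => r _; rewrite form_eval_cform xA.
move=> V flV b; exists (fun i => 0 + \sum_(r < K) (ir r == i))%N, F; split.
- move=> j; apply: mhom_sum => S; apply: mhomM; first exact: mhomC.
  exact: mhom_prod (fun r => @mhom_cform C (flag_space C n) (crd r S)).
- have [x hx] := pluecker_exists flV; have [A [bA E]] := FE V x hx.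
  have [j jP] : exists j, coord (vbasis {:M}) j (Theta (mvec A)) != 0.
    apply: NNPP => no; case/eqP: (Theta_neq0 flV bA); rewrite -[LHS]cmb_coord /cmb big1 // => j _.
    by rewrite (_ : coord _ _ _ = 0) ?scale0r //; apply/eqP; apply: contraT => nz; case: no; exists j.
  by exists x, j; rewrite E; split=> //; case: b.
move=> V' x y flV' hx [y0 yE] _; have [A [bA E]] := FE V' x hx.
have [c c0 cE] := line_eq (Theta_neq0 flV' bA) (etrans (esym (phiE bA)) yE).
exists c => // j _; rewrite E -(coord_cmb y).
by rewrite -[cmb y]/(\sum_j y j *: (vbasis {:M})`_j) cE linearZ.
Qed.

(* Meant for prow j = ir r, where pcol j replaces the block r of S; going     *)
(* through [insub] avoids a cast along this equality.                         *)
Definition upd_blk S (r : 'I_K) (j : pidx) : {ffun pos k -> 'I_D} :=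
  [ffun q => if tag q == r then
     (if insub (val (tagged q)) : option 'I_(n.*2 - prow j) is Some i then pcol j i else S q)
   else S q].

Lemma slot_upd_blk S r j r' : r' != r -> slot (upd_blk S r j) r' = slot S r'.
Proof. by move=> ne; apply/ffunP => i; rewrite !ffunE /= (negPf ne). Qed.

Lemma slot_upd_blk_eq S r (s : {ffun 'I_(n.*2 - ir r) -> 'I_D}) :
  slot (upd_blk S r (existT _ (ir r) s)) r = s.
Proof. by apply/ffunP => i; rewrite !ffunE /= eqxx valK. Qed.

Lemma upd_blk_id S r : upd_blk S r (existT _ (ir r) (slot S r)) = S.
Proof.
apply/ffunP => -[r' i]; rewrite ffunE /=; case: eqP => // E; subst r'.
by rewrite valK /pcol /= ffunE.
Qed.

Definition phi_inv (l : {vspace M}) : flag C n :=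
  epsilon (inhabits [ffun=> fullv]) (fun V => is_flag V /\ phi V = l).

Lemma phi_invP l : Sch l -> is_flag (phi_inv l) /\ phi (phi_inv l) = l.
Proof.
move=> /phi_surj[V flV E]; exact: (epsilon_spec (inhabits [ffun=> fullv])
  (fun V => is_flag V /\ phi V = l) (ex_intro _ V (conj flV E))).
Qed.

(** With the columns of all blocks but r frozen at a nonzero coordinate [S0], the coordinates of the
    tensor are those of V_(ir r) times the constant [c1] of frozen minors. *)
Lemma phi_inv_regular : @regular_map C (proj_space M) (flag_space C n) Sch phi_inv.
Proof.
move=> l cl i; have [[x0 hx0] _] := cl; have [x0_neq0 _] := hx0.
have [/eqP i0|/ir_surj[r <-{i}]] := posnP i.
  (* V_0 is the same for all flags: constant forms suffice. *)
  have {i0} -> : i = ord0 by apply: val_inj; apply/eqP.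
  have [A0 bA0] : exists A : 'M[C]_(n.*2 - (ord0 : 'I_n.+1), D), basis_mx (fullv : {vspace V0 C n}) A.
    by have [B bB] := basis_mx_dim (etrans (dim_V0 C n_gt0) (esym (subn0 _))); exists (bmx B); apply: basis_bmx.
  pose a0 (m : nat) c : C := if insub m : option 'I_(n.*2 - (ord0 : 'I_n.+1)) is Some i then A0 i c else 0.
  pose F (j : mp_crd (flag_space C n)) : Defs.form (proj_space M) :=
    (\det (\matrix_(i, c) a0 i (pcol j c)))%:MP.
  have FE (s : {ffun 'I_(n.*2 - (ord0 : 'I_n.+1)) -> 'I_D}) x :
      form_eval (F (existT _ ord0 s)) x = \det (colsub s A0).
    by rewrite form_evalC; congr (\det _); apply/matrixP => i' c; rewrite !mxE /a0 valK.
  exists (fun=> 0%N), F; split=> [j||l' x y cl' hx hy _].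
  - exact: mhomC.
  - have [s s0] := row_free_minor (proj1 bA0).
    by exists x0, (existT _ ord0 s); rewrite FE.
  have [A [bA yA]] := pluecker_bases hy; have [[V0f _] _] := phi_invP cl'.
  have := bA ord0; rewrite V0f => bA'; have [G GU GE] := basis_mx_scale bA0 bA'.
  exists (\det G); first by rewrite -unitfE.
  case=> i' s /= E; subst i'; rewrite FE yA /= /pcol /= GE.
  by rewrite -mulmx_colsub det_mulmx.
have [S0 S0P] := Psi_coord x0_neq0.
pose F (j : mp_crd (flag_space C n)) : Defs.form (proj_space M) := lform (upd_blk S0 r j).
exists (fun=> 1%N), F; split=> [j||l' x y cl' hx hy].
- exact: mhom_lform.
- by exists x0, (existT _ (ir r) (slot S0 r)); rewrite /F lform_eval upd_blk_id.
have [A [bA yA]] := pluecker_bases hy; have [flV phiV] := phi_invP cl'.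
have bA' : bases_of (phi_inv l') (fun r => A (ir r)) by move=> r'; apply: bA.
have [x_neq0 xE] := hx; rewrite -phiV (phiE bA') in xE.
have [c c0 cE] := line_eq (Theta_neq0 flV bA') xE.
pose c1 := \prod_(r' < K | r' != r) \det (colsub (slot S0 r') (A (ir r'))).
have FE (s : {ffun 'I_(n.*2 - ir r) -> 'I_D}) :
    form_eval (F (existT _ (ir r) s)) x = c * c1 * y (existT _ (ir r) s).
  rewrite /F lform_eval -[cmb x]/(\sum_j x j *: (vbasis {:M})`_j) cE linearZ /= (flag_im flV bA').
  rewrite ffunE -[LHS]/(c * _) -mulrA; congr (_ * _); rewrite ffunE (bigD1 r) //= mulrC.
  rewrite slot_upd_blk_eq yA; congr (_ * _); apply: eq_bigr => r' ne.
  by rewrite slot_upd_blk.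
case=> -[i' s'] /= E; subst i'; rewrite FE => nz.
have c10 : c1 != 0 by apply: contraNneq nz => ->; rewrite mulr0 mul0r.
exists (c * c1)^-1; first by rewrite invr_eq0 mulf_neq0.
case=> i' s /= E; subst i'; rewrite FE mulrA mulVf ?mul1r //.
by rewrite mulf_neq0.
Qed.

Lemma flag_embedding : [/\ @variety_iso C (flag_space C n) (proj_space M) (@flag_variety C n) Sch phi,
  forall g Tm (V : flag C n), act g Tm -> flag_variety V -> phi (flag_act g V) = (Tm @: phi V)%VS
  & phi (flag_P C n) = <[vac]>%VS].
Proof.
split; [|exact: phi_act|exact: phi_P]; exists phi_inv; split.
- move=> V flV; split; first exact: phi_closure.
  have [flV' E] := phi_invP (phi_closure flV); exact: phi_inj.
- exact: phi_invP.
- exact: phi_regular.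
- exact: phi_inv_regular.
Qed.

End Embedding.

Section FusionEmbedding.
Variables (C : numFieldType) (n : nat) (a : 'I_n -> nat) (z : 'I_n -> C).

Lemma bsize_gt0 (r : 'I_(nblk a)) : (0 < bsize a r)%N.
Proof.
have n_gt0 : (0 < #|'I_n|)%N.
  rewrite card_ord; case: n a r => // a' [r]; rewrite /nblk big_ord0 //.
have [i E] := eq_bigmax a n_gt0; apply/card_gt0P; exists i; rewrite inE -E.
by have := ltn_ord r; rewrite /nblk; lia.
Qed.

Definition blk_row (r : 'I_(nblk a)) : 'I_n.+1 := Ordinal (bsize_le a r : (bsize a r < n.+1)%N).

(** The embedding is psi followed by the change from monomials to the coordinates of [flag_space];
    by [bsize_surj] every V_m with m = 1, ..., n has a block, so the tensor determines the flag. *)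
Lemma fusion_embedding (M : fusion_product a z) : (0 < n)%N ->
  (forall i j : 'I_n, (i < j)%N -> (a i < a j)%N) -> (forall i, (1 < a i)%N) -> injective z ->
  exists phi : mp_pt (flag_space C n) -> mp_pt (proj_space M),
    [/\ variety_iso (@flag_variety C n) (schubert M) phi,
        forall (g : 'M[trunc C n]_2) (T : 'End(M)) (V : flag C n),
          group_act M g T -> flag_variety V -> phi (flag_act g V) = (T @: phi V)%VS
      & phi (flag_P C n) = <[fp_vac M]>%VS].
Proof.
move=> n_gt0 a_incr a_gt1 z_inj.
have a_gt0 i : (0 < a i)%N by apply: ltnW.
have [f [f_inj f_vac f_act]] := psi_group n_gt0 a_incr a_gt0 z_inj M.
have lin : linear (fun m => tp (nc_mx C n) (f m) : tpow C (pos (@bdim n a)) (\dim {:V0 C n})).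
  by move=> c u v; rewrite !linearP.
have [Psi PsiE] := lfun_of_linear lin.
have tpK u : tp (cn_mx C n) (tp (nc_mx C n) u) = u :> tpow C (pos (@bdim n a)) (n + n).
  by rewrite -tpM nc_cn // tp1.
have Psi_inj : injective Psi.
  by move=> u v; rewrite !PsiE => /(congr1 (tp (cn_mx C n))); rewrite !tpK => /f_inj.
have ir_surj (i : 'I_n.+1) : (0 < i)%N -> exists r, blk_row r = i.
  move=> i0; have [r E] := bsize_surj a_incr a_gt1 i0 (leq_ord i).
  by exists r; apply: val_inj.
eexists; apply: (@flag_embedding C n (nblk a) blk_row n_gt0 bsize_gt0 ir_surj M Psi (fp_vac M)
  (group_act M) Psi_inj).
- by move=> g Tm; apply: group_act_det.
- by move=> p; exists (nexp (fp_actp M (delta_mx 0 1) p)); apply: GActUp.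
- by rewrite PsiE f_vac /vac_vec tp_mvec.
- by move=> g Tm m gT; rewrite !PsiE (f_act _ _ _ gT) -!tpM nc_cg.
Qed.

End FusionEmbedding.

Local Open Scope complex_scope.

Theorem theorem1p2 (R : realType) (n : nat) (a : 'I_n -> nat)
    (z : 'I_n -> R[i]) (M : fusion_product a z) :
  (0 < n)%N ->
  (forall i j : 'I_n, (i < j)%N -> (a i < a j)%N) ->
  (forall i : 'I_n, (1 < a i)%N) ->
  injective z ->
  exists phi : mp_pt (flag_space R[i] n) -> mp_pt (proj_space M),
    [/\ variety_iso (@flag_variety R[i] n) (schubert M) phi,
        forall (g : 'M[trunc R[i] n]_2) (T : 'End(M)) (V : flag R[i] n),
          group_act M g T -> flag_variety V ->
          phi (flag_act g V) = (T @: phi V)%VS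
      & phi (flag_P R[i] n) = <[fp_vac M]>%VS].
Proof.
exact: fusion_embedding.
Qed.
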